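(* Let $m,n$ be positive integers, let $\theta=\frac{\max\{n+1,m+2\}}{m}$, and let $\Phi:\mathbb{N}\to(0,\infty)$ satisfy $\Phi(t)\le t^{-n/m}$ for $t\ge1$, with $\tau=\liminf_{t\to\infty}\frac{-\log\Phi(t)}{\log t}$. (a) If $\tau>\theta$ and $\Phi$ is decreasing, then $\dim_H(Exact(\Phi))\ge m(n-1)+\frac{m+1}{1+\tau}$ (with the last fraction $0$ if $\tau=\infty$). (b) If $\tau>\max\{\theta,\frac{5+\sqrt{17}}{2}\}$ ($\Phi$ not necessarily decreasing), then $\dim_H(Exact(\Phi))\ge m(n-1)$ and $\dim_P(Exact(\Phi))=mn$.
   Context: All norms are maximum norms. For $\Psi:\mathbb{N}\to(0,\infty)$, $W(\Psi)$ is the set of real $m\times n$ matrices $A$ such that $\Vert A\mathbf{q}-\mathbf{p}\Vert\le\Psi(\Vert\mathbf{q}\Vert)$ for infinitely many $\mathbf{p}\in\mathbb{Z}^m$, $\mathbf{q}\in\mathbb{Z}^n\setminus\{0\}$. $Exact(\Phi)=W(\Phi)\setminus\bigcup_{c>1}W(\Phi/c)$, where $\Phi/c$ is $t\mapsto\Phi(t)/c$. Matrices are identified with $\mathbb{R}^{mn}$; $\dim_H,\dim_P$ are Hausdorff and packing dimension. *)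

(* Defs.v *)
From HB Require Import structures.
From mathcomp Require Import all_boot all_order all_algebra.
From mathcomp Require Import all_classical all_reals all_analysis.
Unset Printing Implicit Defensive.
Import Order.TTheory GRing.Theory Num.Theory.
Local Open Scope classical_set_scope.
Local Open Scope ring_scope.

Section Defs.
Variable R : realType.

Definition vnorm (k : nat) (v : 'cV[R]_k) : R :=
  \big[Num.max/0]_(i < k) `|v i ord0|.

Definition qnorm (k : nat) (q : 'cV[int]_k) : nat :=
  \max_(i < k) `|q i ord0|%N.

Definition mdist (m n : nat) (A B : 'M[R]_(m, n)) : R :=
  \big[Num.max/0]_(ij : 'I_m * 'I_n) `|A ij.1 ij.2 - B ij.1 ij.2|.

Definition W (m n : nat) (Psi : nat -> R) : set 'M[R]_(m, n) :=
  [set A : 'M[R]_(m, n) | ~ finite_set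
     [set pq : 'cV[int]_m * 'cV[int]_n |
        pq.2 != 0 /\
        vnorm m (A *m map_mx intr pq.2 - map_mx intr pq.1) <= Psi (qnorm n pq.2)]].

Definition Exact (m n : nat) (Phi : nat -> R) : set 'M[R]_(m, n) :=
  W m n Phi `\` \bigcup_(c in [set c : R | 1 < c]) W m n (fun t => Phi t / c).

Section Dim.
Variables m n : nat.
Local Notation M := 'M[R]_(m, n).

Definition rdiam (U : set M) : R :=
  sup [set r | exists x y, U x /\ U y /\ r = mdist m n x y].

Definition dcost (s : R) (U : set M) : R :=
  if asbool (U = set0) then 0 else rdiam U `^ s.

Definition Hcontent (s delta : R) (E : set M) : \bar R :=
  ereal_inf [set (\sum_(i <oo) (dcost s (U i))%:E)%E | U in
    [set U : nat -> set M |
       E `<=` \bigcup_i U i /\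
       forall i x y, U i x -> U i y -> mdist m n x y <= delta]].

Definition Hmeasure (s : R) (E : set M) : \bar R :=
  ereal_sup [set Hcontent s delta E | delta in [set d : R | 0 < d]].

Definition dimH (E : set M) : \bar R :=
  ereal_inf [set s%:E | s in [set s : R | 0 <= s /\ Hmeasure s E = 0%E]].

(* delta-packings of E: finitely many pairwise disjoint closed balls with
   centres in E and radii in (0, delta]; the supremum over finite packings
   equals the supremum over countable ones. *)
Definition Ppre_delta (s delta : R) (E : set M) : \bar R :=
  ereal_sup [set v : \bar R | exists (k : nat) (x : 'I_k -> M) (r : 'I_k -> R),
     (forall i, E (x i) /\ 0 < r i <= delta) /\
     (forall i j, i != j -> ~ exists y, mdist m n y (x i) <= r i /\ mdist m n y (x j) <= r j) /\
     v = (\sum_(i < k) (2 * r i) `^ s)%:E].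

(* packing premeasure P^s_0 = lim_{delta -> 0} (decreasing in delta) *)
Definition Ppre (s : R) (E : set M) : \bar R :=
  ereal_inf [set Ppre_delta s delta E | delta in [set d : R | 0 < d]].

Definition Pmeasure (s : R) (E : set M) : \bar R :=
  ereal_inf [set (\sum_(i <oo) Ppre s (F i))%E | F in
    [set F : nat -> set M | E `<=` \bigcup_i F i]].

Definition dimP (E : set M) : \bar R :=
  ereal_inf [set s%:E | s in [set s : R | 0 <= s /\ Pmeasure s E = 0%E]].
End Dim.

Definition tau (Phi : nat -> R) : \bar R :=
  limn_einf (fun t : nat => ((- ln (Phi t)) / ln (t%:R))%:E).
End Defs.

(* Main.v *)
(* Fix t with theta < t < tau: eventually Phi q <= q^-t, and t m > max(n + 1, m + 2).

   One column.  Inside a cube of radius b, Dirichlet's theorem attaches to every point a rational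
   point with denominator at most N^m.  Removing the neighbourhoods of the rational points with
   denominator below N^m / dens costs only part of the volume, because t m > m + 2; what is left
   yields about (b N^(m+1))^m rational points at mutual distance of order N^-(m+1), none of them with
   a small denominator.  Around such a point x, let r be the largest Phi q / q over the denominators
   q of x.  A cube in the shell (1 - eps) r <= |al - x| <= r consists of points al which x
   approximates within Phi, while no fraction with denominator between the two scales approximates
   them better than (1 - eps) Phi.  Along a chain of such cubes with eps -> 0 the limit point is in
   Exact Phi.  Choosing the next cube greedily steers the limit away from prescribed sets: a set
   covered by few balls misses some subcube, and for weighted sets some subcube does not increase the
   weighted sum of the expected hits, as in the mass distribution principle.

   Further columns.  If A is in Exact Phi, then for most v so is (v | A): solutions of A are
   solutions of (v | A) with first coordinate 0, and since t m >= n + 2 a Borel-Cantelli estimate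
   removes all large solutions with nonzero first coordinate.  Averaging over v turns a lower bound s
   for the dimension into s + m.  *)

Require Import Defs.
From HB Require Import structures.
From mathcomp Require Import all_boot all_order all_algebra.
From mathcomp Require Import all_classical all_reals all_analysis.
From mathcomp Require Import measurable_realfun ring lra zify.
Import Order.TTheory GRing.Theory Num.Theory.
Local Open Scope classical_set_scope.
Local Open Scope ring_scope.

(** No measure on the exact set is constructed. Frostman's lemma appears in a dual form, as a
    covering property with arbitrary weights; it survives averaging over a further column. The
    obstacle in one column is that the spacing 1/q of the fractions with denominator q may exceed
    the radius b of the cube. Each q must then be charged about q b + 1 fractions per coordinate,
    and the summand 1, too large on average, cannot be dropped. Summed over q >= T it has to stay
    small compared with b^m; this is the last inequality of [good_cube], and t m > m + 2 lets the
    next cube inherit it. The exponent (m + 1) / (1 + tau) compares two powers of Q = N^m: there are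
    about Q^(m+1) subcubes, of radius about Q^-(1+tau). As tau is a lower limit, [Phi] Q is that
    large only for suitable Q, so N is chosen anew at every stage, and monotonicity carries the
    bound from a suitable q to the m-th power below it. For the packing dimension only the number of
    subcubes against their mutual distance counts, and its exponent is m for every N. *)

(** * Averaging and packing *)

(* For a >= 0 this says that the series of a is at most K, over any countable index set. *)
Definition sums_le {R : realType} {I : eqType} (a : I -> R) (K : R) :=
  forall s : seq I, uniq s -> \sum_(i <- s) a i <= K.

Lemma sum_uniq_sub {R : realType} {I : eqType} (a : I -> R) (s s' : seq I) :
  (forall i, 0 <= a i) -> uniq s -> {subset s <= s'} ->
  \sum_(i <- s) a i <= \sum_(i <- s') a i.
Proof.
move=> a0; elim: s s' => [|x s IHs] s' /=.
  by move=> _ _; rewrite big_nil sumr_ge0.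
move=> /andP[xs us] sub.
have xs' : x \in s' by apply: sub; rewrite mem_head.
rewrite big_cons (perm_big _ (perm_to_rem xs')) big_cons lerD2l.
apply: IHs => // y ys.
have := sub y; rewrite inE ys orbT => /(_ isT) ys'.
have := perm_mem (perm_to_rem xs') y; rewrite ys' inE => /esym /orP[/eqP yx|//].
by rewrite -yx ys in xs.
Qed.

(* Markov's inequality on [a, a + l]. *)
Lemma exists_coord {R : realType} {I : countType} (w v : I -> R)
    (V : I -> set R) (a l K C : R) :
  0 <= l -> (forall i, 0 <= w i) ->
  (forall i, measurable (V i)) ->
  (forall i, (lebesgue_measure (V i) <= (v i)%:E)%E) ->
  sums_le (fun i => w i * v i) K -> K < C * l ->
  exists2 t, a <= t <= a + l & sums_le (fun i => w i * \1_(V i) t) C.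
Proof.
move=> l0 w0 mV vV sumK KC; apply: contrapT => noT.
pose D := `[a, a + l]%classic : set R.
have mD : measurable D by exact: measurable_itv.
(* The series is indexed by nat through the codes of I; numbers that code no index contribute 0. *)
pose f (k : nat) (t : measurableTypeR R) : \bar R := (oapp (fun i => w i * \1_(V i) t) 0 (pickle_inv k))%:E.
have f0 k t : (0 <= f k t)%E.
  by rewrite /f lee_fin; case: pickle_inv => //= i; rewrite mulr_ge0.
have mf k : measurable_fun D (f k).
  rewrite /f; case: (pickle_inv k) => [i|] /=; last exact: measurable_cst.
  apply/measurable_EFinP; apply: measurable_funM; first exact: measurable_cst.
  exact: measurable_indic.
have fC t : D t -> (C%:E <= \sum_(0 <= k <oo) f k t)%E.
  rewrite /D /= in_itv /= => aD.
  have [s us Cs] : exists2 s : seq I, uniq s & C < \sum_(i <- s) (w i * \1_(V i) t).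
    apply: contrapT => h; apply: noT; exists t => // s us.
    by rewrite leNgt; apply/negP => h'; apply: h; exists s.
  pose n := (\max_(i <- s) pickle i).+1.
  apply: le_trans (nneseries_lim_ge n (fun k _ _ => f0 k t)).
  rewrite /f sumEFin lee_fin; apply: (le_trans (ltW Cs)).
  rewrite /index_iota subn0 -(big_pmap (@pickle_inv I)) sum_uniq_sub //.
    by move=> i; rewrite mulr_ge0.
  move=> i iS; rewrite mem_pmap; apply/mapP; exists (pickle i); last by rewrite pickleK_inv.
  by rewrite mem_iota /= add0n /n ltnS; apply: leq_bigmax_seq.
have : (\int[lebesgue_measure]_(x in D) (cst C%:E) x
        <= \int[lebesgue_measure]_(x in D) (\sum_(0 <= k <oo) f k x))%E.
  have [C0|C0] := leP 0 C.
    apply: ge0_le_integral => //.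
    exact: (@ge0_emeasurable_sum _ _ _ D f predT).
  apply: (@le_trans _ _ 0%E); last by apply: integral_ge0 => x _; apply: nneseries_ge0.
  by rewrite integral_cst // mule_le0_ge0 // lee_fin ltW.
rewrite integral_cst // integral_nneseries //.
have hD : lebesgue_measure D = l%:E.
  rewrite /D lebesgue_measure_itv /= lte_fin ltrDl.
  case: ltP => [l1|l1]; first by rewrite -EFinB; congr _%:E; ring.
  by congr _%:E; apply/eqP; rewrite eq_le l0.
rewrite [X in (_ * X)%E]hD -EFinM.
move=> h; have : ((C * l)%:E <= K%:E)%E; last by rewrite lee_fin leNgt KC.
apply: (le_trans h).
apply: lime_le.
  by apply: is_cvg_nneseries => n _ _; apply: integral_ge0.
near=> n.
apply: (@le_trans _ _ (\sum_(0 <= k < n) (oapp (fun i => (w i * v i)%R) 0%R (@pickle_inv I k))%:E)%E).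
  apply: lee_sum => k _; rewrite /f.
  case: (pickle_inv k) => [i|] /=; last by rewrite integral0.
  have mI : measurable_fun D (\1_(V i) : R -> R) by exact: measurable_indic.
  under eq_integral do rewrite EFinM.
  rewrite ge0_integralZl_EFin//; last first.
    by apply/measurable_EFinP; exact: mI.
  have hI : (\int[lebesgue_measure]_(x in D) (\1_(V i) x)%:E <= (v i)%:E)%E.
    have := integral_indic lebesgue_measure mD (mV i) => ->.
    apply: le_trans (vV i); apply: le_measure; rewrite ?inE //.
    - by apply: measurableI => //; exact: mV.
    - exact: mV.
  have -> : (w i * v i)%:E = ((w i)%:E * (v i)%:E)%E by [].
  by apply: lee_wpmul2l => //; rewrite lee_fin.
rewrite sumEFin lee_fin /index_iota subn0 -(big_pmap (@pickle_inv I)).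
apply: sumK; apply: (pmap_uniq (@pickle_invK I)); exact: iota_uniq.
Unshelve. all: by end_near. Qed.

(* Markov's inequality on a cube, applied to one coordinate after the other. *)
Lemma exists_point {R : realType} {I : countType} {J : finType} (w v : I -> R)
    (V : I -> J -> set R) (a : J -> R) (l K C : R) :
  0 < l -> (forall i, 0 <= w i) -> (forall i, 0 <= v i) ->
  (forall i j, measurable (V i j)) ->
  (forall i j, (lebesgue_measure (V i j) <= (v i)%:E)%E) ->
  sums_le (fun i => w i * v i ^+ #|J|) K -> K < C * l ^+ #|J| ->
  exists2 x : J -> R, forall j, a j <= x j <= a j + l &
    sums_le (fun i => w i * \prod_j \1_(V i j) (x j)) C.
Proof.
move=> l0 w0 v0 mV vV; have -> : #|J| = size (index_enum J) by rewrite -sum1_size -sum1_card; apply: eq_bigl.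
have: uniq (index_enum J) by exact: index_enum_uniq.
move: (index_enum J) (@mem_index_enum J) => js Jjs ujs sumK KC.
suff [x xjs xC] : exists2 x : J -> R, forall j, j \in js -> a j <= x j <= a j + l &
    sums_le (fun i => w i * \prod_(j <- js) \1_(V i j) (x j)) C.
  by exists x => // j; apply: xjs.
elim: js ujs w w0 K C sumK KC {Jjs} => [|j js IH] /=.
  move=> _ w w0 K C sumK; rewrite expr0 mulr1 => KC.
  exists (fun=> 0) => // s us; under eq_bigr do rewrite big_nil.
  by apply: ltW; apply: le_lt_trans KC; apply: sumK.
move=> /andP[jjs ujs] w w0 K C sumK KC.
(* The midpoint leaves a strict inequality both for the coordinates in js and for j. While those in
   js are chosen, the factor [v i] of coordinate j is part of the weight. *)
pose C' := (K / l ^+ size js + C * l) / 2.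
have ln0 : 0 < l ^+ size js by exact: exprn_gt0.
have KC1 : K / l ^+ size js < C * l by rewrite ltr_pdivrMr // -mulrA -exprS.
have KC' : K < C' * l ^+ size js by rewrite -ltr_pdivrMr // /C'; lra.
have wv0 i : 0 <= w i * v i by rewrite mulr_ge0.
have sumK' : sums_le (fun i => w i * v i * v i ^+ size js) K.
  by move=> s us; under eq_bigr do rewrite -mulrA -exprS; exact: sumK.
have [x xjs xC'] := IH ujs _ wv0 K C' sumK' KC'.
pose w' i := w i * \prod_(j <- js) \1_(V i j) (x j).
have w'0 i : 0 <= w' i by rewrite mulr_ge0 // prodr_ge0.
have sumC' : sums_le (fun i => w' i * v i) C'.
  by move=> s us; under eq_bigr do rewrite mulrAC; exact: xC'.
have C'C : C' < C * l by rewrite /C'; lra.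
have [t tj tC] := exists_coord _ _ _ (a j) _ _ _ (ltW l0) w'0 (fun i => mV i j) (fun i => vV i j) sumC' C'C.
exists (fun j' => if j' == j then t else x j').
  by move=> j'; rewrite inE; case: eqP => [->|_ /xjs].
move=> s us; move: (tC s us); congr (_ <= _); apply: eq_bigr => i _.
rewrite big_cons eqxx /w' -mulrA; congr (_ * _); rewrite mulrC; congr (_ * _).
rewrite big_seq [RHS]big_seq; apply: eq_bigr => j' j'js.
by case: eqP => // jj; rewrite -jj j'js in jjs.
Qed.

Lemma measure_intervals {R : realType} (c : nat -> R) (r : R) (K : nat) :
  0 <= r ->
  measurable (\bigcup_(k < K) `[c k - r, c k + r]%classic : set R) /\
  (lebesgue_measure (\bigcup_(k < K) `[(c k - r)%R, (c k + r)%R]%classic : set R)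
     <= (K%:R * (2 * r))%:E)%E.
Proof.
move=> r0; rewrite bigcup_mkord; elim: K => [|K [IHm IH]].
  by rewrite big_ord0 mul0r; split => //; rewrite measure0.
rewrite big_ord_recr /=.
have mI : measurable (`[c K - r, c K + r]%classic : set R) by exact: measurable_itv.
split; first exact: measurableU.
apply: (le_trans (measureU2 _ _ _)) => //.
rewrite -natr1 mulrDl EFinD; apply: leeD => //.
have /= := @lebesgue_measure_itv R `[(c K - r)%R, (c K + r)%R] => ->.
rewrite lte_fin; case: ltP => _; last by rewrite lee_fin mul1r mulr_ge0.
by rewrite -EFinB lee_fin; lra.
Qed.

(** About q l fractions fall into the interval, each contributing length 2 r; the 3 covers the
    rounding at the ends. The shift s is needed for further columns, where the multiples of the new
    column are translated by those of the old ones. *)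
Lemma near_fractions {R : realType} (q s r a l : R) :
  0 < q -> 0 <= r -> 0 <= l ->
  exists V : set R, [/\ measurable V,
    (lebesgue_measure V <= ((q * l + 2 * q * r + 3) * (2 * r))%:E)%E &
    forall t (p : int), a <= t <= a + l -> `|t - (p%:~R + s) / q| <= r -> V t].
Proof.
move=> q0 r0 l0.
pose p0 : int := Num.floor (q * (a - r) - s).
pose c (k : nat) : R := ((p0 + k)%:~R + s) / q.
have : 0 <= q * l + 2 * q * r by rewrite addr_ge0 // !mulr_ge0 // ltW.
move=> L0; pose K := (Num.truncn (q * l + 2 * q * r)).+3.
have [mV vV] := measure_intervals c r K r0.
exists (\bigcup_(k < K) `[c k - r, c k + r]%classic); split => //.
  apply: (le_trans vV); rewrite lee_fin ler_wpM2r ?mulr_ge0 //.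
  by rewrite /K -addn3 natrD lerD2r Num.Theory.truncn_le.
move=> t p /andP[ta tal]; rewrite ler_distl => /andP[h1 h2].
have pq : (p%:~R + s) / q * q = p%:~R + s by rewrite mulfVK // gt_eqF.
have f1 : p0%:~R <= q * (a - r) - s by exact: Num.Theory.floor_le.
have f2 : q * (a - r) - s < p0%:~R + 1.
  by have := Num.Theory.floorD1_gt (q * (a - r) - s); rewrite intrD.
have P1 : q * (a - r) - s <= p%:~R.
  rewrite lerBlDr -pq mulrC ler_pM2r //; lra.
have P2 : p%:~R <= q * (a + l + r) - s.
  rewrite lerBrDr -pq mulrC ler_pM2l //; lra.
have p0p : p0 <= p.
  by rewrite -(ler_int R); apply: le_trans P1.
exists `|p - p0|%N; last first.
  rewrite /= /c in_itv /=; have -> : (p0 + `|p - p0|%N) = p.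
    by rewrite gez0_abs ?subr_ge0 //; ring.
  by apply/andP; split; lra.
rewrite /= -(ltr_nat R) natr_absz ger0_norm ?subr_ge0 // intrB /K.
have := Num.Theory.truncnS_gt (q * l + 2 * q * r).
rewrite -!(natr1 (Num.truncn _).+2) -(natr1 (Num.truncn _).+1); lra.
Qed.

Lemma measure_ball1 {R : realType} (c r : R) : 0 <= r ->
  lebesgue_measure (`[c - r, c + r]%classic : set R) = (2 * r)%:E.
Proof.
move=> r0; have /= := @lebesgue_measure_itv R `[(c - r)%R, (c + r)%R] => ->.
rewrite lte_fin; case: ltP => h; rewrite -?EFinB; congr _%:E; lra.
Qed.

(** The complements of the intervals in [a, a + l] have small weighted measure, so by [exists_coord]
    some t lies in few of them, hence in many of the intervals. *)
Lemma exists_coord_ge {R : realType} {k : nat} (w c r : 'I_k -> R) (a l C : R) :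
  0 <= l -> (forall i, 0 <= w i) -> (forall i, 0 <= r i) ->
  (forall i, a <= c i - r i) -> (forall i, c i + r i <= a + l) ->
  C * l < \sum_i w i * (2 * r i) ->
  exists t, C <= \sum_i w i * \1_(`[c i - r i, c i + r i]%classic) t.
Proof.
move=> l0 w0 r0 ac ca Cl.
pose I i : set R := `[c i - r i, c i + r i]%classic.
pose D : set R := `[a, a + l]%classic.
have mI i : measurable (I i) by exact: measurable_itv.
have mD : measurable D by exact: measurable_itv.
have ID i : I i `<=` D.
  move=> t; rewrite /I /D /= !in_itv /= => /andP[h1 h2].
  by have := ac i; have := ca i; move=> h3 h4; apply/andP; split; lra.
have mV i : measurable (D `\` I i) by exact: measurableD.
have lD : lebesgue_measure D = l%:E.
  rewrite /D; have -> : `[a, a + l]%classic = `[(a + l / 2) - l / 2, (a + l / 2) + l / 2]%classic :> set R.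
    by rewrite addrK -addrA -splitr.
  by rewrite measure_ball1 ?divr_ge0 //; congr _%:E; lra.
have vV i : (lebesgue_measure (D `\` I i) <= (l - 2 * r i)%:E)%E.
  rewrite measureD //; [|exact: mI|by rewrite [X in (X < _)%E]lD ltry].
  rewrite setIidr // EFinB; apply: leeB; first by rewrite -lD.
  by rewrite -(measure_ball1 (c i)).
have v0 i : 0 <= l - 2 * r i by have := ac i; have := ca i; lra.
pose W := \sum_i w i.
have sumK : sums_le (fun i => w i * (l - 2 * r i)) (\sum_i w i * (l - 2 * r i)).
  move=> s us; apply: sum_uniq_sub => // [i|i _]; first by rewrite mulr_ge0.
  by rewrite mem_index_enum.
have KC : \sum_i w i * (l - 2 * r i) < (W - C) * l.
  rewrite mulrBl /W mulr_suml -[ltLHS]addr0.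
  have -> : \sum_i w i * (l - 2 * r i) = \sum_i w i * l - \sum_i w i * (2 * r i).
    by rewrite -sumrB; apply: eq_bigr => i _; rewrite mulrBr.
  lra.
have [t /andP[t1 t2] tC] := exists_coord _ _ _ a _ _ _ l0 w0 mV vV sumK KC.
exists t; have := tC (index_enum 'I_k) (index_enum_uniq _).
have -> : \sum_i w i * \1_(D `\` I i) t = W - \sum_i w i * \1_(I i) t.
  rewrite /W -sumrB; apply: eq_bigr => i _.
  rewrite -[X in X - _]mulr1 -mulrBr; congr (_ * _).
  have Dt : (t \in D) by rewrite inE /D /= in_itv /= t1.
  rewrite !indicE in_setD Dt /=.
  by case: (t \in I i); rewrite /= ?subrr ?subr0.
rewrite /I; lra.
Qed.

(* If the volumes added up to more, some point would lie in two of the balls by averaging. *)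
Lemma packing_volume {R : realType} {J : finType} (k : nat) (x : 'I_k -> J -> R)
    (r : 'I_k -> R) (a : J -> R) (l : R) :
  0 < l -> (forall i, 0 <= r i) ->
  (forall i j, a j <= x i j - r i) -> (forall i j, x i j + r i <= a j + l) ->
  (forall i i', i != i' ->
     ~ exists y : J -> R, forall j, `|y j - x i j| <= r i /\ `|y j - x i' j| <= r i') ->
  \sum_i (2 * r i) ^+ #|J| <= l ^+ #|J|.
Proof.
move=> l0 r0 ax xa disj; rewrite leNgt; apply/negP => big.
suff [y yC] : exists y : J -> R, 1 < \sum_i \prod_j \1_(`[x i j - r i, x i j + r i]%classic) (y j) :> R.
  pose f i : R := \prod_j \1_(`[x i j - r i, x i j + r i]%classic) (y j).
  have f01 i : f i = 0 \/ f i = 1 /\ forall j, `|y j - x i j| <= r i.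
    case: (pselect (forall j, `|y j - x i j| <= r i)) => h.
      right; split => //; rewrite /f big1 // => j _.
      by rewrite indicE mem_set //= in_itv /= -ler_distl.
    left; have [j jh] : exists j, ~ `|y j - x i j| <= r i by apply/existsNP.
    rewrite /f (bigD1 j) //= indicE memNset ?mul0r //= in_itv /= -ler_distl.
    exact: jh.
  case: (pselect (exists i, f i = 1)) => [[i fi]|nf]; last first.
    move: yC; rewrite big1 ?ltr10 // => i _.
    by case: (f01 i) => // -[fi _]; case: nf; exists i.
  move: yC; rewrite (bigD1 i) //= -/(f i) fi ltrDl.
  suff -> : \sum_(i0 | i0 != i) \prod_j \1_(`[x i0 j - r i0, x i0 j + r i0]%classic) (y j) = 0 :> R by rewrite ltxx.
  apply: big1 => i' ii'; rewrite -/(f i').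
  case: (f01 i') => // -[_ h']; case: (f01 i) => [|[_ h]].
    by rewrite fi => /eqP; rewrite oner_eq0.
  by case: (disj i i'); rewrite 1?eq_sym //; exists y => j; split.
(* The midpoint of 1 and the ratio of the volumes exceeds 1 and still leaves a strict inequality for
   the averaging. *)
suff [y yC] : exists y : J -> R, (1 + (\sum_i (2 * r i) ^+ #|J|) / l ^+ #|J|) / 2
    <= \sum_i (1 * \prod_j \1_(`[x i j - r i, x i j + r i]%classic) (y j)) :> R.
  exists y; under eq_bigr do rewrite -[\prod_j _]mul1r.
  apply: lt_le_trans yC; have : 1 < (\sum_i (2 * r i) ^+ #|J|) / l ^+ #|J|.
    by rewrite ltr_pdivlMr ?mul1r // exprn_gt0.
  lra.
have : (1 + (\sum_i (2 * r i) ^+ #|J|) / l ^+ #|J|) / 2 * l ^+ #|J| < \sum_i 1 * (2 * r i) ^+ #|J|.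
  rewrite -mulrA [_^-1 * _]mulrC mulrA mulrDl mul1r mulfVK; last by rewrite gt_eqF // exprn_gt0.
  have -> : \sum_i 1 * (2 * r i) ^+ #|J| = \sum_i (2 * r i) ^+ #|J|.
    by apply: eq_bigr => i _; rewrite mul1r.
  by move: big; lra.
move: ((1 + _) / 2) => C.
(* Weights make the induction over the coordinates possible: they carry the factors of the
   coordinates not yet chosen. *)
suff H : forall w : 'I_k -> R, (forall i, 0 <= w i) ->
    C * l ^+ #|J| < \sum_i w i * (2 * r i) ^+ #|J| ->
    exists y : J -> R,
      C <= \sum_i w i * \prod_j \1_(`[x i j - r i, x i j + r i]%classic) (y j).
  exact: (H (fun=> 1) (fun=> ler01)).
move=> w w0.
have cJ : #|J| = size (index_enum J) by rewrite -sum1_size -sum1_card; apply: eq_bigl.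
rewrite cJ {cJ}; have: uniq (index_enum J) by exact: index_enum_uniq.
move: (index_enum J) => js.
elim: js w w0 C {big disj} => [|j js IH] /= w w0 C.
  move=> _; rewrite expr0 mulr1; under eq_bigr do rewrite expr0 mulr1.
  move=> h; exists (fun=> 0); under eq_bigr do rewrite big_nil mulr1; exact: ltW.
move=> /andP[jjs ujs] h.
have ln0 : 0 < l ^+ size js by exact: exprn_gt0.
pose S := \sum_i w i * (2 * r i) ^+ (size js).+1.
pose C' := (S / l ^+ size js + C * l) / 2.
have h1 : C * l < S / l ^+ size js by rewrite ltr_pdivlMr // -mulrA -exprS.
have w'0 i : 0 <= w i * (2 * r i) by rewrite !mulr_ge0.
have h2 : C' * l ^+ size js < \sum_i w i * (2 * r i) * (2 * r i) ^+ size js.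
  under eq_bigr do rewrite -mulrA -exprS.
  by rewrite -/S -ltr_pdivlMr // /C'; lra.
have [y yC'] := IH _ w'0 C' ujs h2.
pose w' i := w i * \prod_(j <- js) \1_(`[x i j - r i, x i j + r i]%classic) (y j).
have w''0 i : 0 <= w' i by rewrite mulr_ge0 // prodr_ge0.
have h3 : C * l < \sum_i w' i * (2 * r i).
  apply: (@lt_le_trans _ _ C'); first by rewrite /C'; lra.
  by apply: (le_trans yC'); rewrite le_eqVlt; apply/orP; left; apply/eqP/eq_bigr => i _; rewrite /w' mulrAC.
have [t tC] := exists_coord_ge _ _ _ _ _ _ (ltW l0) w''0 r0 (ax ^~ j) (xa ^~ j) h3.
exists (fun j' => if j' == j then t else y j').
apply: (le_trans tC); rewrite le_eqVlt; apply/orP; left; apply/eqP/eq_bigr => i _.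
rewrite big_cons eqxx /w' -mulrA; congr (_ * _); rewrite mulrC; congr (_ * _).
rewrite big_seq [RHS]big_seq; apply: eq_bigr => j' j'js.
by case: eqP => // jj; rewrite -jj j'js in jjs.
Qed.

(** * Distances, separated families and Dirichlet's theorem *)

Local Notation dist := (Defs.mdist _ _ _).

Lemma dist_leP {R : realType} {m n : nat} (A B : 'M[R]_(m, n)) (r : R) : 0 <= r ->
  (dist A B <= r) <-> (forall i j, `|A i j - B i j| <= r).
Proof.
move=> r0; rewrite /Defs.mdist; split=> [h i j|h].
  apply: le_trans h.
  by rewrite (bigD1 (i, j)) //= le_max lexx.
by elim/big_ind: _ => // x y hx hy; rewrite ge_max hx hy.
Qed.

Lemma dist_ge0 {R : realType} {m n : nat} (A B : 'M[R]_(m, n)) : 0 <= dist A B.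
Proof. by rewrite /Defs.mdist; elim/big_ind: _ => // x y hx hy; rewrite le_max hx. Qed.

Lemma dist_ge {R : realType} {m n : nat} (A B : 'M[R]_(m, n)) i j :
  `|A i j - B i j| <= dist A B.
Proof. by have /dist_leP := lexx (dist A B); apply; exact: dist_ge0. Qed.

Lemma distC {R : realType} {m n : nat} (A B : 'M[R]_(m, n)) :
  dist A B = dist B A.
Proof. by rewrite /Defs.mdist; apply: eq_bigr => i _; rewrite distrC. Qed.

Lemma dist_triangle {R : realType} {m n : nat} (B A C : 'M[R]_(m, n)) :
  dist A C <= dist A B + dist B C.
Proof.
apply/dist_leP; first by rewrite addr_ge0 ?dist_ge0.
by move=> i j; apply: le_trans (ler_distD (B i j) _ _) _; rewrite lerD ?dist_ge.
Qed.

Lemma distxx {R : realType} {m n : nat} (A : 'M[R]_(m, n)) : dist A A = 0.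
Proof.
apply/le_anti; rewrite dist_ge0 andbT; apply/dist_leP => // i j.
by rewrite subrr normr0.
Qed.

Definition separated {R : realType} {m n : nat} (r : R) : seq 'M[R]_(m, n) -> bool :=
  pairwise (fun x y => r < dist x y).

Lemma separated_nth {R : realType} {m n : nat} (r : R) (s : seq 'M[R]_(m, n)) x0 i j :
  separated r s -> (i < size s)%N -> (j < size s)%N -> i <> j ->
  r < dist (nth x0 s i) (nth x0 s j).
Proof.
move=> /(pairwiseP x0) h hi hj; case: (ltngtP i j) => // ij _.
  exact: h.
by rewrite distC; exact: h.
Qed.

(** The cap k on the size gives a finite family without any boundedness of G; a family that stays
    below the cap is maximal and therefore an r-net. *)
Lemma separated_maximal {R : realType} {m n : nat} (G : set 'M[R]_(m, n)) (r : R) (k : nat) :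
  exists s, [/\ (size s <= k)%N, separated r s, forall x, x \in s -> G x &
    (size s < k)%N -> forall x, G x -> exists2 y, y \in s & dist x y <= r].
Proof.
elim: k => [|k [s [sk sep sG scov]]]; first by exists [::].
have [sk'|sk'] := ltnP (size s) k.
  by exists s; split => // [|_ x Gx]; [exact: leqW|exact: scov].
case: (pselect (exists2 x, G x & forall y, y \in s -> r < dist x y)).
  move=> [x Gx xs]; exists (x :: s); split => //=.
  - by apply/andP; split => //; apply/allP.
  - by move=> y; rewrite inE => /orP[/eqP ->|/sG].
  - by rewrite ltnS ltnNge sk'.
move=> nx; exists s; split => // [|_ x Gx]; first exact: leqW.
apply: contrapT => h; apply: nx; exists x => // y ys.
by rewrite ltNge; apply/negP => yr; apply: h; exists y.
Qed.

(** The balls of radius d about the points are disjoint and lie in a cube of radius L + d. *)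
Lemma size_separated {R : realType} {m n : nat} (s : seq 'M[R]_(m, n)) (c : 'M[R]_(m, n)) (d L : R) :
  0 < d -> 0 <= L -> separated (2 * d) s ->
  (forall x, x \in s -> dist c x <= L) ->
  (size s)%:R * (2 * d) ^+ (m * n) <= (2 * (L + d)) ^+ (m * n).
Proof.
move=> d0 L0 sep sL.
pose x (i : 'I_(size s)) (j : 'I_m * 'I_n) := nth c s i j.1 j.2.
have xc (i : 'I_(size s)) j : `|c j.1 j.2 - x i j| <= L.
  apply: (le_trans (dist_ge _ _ _ _)); apply: sL; exact: mem_nth.
have := @packing_volume R _ (size s) x (fun=> d) (fun j => c j.1 j.2 - (L + d)) (2 * (L + d)).
rewrite card_prod !card_ord sumr_const card_ord.
have -> : (size s)%:R * (2 * d) ^+ (m * n) = (2 * d) ^+ (m * n) *+ size s by exact: mulr_natl.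
apply.
- by rewrite mulr_gt0 //; lra.
- by move=> _; exact: ltW.
- by move=> i j; have := xc i j; rewrite ler_distl => /andP[h1 h2]; lra.
- by move=> i j; have := xc i j; rewrite ler_distl => /andP[h1 h2]; lra.
move=> i i' ii' [y hy].
have ii : (i : nat) <> i' by move=> /val_inj /eqP; apply/negP.
have := separated_nth _ _ c i i' sep (ltn_ord i) (ltn_ord i') ii.
apply/negP; rewrite -leNgt; apply/dist_leP; first by rewrite mulr_ge0 // ltW.
move=> a b; have [h1 h2] := hy (a, b).
apply: (le_trans (ler_distD (y (a, b)) _ _)).
rewrite [X in X + _]distrC.
by rewrite mulr_natl mulr2n lerD.
Qed.

(** Pigeonhole: two of N^m + 1 multiples of al have their fractional parts in the same one of N^m
    boxes of side 1/N. *)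
Lemma dirichlet {R : realType} {m : nat} (al : 'I_m -> R) (N : nat) : (0 < N)%N ->
  exists (q : nat) (p : 'I_m -> int), [/\ (0 < q)%N, (q <= N ^ m)%N &
    forall i, `|q%:R * al i - (p i)%:~R| <= N%:R^-1].
Proof.
case: N => // N _.
pose fr (x : R) := x - (Num.floor x)%:~R.
have fr0 x : 0 <= fr x by rewrite /fr subr_ge0 Num.Theory.floor_le.
have fr1 x : fr x < 1.
  by rewrite /fr ltrBlDl; have := Num.Theory.floorD1_gt x; rewrite intrD.
pose f (k : 'I_(N.+1 ^ m).+1) : {ffun 'I_m -> 'I_N.+1} :=
  [ffun i => inord (Num.truncn (N.+1%:R * fr (k%:R * al i)))].
have [k [k' [kk' fkk']]] : exists k k' : 'I_(N.+1 ^ m).+1, (k < k')%N /\ f k = f k'.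
  have /injectivePn[k [k' kk' fk]] : ~~ injectiveb f.
    apply/negP => /injectiveP /leq_card.
    by rewrite card_ffun !card_ord ltnn.
  case: (ltngtP k k') => h; first by exists k, k'.
    by exists k', k.
  by move: kk'; rewrite (val_inj h) eqxx.
exists (k' - k)%N, (fun i => Num.floor (k'%:R * al i) - Num.floor (k%:R * al i)).
split; first by rewrite subn_gt0.
  by apply: (leq_trans (leq_subr _ _)); rewrite -ltnS.
move=> i.
have trN (x : R) : (Num.truncn (N.+1%:R * fr x) < N.+1)%N.
  rewrite Num.Theory.truncn_lt_nat ?mulr_ge0 //.
  by rewrite -[ltRHS]mulr1 ltr_pM2l.
have : Num.truncn (N.+1%:R * fr (k%:R * al i)) = Num.truncn (N.+1%:R * fr (k'%:R * al i)).
  have /ffunP/(_ i) := fkk'; rewrite !ffunE => /(congr1 val) /=.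
  by rewrite !inordK.
set x := fr (k%:R * al i); set y := fr (k'%:R * al i) => exy.
have -> : (k' - k)%:R * al i - (Num.floor (k'%:R * al i) - Num.floor (k%:R * al i))%:~R = y - x.
  by rewrite natrB 1?ltnW // intrB /x /y /fr; ring.
have hx0 : 0 <= N.+1%:R * x by rewrite mulr_ge0 // fr0.
have hy0 : 0 <= N.+1%:R * y by rewrite mulr_ge0 // fr0.
have /andP[x1 x2] := Num.Theory.truncn_itv hx0.
have /andP[y1 y2] := Num.Theory.truncn_itv hy0.
rewrite exy in x1 x2.
rewrite -(ler_pM2l (_ : 0 < N.+1%:R)) // divff ?pnatr_eq0 //.
rewrite -[X in X * _]ger0_norm // -normrM mulrBr ler_distl.
have nt : (Num.truncn (N.+1%:R * y)).+1%:R = (Num.truncn (N.+1%:R * y))%:R + 1 :> R.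
  by rewrite natr1.
by apply/andP; split; lra.
Qed.

(** * Summation estimates *)

Lemma sums_le_nat {R : realType} (a : nat -> R) (M : nat) (K : R) :
  (forall i, 0 <= a i) -> (forall i, (M <= i)%N -> a i = 0) ->
  \sum_(i < M) a i <= K -> sums_le a K.
Proof.
move=> a0 aM aK s us; apply: le_trans aK.
rewrite -(big_mkord predT a) (bigID (fun i => i < M)%N) /= [X in _ + X]big1 ?addr0; last first.
  by move=> i; rewrite -leqNgt; exact: aM.
rewrite -big_filter; apply: sum_uniq_sub => //; first exact: filter_uniq.
by move=> i; rewrite mem_filter mem_index_iota => /andP[].
Qed.

Lemma sums_le_sum {R : realType} {I J : eqType} (a : I + J -> R) (K L : R) :
  sums_le (fun i => a (inl i)) K -> sums_le (fun j => a (inr j)) L ->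
  sums_le a (K + L).
Proof.
move=> aK aL s us.
pose f (x : I + J) := if x is inl i then Some i else None.
pose g (x : I + J) := if x is inr j then Some j else None.
have fK : ocancel f inl by case.
have gK : ocancel g inr by case.
have -> : \sum_(x <- s) a x = \sum_(i <- pmap f s) a (inl i) + \sum_(j <- pmap g s) a (inr j).
  rewrite !big_pmap -big_split /=; apply: eq_bigr => -[i|j] _ /=; by rewrite ?addr0 ?add0r.
by apply: lerD; [apply: aK; exact: pmap_uniq us|apply: aL; exact: pmap_uniq us].
Qed.

Lemma sum_inv_sq {R : realType} (T M : nat) : (0 < T)%N ->
  \sum_(T <= q < M) (q%:R ^- 2 : R) <= 2 / T%:R.
Proof.
move=> T0; have [MT|TM] := leqP M T.
  by rewrite big_geq // divr_ge0.
(* Telescoping: 1/x^2 <= 2/x - 2/(x + 1) for x >= 1. *)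
suff : \sum_(T <= q < M) (q%:R ^- 2 : R) <= 2 / T%:R - 2 / M%:R.
  by move/le_trans; apply; rewrite gerBl divr_ge0.
rewrite -(subnKC (ltnW TM)); elim: (M - T)%N => [|k IH].
  by rewrite addn0 big_geq // subrr.
rewrite addnS big_nat_recr ?leq_addr //=.
have x0 : 0 < ((T + k)%N%:R : R) by rewrite ltr0n addn_gt0 T0.
have x1 : 1 <= ((T + k)%N%:R : R) by rewrite ler1n addn_gt0 T0.
rewrite -[(T + k).+1%:R]natr1; move: ((T + k)%N%:R) x0 x1 IH => x x0 x1 IH.
apply: (le_trans (lerD IH (lexx _))).
rewrite -subr_ge0.
have -> : 2 / T%:R - 2 / (x + 1) - (2 / T%:R - 2 / x + x ^- 2) = (x - 1) / (x ^+ 2 * (x + 1)).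
  by field; rewrite ?pnatr_eq0 -?lt0n ?T0 ?gt_eqF //= addr_gt0.
by rewrite divr_ge0 ?subr_ge0 // mulr_ge0 ?exprn_ge0 //; lra.
Qed.

(** Two powers of q are kept for the convergence of the sum over q; the others are bounded by their
    value at the start T. *)
Lemma powR_tail {R : realType} (T q s : R) : 1 <= T -> T <= q -> 2 <= s ->
  q `^ (- s) <= q ^- 2 * T `^ (- (s - 2)).
Proof.
move=> T1 Tq s2; have q0 : 0 < q by apply: lt_le_trans Tq; lra.
have -> : - s = - 2%:R + - (s - 2) by ring.
rewrite powRD; last by rewrite (gt_eqF q0) implybT.
have -> : q `^ (- 2%:R) = q ^- 2 by rewrite powRN powR_mulrn // ltW.
rewrite ler_pM2l ?invr_gt0 ?exprn_gt0 //.
rewrite !powRN lef_pV2 ?posrE ?powR_gt0 //; last lra.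
by apply: ge0_ler_powR; rewrite ?nnegrE; lra.
Qed.

Lemma exprDn_le {R : realType} (a b : R) (m : nat) : 0 <= a -> 0 <= b ->
  (a + b) ^+ m <= 2 ^+ m * (a ^+ m + b ^+ m).
Proof.
move=> a0 b0; wlog ab : a b a0 b0 / a <= b.
  move=> H; case: (leP a b) => [|/ltW] h; first exact: H.
  by rewrite addrC [a ^+ m + _]addrC; apply: H.
apply: (@le_trans _ _ ((2 * b) ^+ m)); first by rewrite lerXn2r ?nnegrE //; lra.
by rewrite exprMn ler_pM2l ?exprn_gt0 // lerDr exprn_ge0.
Qed.

Lemma sum_ltn_le (M K : nat) : (\sum_(i < M) (i.+1 < K) <= K)%N.
Proof.
suff : (\sum_(i < M) (i.+1 < K) <= minn M K)%N by rewrite leq_min => /andP[].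
elim: M => [|M IH]; first by rewrite big_ord0.
rewrite big_ord_recr /=; move: IH; move: (\sum_(i < M) _)%N => x.
by case: (ltnP M.+1 K) => h /=; rewrite !leq_min; lia.
Qed.

(* Summed over the M denominators q, the bounds of removal_term_le give this expression, with
   bm = b^m, u = N^m, e = 11^m, p = 16^m, c = 2^(5m), S1 counting the q < K and S2 = \sum q^-2. *)
Lemma removal_arith {R : realType} (bm u M e p c K S1 S2 T X : R) :
  S1 <= K -> S2 <= 2 -> 0 <= S1 -> 0 < u -> M * (8 * c) <= u -> M <= u -> 0 < e -> 0 < p -> 0 < c ->
  0 < K -> p * bm = c * X -> 16 * (p * e) / X <= K -> 16 * (p * e) * K / X <= u ->
  0 < X -> 16 * c <= T ->
  p * (M * (bm / u) + e / u * (M / K + S1) + S2 * (bm / T + e * (bm / (16 * (c * e))))) <= X / 2.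
Proof.
move=> hS1 hS2 S10 u0 hM hM1 e0 p0 c0 K0 pX hK hN X0 T1.
have T0 : 0 < T by apply: lt_le_trans T1; lra.
(* The five parts take X/8, X/16, X/16, X/8 and X/8. E1 is the volume term of the Dirichlet
   neighbourhoods, E2 and E3 are their boundary terms for q >= K and q < K; E4 and E5 are the volume
   and boundary terms of the neighbourhoods of radius 2 [hgt] q. *)
have E1 : p * (M * (bm / u)) <= X / 8.
  have -> : p * (M * (bm / u)) = p * bm * M / u by ring.
  rewrite pX ler_pdivrMr //.
  have -> : c * X * M = X / 8 * (M * (8 * c)) by field.
  by rewrite ler_pM2l // divr_gt0.
have ep0 : 0 < e * p by rewrite mulr_gt0.
have E2 : p * (e / u * (M / K)) <= X / 16.
  apply: (@le_trans _ _ (e * p / K)).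
    have -> : p * (e / u * (M / K)) = e * p / K * (M / u) by ring.
    by rewrite ler_piMr ?ler_pdivrMr ?mul1r // divr_ge0 // ltW.
  by rewrite ler_pdivrMr //; move: hK; rewrite ler_pdivrMr //; nra.
have E3 : p * (e / u * S1) <= X / 16.
  apply: (@le_trans _ _ (e * p * K / u)).
    have -> : p * (e / u * S1) = e * p * S1 / u by ring.
    by rewrite ler_pM2r ?invr_gt0 // ler_pM2l.
  by rewrite ler_pdivrMr //; move: hN; rewrite ler_pdivrMr //; nra.
have X0' := ltW X0.
have E4 : p * (S2 * (bm / T)) <= X / 8.
  have -> : p * (S2 * (bm / T)) = p * bm * S2 / T by ring.
  rewrite pX ler_pdivrMr //; have cX : 0 < c * X by rewrite mulr_gt0.
  by apply: (@le_trans _ _ (c * X * 2)); [rewrite ler_pM2l|nra].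
have E5 : p * (S2 * (e * (bm / (16 * (c * e))))) <= X / 8.
  have -> : p * (S2 * (e * (bm / (16 * (c * e))))) = (p * bm) * S2 / (16 * c).
    by field; rewrite !gt_eqF.
  rewrite pX; have -> : c * X * S2 / (16 * c) = X * S2 / 16 by field; rewrite gt_eqF.
  by nra.
rewrite !mulrDr; lra.
Qed.

Lemma far_from_near {R : realType} (x y z d : R) :
  2 * d <= `|x - z| -> `|y - x| <= d -> d <= `|y - z|.
Proof. by move=> h1 h2; have := ler_distD y x z; rewrite [`|x - y|]distrC; lra. Qed.

(** * Rational points in a cube *)

Section RationalPoints.
Variables (R : realType) (m : nat) (t : R).
Hypotheses (m_gt0 : (0 < m)%N) (tm : m%:R + 2 < t * m%:R).

(* Phi q / q <= hgt q for large q: only points this close to p/q can be Phi-approximated by it. *)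
Definition hgt (q : nat) : R := q%:R `^ (- (t + 1)).

Let t_gt1 : 1 < t.
Proof.
have m0 : 0 < m%:R :> R by rewrite ltr0n.
by rewrite -(ltr_pM2r m0) mul1r; apply: le_lt_trans tm; rewrite lerDl.
Qed.

Lemma hgt_mul q : (0 < q)%N -> q%:R * hgt q = q%:R `^ (- t).
Proof.
move=> q0; have q1 : 0 < q%:R :> R by rewrite ltr0n.
rewrite /hgt -[X in X * _]powRr1 ?ltW // -powRD; first by congr (_ `^ _); ring.
by rewrite (gt_eqF q1) implybT.
Qed.

Lemma hgt_exp q : hgt q ^+ m = q%:R `^ (- ((t + 1) * m%:R)).
Proof. by rewrite -powR_mulrn ?powR_ge0 // -powRrM mulNr. Qed.

Lemma hgt_mul_exp q : (0 < q)%N -> (q%:R * hgt q) ^+ m = q%:R `^ (- (t * m%:R)).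
Proof. by move=> q0; rewrite hgt_mul // -powR_mulrn ?powR_ge0 // -powRrM mulNr. Qed.

Lemma hgt_mul_le1 q : (0 < q)%N -> q%:R * hgt q <= 1.
Proof.
move=> q0; rewrite hgt_mul // powRN invf_le1 ?powR_gt0 ?ltr0n //.
have q1 : 1 <= q%:R :> R by rewrite ler1n.
have t0 : 0 <= t by apply: ltW (lt_trans ltr01 t_gt1).
by have := @ler_powR R _ q1 _ _ t0; rewrite powRr0.
Qed.

(* Radius of the neighbourhood of Z/q to be avoided.  The first term prevents q from being the
   denominator found by Dirichlet's theorem; the second one, relevant only for q >= T, keeps that
   rational point away from the fractions with denominator q. *)
Definition removed (N : nat) (T : R) (q : nat) : R :=
  2 / (N%:R * q%:R) + (T <= q%:R)%R%:R * (2 * hgt q).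

Lemma removed_ge0 N T q : 0 <= removed N T q.
Proof.
apply: addr_ge0; first by rewrite divr_ge0 // mulr_ge0.
by rewrite !mulr_ge0 // powR_ge0.
Qed.

(** The left-hand side comes from [near_fractions] for an interval of length b/2. The terms with b^m
    reflect the expected number of fractions, those with 11^m the boundary effect, which prevails
    when q b is small. *)
Lemma removal_term N T q b : (0 < N)%N -> (0 < q)%N -> 0 < b ->
  ((q%:R * (b / 2) + 2 * q%:R * removed N T q + 3) * (2 * removed N T q)) ^+ m
  <= 16 ^+ m * (b ^+ m / N%:R ^+ m + 11 ^+ m / N%:R ^+ m / q%:R ^+ m
     + (T <= q%:R)%R%:R * (b ^+ m * (q%:R * hgt q) ^+ m + 11 ^+ m * hgt q ^+ m)).
Proof.
move=> N0 q0 b0.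
have N1 : 1 <= N%:R :> R by rewrite ler1n.
have q1 : 1 <= q%:R :> R by rewrite ler1n.
have h0 : 0 <= hgt q by rewrite powR_ge0.
have qh := hgt_mul_le1 q q0.
rewrite /removed; set e : bool := (T <= q%:R).
have e01 : e%:R = 0 :> R \/ e%:R = 1 :> R by case: e; auto.
have em : (e%:R : R) ^+ m = e%:R by case: (e); rewrite ?expr1n // expr0n eqn0Ngt m_gt0.
move: (e%:R) e01 em => {e} e e01 em.
have e0 : 0 <= e by case: e01; lra.
set u : R := (N%:R * q%:R)^-1.
have u0 : 0 <= u by rewrite invr_ge0 mulr_ge0.
have qu : q%:R * u <= 1.
  rewrite /u invfM mulrCA divff ?mulr1; last by rewrite gt_eqF //; lra.
  by rewrite invf_le1 //; lra.
move: (hgt q) h0 qh => h h0 qh.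
have -> : (q%:R * (b / 2) + 2 * q%:R * (2 / (N%:R * q%:R) + e * (2 * h)) + 3) * (2 * (2 / (N%:R * q%:R) + e * (2 * h)))
  = (q%:R * b / 2 + 4 * (q%:R * u) + 4 * e * (q%:R * h) + 3) * (4 * (u + e * h)) by rewrite -/u; ring.
(* 11 = 4 + 4 + 3, from q u <= 1 and e q h <= 1. *)
apply: (@le_trans _ _ (((q%:R * b + 11) * (4 * (u + e * h))) ^+ m)).
  have qb : 0 <= q%:R * b by rewrite mulr_ge0 // ltW.
  have qu0 : 0 <= q%:R * u by rewrite mulr_ge0.
  have qh0 : 0 <= q%:R * h by rewrite mulr_ge0.
  have eqh : 0 <= e * (q%:R * h) <= 1 by case: e01 => ->; rewrite ?mul0r ?mul1r ?lexx ?ler01 // qh0.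
  have eh : 0 <= e * h by rewrite mulr_ge0.
  move/andP: eqh => [eqh1 eqh2].
  rewrite lerXn2r ?nnegrE ?ler_wpM2r ?mulr_ge0 ?addr_ge0 //; try lra.
rewrite [(q%:R * b + 11) * _]mulrA exprMn exprMn -mulrA mulrCA.
have -> : 16 = 4 * 4 :> R by ring.
have -> : (4 * 4) ^+ m = 4 ^+ m * (2 ^+ m * 2 ^+ m) :> R by rewrite -!exprMn; congr (_ ^+ _); ring.
rewrite -[X in _ <= X]mulrA ler_pM2l ?exprn_gt0 //.
have A1 : (q%:R * b + 11) ^+ m <= 2 ^+ m * ((q%:R * b) ^+ m + 11 ^+ m).
  by apply: exprDn_le => //; rewrite mulr_ge0 // ltW.
have A2 : (u + e * h) ^+ m <= 2 ^+ m * (u ^+ m + e * h ^+ m).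
  have eh : 0 <= e * h by rewrite mulr_ge0.
  by apply: (le_trans (exprDn_le _ _ m u0 eh)); rewrite exprMn em.
apply: (@le_trans _ _ ((2 ^+ m * ((q%:R * b) ^+ m + 11 ^+ m)) * (2 ^+ m * (u ^+ m + e * h ^+ m)))).
  have b1 := ltW b0.
  by apply: ler_pM => //; rewrite exprn_ge0 // addr_ge0 // mulr_ge0.
have um : u ^+ m = N%:R ^- m * q%:R ^- m by rewrite /u exprVn exprMn invfM.
have qq : q%:R ^+ m * q%:R ^- m = 1 :> R by rewrite divff // expf_neq0 // gt_eqF //; lra.
rewrite um !exprMn le_eqVlt; apply/orP; left; apply/eqP.
transitivity (2 ^+ m * 2 ^+ m * (b ^+ m / N%:R ^+ m * (q%:R ^+ m * q%:R ^- m) + 11 ^+ m / N%:R ^+ m / q%:R ^+ m +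
  e * (b ^+ m * (q%:R ^+ m * h ^+ m) + 11 ^+ m * h ^+ m))); last by rewrite qq mulr1.
by ring.
Qed.

(* Chosen so that the denominators below N^m / dens remove at most half of the volume. *)
Definition dens : nat := (8 * 2 ^ (5 * m))%N.
(* The denominators q >= T remove only a small proportion of a cube of radius b. *)
Definition good_cube (b T : R) := [/\ 0 < b, b <= 1, 16 * 2 ^+ (5 * m) <= T &
  16 * (2 ^+ (5 * m) * 11 ^+ m) <= b ^+ m * T `^ ((t + 1) * m%:R - 2)].

(** For m = 1 the series of q^-m diverges, hence the threshold K: q^-m is at most 1 below K and at
    most 1/K beyond, which over all q up to N^m adds up to K + N^m / K, small against N^m. In the
    second part the volume term uses t m >= 3 and the boundary term the last inequality of
    [good_cube]. *)
Lemma removal_term_le b T N K q : good_cube b T -> (0 < N)%N -> (0 < q)%N -> (0 < K)%N ->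
  b ^+ m / N%:R ^+ m + 11 ^+ m / N%:R ^+ m / q%:R ^+ m
     + (T <= q%:R)%R%:R * (b ^+ m * (q%:R * hgt q) ^+ m + 11 ^+ m * hgt q ^+ m)
  <= b ^+ m / N%:R ^+ m + 11 ^+ m / N%:R ^+ m * (K%:R^-1 + (q < K)%N%:R)
     + q%:R ^- 2 * (b ^+ m / T + 11 ^+ m * (b ^+ m / (16 * (2 ^+ (5 * m) * 11 ^+ m)))).
Proof.
move=> [b0 b1 T1 kT] N0 q0 K0.
have q1 : 1 <= q%:R :> R by rewrite ler1n.
have m1 : 1 <= m%:R :> R by rewrite ler1n.
have c1 : 1 <= 2 ^+ (5 * m) :> R by rewrite exprn_ege1 //; lra.
have tm' := tm; have t1' := t_gt1.
have T1' : 1 <= T by lra.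
have bm : 0 < b ^+ m by rewrite exprn_gt0.
have k0 : 0 < 16 * (2 ^+ (5 * m) * 11 ^+ m) :> R by rewrite !mulr_gt0 // exprn_gt0.
rewrite -!addrA lerD2l; apply: lerD.
  rewrite ler_wpM2l ?divr_ge0 ?exprn_ge0 //.
  have [qK|Kq] := ltnP q K.
    have : q%:R ^- m <= 1 :> R by rewrite invf_le1 ?exprn_gt0 ?exprn_ege1 // ltr0n.
    have : 0 <= K%:R^-1 :> R by rewrite invr_ge0.
    by rewrite /=; lra.
  rewrite addr0 lef_pV2 ?posrE ?ltr0n // ?exprn_gt0 ?ltr0n //.
  apply: (@le_trans _ _ q%:R); first by rewrite ler_nat.
  by rewrite -[leLHS]expr1 ler_weXn2l.
case: (lerP T q%:R) => Tq; last first.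
  have T0 : 0 <= T by lra.
  have bm0 := ltW bm; have k0' := ltW k0.
  have B0 : 0 <= b ^+ m / T by exact: divr_ge0.
  have B1 : 0 <= 11 ^+ m * (b ^+ m / (16 * (2 ^+ (5 * m) * 11 ^+ m))).
    by apply: mulr_ge0; [exact: exprn_ge0|exact: divr_ge0].
  by rewrite mul0r mulr_ge0 ?invr_ge0 ?exprn_ge0 // addr_ge0.
rewrite mul1r mulrDr; apply: lerD.
  rewrite mulrCA ler_pM2l // hgt_mul_exp //.
  have s2 : 2 <= t * m%:R by lra.
  apply: (le_trans (powR_tail _ _ _ T1' Tq s2)).
  rewrite ler_pM2l ?invr_gt0 ?exprn_gt0 ?ltr0n //.
  rewrite -[leRHS]powR_inv1 ?(le_trans ler01) //.
  apply: ler_powR => //; lra.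
rewrite mulrCA ler_pM2l ?exprn_gt0 // hgt_exp.
have s2 : 2 <= (t + 1) * m%:R by lra.
apply: (le_trans (powR_tail _ _ _ T1' Tq s2)).
rewrite ler_pM2l ?invr_gt0 ?exprn_gt0 ?ltr0n //.
have Tp : 0 < T `^ ((t + 1) * m%:R - 2) by rewrite powR_gt0; lra.
by rewrite powRN -[leLHS]mul1r ler_pdivrMr // mulrAC ler_pdivlMr // mul1r.
Qed.

Lemma removal_sum b T : good_cube b T -> exists N0, forall N, (N0 <= N)%N -> (0 < N)%N ->
  sums_le (fun q => ((0 < q)%N && (q * dens < N ^ m)%N)%:R *
    ((q%:R * (b / 2) + 2 * q%:R * removed N T q + 3) * (2 * removed N T q)) ^+ m)
    ((b / 2) ^+ m / 2).
Proof.
move=> gc; have [b0 b1 T1 kT] := gc.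
set X := (b / 2) ^+ m.
have X0 : 0 < X by rewrite exprn_gt0 // divr_gt0.
(* K depends only on the cube; N0, chosen afterwards, makes K negligible against N^m. *)
pose K := (Num.truncn (16 * (16 ^+ m * 11 ^+ m) / X)).+1.
have K0 : (0 < K)%N by [].
have hK : 16 * (16 ^+ m * 11 ^+ m) / X <= K%:R by apply: ltW; exact: Num.Theory.truncnS_gt.
pose N0 := (Num.truncn (16 * (16 ^+ m * 11 ^+ m) * K%:R / X)).+1.
exists N0 => N N0N N1.
have hN : 16 * (16 ^+ m * 11 ^+ m) * K%:R / X <= N%:R ^+ m.
  apply: (@le_trans _ _ N%:R).
    apply: (@le_trans _ _ N0%:R); last by rewrite ler_nat.
    by apply: ltW; exact: Num.Theory.truncnS_gt.
  by rewrite -[leLHS]expr1 ler_weXn2l // ler1n.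
have D0 : (0 < dens)%N by rewrite muln_gt0 expn_gt0.
pose M := (N ^ m %/ dens)%N.
apply: (@sums_le_nat _ _ M.+1).
- move=> q; rewrite mulr_ge0 // exprn_ge0 // mulr_ge0 ?mulr_ge0 ?removed_ge0 //.
  by rewrite !addr_ge0 // !mulr_ge0 ?removed_ge0 ?invr_ge0 // ltW.
- move=> q Mq; rewrite [(q * dens < _)%N]ltnNge.
  suff -> : (N ^ m <= q * dens)%N by rewrite andbF mul0r.
  by apply: ltnW; rewrite -ltn_divLR.
rewrite big_ord_recl /= mul0r add0r.
pose B := b ^+ m / T + 11 ^+ m * (b ^+ m / (16 * (2 ^+ (5 * m) * 11 ^+ m))).
pose G q : R := 16 ^+ m * (b ^+ m / N%:R ^+ m + 11 ^+ m / N%:R ^+ m * (K%:R^-1 + (q < K)%N%:R)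
     + q%:R ^- 2 * B).
apply: (@le_trans _ _ (\sum_(i < M) G i.+1)).
  apply: ler_sum => i _.
  apply: (@le_trans _ _ (16 ^+ m * (b ^+ m / N%:R ^+ m + 11 ^+ m / N%:R ^+ m / i.+1%:R ^+ m
     + (T <= i.+1%:R)%R%:R * (b ^+ m * (i.+1%:R * hgt i.+1) ^+ m + 11 ^+ m * hgt i.+1 ^+ m)))).
    apply: le_trans (removal_term N T i.+1 b N1 isT b0).
    rewrite ler_piMl //; last by case: (_ < _)%N; rewrite ?lexx ?ler01.
    rewrite exprn_ge0 // mulr_ge0 ?mulr_ge0 ?removed_ge0 //.
    by rewrite !addr_ge0 // !mulr_ge0 ?removed_ge0 ?invr_ge0 // ltW.
  by rewrite ler_pM2l ?exprn_gt0 //; exact: removal_term_le.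
pose S1 : R := \sum_(i < M) (i.+1 < K)%N%:R.
pose S2 : R := \sum_(i < M) i.+1%:R ^- 2.
have cst (y : R) : \sum_(i < M) y = M%:R * y.
  by rewrite sumr_const card_ord mulr_natl.
have -> : \sum_(i < M) G i.+1 = 16 ^+ m * (M%:R * (b ^+ m / N%:R ^+ m)
    + 11 ^+ m / N%:R ^+ m * (M%:R / K%:R + S1) + S2 * B).
  rewrite /G -mulr_sumr big_split /= big_split /= cst -[in X in _ + X]mulr_suml -mulr_sumr.
  by rewrite big_split /= cst.
have hS1 : S1 <= K%:R.
  rewrite /S1 -natr_sum ler_nat.
  exact: sum_ltn_le.
have hS2 : S2 <= 2.
  have := @sum_inv_sq R 1 M.+1 isT.
  by rewrite big_add1 /= big_mkord divr1.
have S10 : 0 <= S1 by apply: sumr_ge0.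
have NM : 0 < N%:R ^+ m :> R by rewrite exprn_gt0 // ltr0n.
have hM : M%:R * dens%:R <= N%:R ^+ m :> R.
  by rewrite -natrM -natrX ler_nat leq_trunc_div.
have hM1 : M%:R <= N%:R ^+ m :> R by rewrite -natrX ler_nat leq_div.
have e0 : 0 < 11 ^+ m :> R by rewrite exprn_gt0.
have p0 : 0 < 16 ^+ m :> R by rewrite exprn_gt0.
have c0 : 0 < 2 ^+ (5 * m) :> R by rewrite exprn_gt0.
have K1 : 0 < K%:R :> R by rewrite ltr0n.
have pX : 16 ^+ m * b ^+ m = 2 ^+ (5 * m) * X.
  rewrite /X exprMn exprVn exprM mulrCA mulrC; congr (_ * _).
  rewrite -exprVn -exprMn; congr (_ ^+ _); lra.
have hD : dens%:R = 8 * 2 ^+ (5 * m) :> R by rewrite natrM natrX.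
rewrite /B; apply: removal_arith => //; first by rewrite -hD.
Qed.

(** Here q is any common denominator, not only the least one. *)
Definition rat_point (q : nat) (x : 'cV[R]_m) :=
  exists p : 'I_m -> int, forall i, q%:R * x i ord0 = (p i)%:~R.

(** Bounds the precision 1/(N q) in Dirichlet's theorem when q >= N^m / [dens]. *)
Definition mesh (N : nat) : R := dens%:R / N%:R ^+ m.+1.

Lemma dens_gt0 : (0 < dens)%N.
Proof. by rewrite muln_gt0 expn_gt0. Qed.

Lemma mesh_gt0 N : (0 < N)%N -> 0 < mesh N.
Proof. by move=> N0; rewrite divr_gt0 ?exprn_gt0 ?ltr0n // dens_gt0. Qed.

Lemma mesh_le (e : R) : 0 < e -> exists N0, forall N, (N0 <= N)%N -> (0 < N)%N -> mesh N <= e.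
Proof.
move=> e0; exists (Num.truncn (dens%:R / e)).+1 => N N0N N0.
have h : dens%:R / e <= N%:R.
  apply: (@le_trans _ _ (Num.truncn (dens%:R / e)).+1%:R); last by rewrite ler_nat.
  by apply: ltW; exact: Num.Theory.truncnS_gt.
have h2 : N%:R <= N%:R ^+ m.+1 :> R by rewrite -[leLHS]expr1 ler_weXn2l // ler1n.
rewrite ler_pdivrMr ?exprn_gt0 ?ltr0n // mulrC -ler_pdivrMr //.
exact: le_trans h h2.
Qed.

(** In the last clause the denominators q < T are left to the earlier cubes. *)
Definition good_point (c : 'cV[R]_m) (b T : R) (N : nat) (x : 'cV[R]_m) :=
  [/\ dist c x <= b / 2,
      exists q, [/\ (0 < q)%N, (q <= N ^ m)%N & rat_point q x],
      forall q, (0 < q)%N -> (q * dens < N ^ m)%N -> ~ rat_point q x &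
      forall q (p : 'I_m -> int), (0 < q)%N -> T <= q%:R -> (q * dens < N ^ m)%N ->
        exists i, 2 * hgt q < `|x i ord0 - (p i)%:~R / q%:R|].

(** Suppose that a maximal family has fewer than k members. The cubes of radius 5 [mesh] about them
    fill at most 1/8 of the available volume and the removed neighbourhoods at most 1/2, so a point
    al lies outside all of them. Dirichlet's theorem at al yields a good point within [mesh] of al,
    hence more than 4 [mesh] from the family, against maximality. *)
Lemma good_points (c : 'cV[R]_m) b T : good_cube b T ->
  exists N0, forall N, (N0 <= N)%N -> (0 < N)%N ->
  forall k : nat, k%:R * (10 * mesh N) ^+ m <= (b / 2) ^+ m / 8 ->
  exists s : seq 'cV[R]_m, [/\ size s = k, separated (4 * mesh N) s &
    forall x, x \in s -> good_point c b T N x].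
Proof.
move=> gc; have [b0 b1 T1 kT] := gc.
have b4 : 0 < b / 4 by rewrite divr_gt0.
have [N1 hN1] := mesh_le _ b4; have [N2 hN2] := removal_sum b T gc.
exists (maxn N1 N2) => N; rewrite geq_max => /andP[/hN1 hN1N /hN2 hN2N] N0 k kb.
have {hN1N} me := hN1N N0; have {hN2N} sumq := hN2N N0.
have d0 := mesh_gt0 N N0.
have [s [sk sep sG scov]] := separated_maximal (good_point c b T N) (4 * mesh N) k.
exists s; split => //; apply/eqP; rewrite eqn_leq sk /= leqNgt; apply/negP => {}/scov scov.
(* Corner of the cube of radius b/4; the remaining b/4 takes the passage from al to the rational
   point. *)
pose a (j : 'I_m) := c j ord0 - b / 4.
have l0 : 0 < b / 2 by rewrite divr_gt0.
pose v0 q := (q%:R * (b / 2) + 2 * q%:R * removed N T q + 3) * (2 * removed N T q).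
have rm0 q : 0 <= removed N T q by exact: removed_ge0.
have v00 q : 0 <= v0 q.
  by rewrite mulr_ge0 ?mulr_ge0 // !addr_ge0 ?mulr_ge0 // ltW.
have HV (qj : nat * 'I_m) : exists V : set R, [/\ measurable V,
    (lebesgue_measure V <= (v0 qj.1)%:E)%E &
    forall t (p : int), (0 < qj.1)%N -> a qj.2 <= t <= a qj.2 + b / 2 ->
      `|t - p%:~R / qj.1%:R| <= removed N T qj.1 -> V t].
  case: qj => -[|q] j /=.
    exists set0; split => //; by rewrite measure0 lee_fin.
  have q0 : 0 < q.+1%:R :> R by rewrite ltr0n.
  have [V [mV vV hV]] := near_fractions q.+1%:R 0 (removed N T q.+1) (a j) (b / 2) q0 (rm0 _) (ltW l0).
  by exists V; split => // t' p _ h1 h2; apply: (hV t' p) => //; rewrite addr0.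
have [V hV] := choice HV.
pose w (i : nat + nat) : R := match i with
  | inl q => ((0 < q)%N && (q * dens < N ^ m)%N)%:R | inr i => (i < size s)%N%:R end.
pose v (i : nat + nat) : R := match i with inl q => v0 q | inr i => 10 * mesh N end.
pose VV (i : nat + nat) (j : 'I_m) : set R := match i with
  | inl q => V (q, j)
  | inr i => `[(nth c s i) j ord0 - 5 * mesh N, (nth c s i) j ord0 + 5 * mesh N]%classic end.
have w0 i : 0 <= w i by case: i.
have vv0 i : 0 <= v i by case: i => //= _; rewrite mulr_ge0 // ltW.
have mVV i j : measurable (VV i j).
  by case: i => [q|i] /=; [case: (hV (q, j))|exact: measurable_itv].
have lVV i j : (lebesgue_measure (VV i j) <= (v i)%:E)%E.
  case: i => [q|i] /=; first by case: (hV (q, j)).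
  have d5 : 0 <= 5 * mesh N by rewrite mulr_ge0 // ltW.
  by rewrite measure_ball1 // lee_fin; lra.
have X0 : 0 < (b / 2) ^+ m by rewrite exprn_gt0.
have sumK : sums_le (fun i => w i * v i ^+ #|'I_m|) ((b / 2) ^+ m / 2 + (b / 2) ^+ m / 8).
  rewrite card_ord; apply: sums_le_sum => //=.
  apply: (@sums_le_nat _ _ (size s)).
  - by move=> i; rewrite mulr_ge0 // exprn_ge0 // mulr_ge0 // ltW.
  - by move=> i; rewrite leqNgt => /negbTE ->; rewrite mul0r.
  apply: le_trans kb; rewrite -mulr_suml ler_wpM2r ?exprn_ge0 ?mulr_ge0 ?(ltW d0) //.
  rewrite (eq_bigr (fun=> 1)) => [|i _]; last by rewrite ltn_ord.
  by rewrite sumr_const card_ord ler_nat.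
(* The budget 1/2 + 1/8 = 5/8 is below 3/4, and a weighted sum below 1 means that al lies in no set
   of weight 1. *)
have KC : (b / 2) ^+ m / 2 + (b / 2) ^+ m / 8 < (3 / 4) * (b / 2) ^+ #|'I_m|.
  by rewrite card_ord; lra.
have [al ala alC] := exists_point w v VV a (b / 2) _ _ l0 w0 vv0 mVV lVV sumK KC.
have notall i : w i = 1 -> ~ forall j, VV i j (al j).
  move=> wi h; have := alC [:: i] isT; rewrite big_seq1 wi mul1r big1 ?lra.
    by lra.
  by move=> j _; rewrite indicE mem_set.
have far q (p : 'I_m -> int) : (0 < q)%N -> (q * dens < N ^ m)%N ->
    exists i, removed N T q < `|al i - (p i)%:~R / q%:R|.
  move=> q0 qN; apply: contrapT => h; apply: (notall (inl q)); first by rewrite /= q0 qN.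
  move=> j /=; case: (hV (q, j)) => _ _ H; apply: (H (al j) (p j)) => //=.
  by rewrite leNgt; apply/negP => h'; apply: h; exists j.
have [q [p [q0 qN qp]]] := dirichlet al N N0.
have q1 : 0 < q%:R :> R by rewrite ltr0n.
have NN : 0 < N%:R :> R by rewrite ltr0n.
pose x : 'cV[R]_m := \col_i ((p i)%:~R / q%:R).
have alx i : `|al i - x i ord0| <= (N%:R * q%:R)^-1.
  rewrite mxE -(ler_pM2l q1) -{1}[q%:R]gtr0_norm // -normrM mulrBr.
  rewrite [_ * (_ / _)]mulrC divfK ?gt_eqF // invfM mulrCA divff ?gt_eqF // mulr1.
  exact: qp.
have qdens : (N ^ m <= q * dens)%N.
  rewrite leqNgt; apply/negP => qN'; have [i] := far q p q0 qN'.
  apply/negP; rewrite -leNgt; have := alx i; rewrite mxE => /le_trans; apply.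
  rewrite /removed -[leLHS]addr0; apply: lerD; last by rewrite !mulr_ge0 // powR_ge0.
  by rewrite ler_peMl ?invr_ge0 ?mulr_ge0 ?ler1n.
have inv_mesh : (N%:R * q%:R)^-1 <= mesh N.
  have -> : mesh N = dens%:R / N%:R ^+ m / N%:R by rewrite /mesh exprS invfM; ring.
  rewrite invfM mulrC ler_pM2r ?invr_gt0 // ler_pdivlMr ?exprn_gt0 // mulrC ler_pdivrMr //.
  by rewrite -natrX mulrC -natrM ler_nat.
have ratx q' p' : (0 < q')%N -> (forall i, q'%:R * x i ord0 = (p' i)%:~R) ->
    forall i, x i ord0 = (p' i)%:~R / q'%:R :> R.
  by move=> q'0 h i; rewrite -h mulrC mulKf // pnatr_eq0 -lt0n.
(* Every small q' lies below the Dirichlet denominator q; half of the first term of [removed]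
   therefore absorbs the passage from al to x. *)
have alx' q' i : (0 < q')%N -> (q' * dens < N ^ m)%N -> `|al i - x i ord0| <= (N%:R * q'%:R)^-1.
  move=> q'0 q'N; apply: (le_trans (alx i)); rewrite lef_pV2 ?posrE ?mulr_gt0 ?ltr0n //.
  rewrite ler_pM2l // ler_nat; apply: ltnW.
  by rewrite -(ltn_pmul2r dens_gt0); exact: leq_trans qdens.
have Gx : good_point c b T N x.
  split.
  - apply/dist_leP => [|i j]; first exact: ltW.
    rewrite ord1 -[c i 0]/(c i ord0); have := ala i; have := alx i.
    have : (N%:R * q%:R)^-1 <= b / 4.
      exact: le_trans inv_mesh me.
    rewrite /a !ler_distl => h1 /andP[h2 h3] /andP[h4 h5].
    by apply/andP; split; lra.
  - exists q; split => //; exists p => i; rewrite mxE mulrC divfK // gt_eqF //.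
  - move=> q' q'0 q'N [p' hp']; have [i] := far q' p' q'0 q'N.
    apply/negP; rewrite -leNgt -ratx //; apply: (le_trans (alx' q' i q'0 q'N)).
    rewrite /removed -[leLHS]addr0; apply: lerD; last by rewrite !mulr_ge0 // powR_ge0.
    by rewrite ler_peMl ?invr_ge0 ?mulr_ge0 ?ler1n.
  - move=> q' p' q'0 Tq' q'N; have [i hi] := far q' p' q'0 q'N.
    exists i; move: hi; rewrite /removed Tq' mul1r => hi.
    have h1 := alx' q' i q'0 q'N.
    have h2 := ler_distD (x i ord0) (al i) ((p' i)%:~R / q'%:R).
    have h3 : 0 <= (N%:R * q'%:R)^-1 :> R by rewrite invr_ge0 mulr_ge0.
    have := lt_le_trans hi (le_trans h2 (lerD h1 (lexx _))).
    by rewrite mulr_natl mulr2n -addrA ltrD2l; apply: le_lt_trans; rewrite lerDr.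
have [y ys xy] := scov x Gx.
have ysz : (index y s < size s)%N by rewrite index_mem.
apply: (notall (inr (index y s))); first by rewrite /= ysz.
move=> j /=; rewrite nth_index // in_itv /= -ler_distl.
apply: (le_trans (ler_distD (x j ord0) _ _)).
have -> : 5 * mesh N = mesh N + 4 * mesh N by ring.
apply: lerD; last by apply: le_trans (dist_ge _ _ _ _) xy.
exact: le_trans (alx j) inv_mesh.
Qed.

(** * From a cube to its subcubes *)

Variables (Phi : nat -> R) (T0 : R).
Hypotheses (Phi_gt0 : forall q, 0 < Phi q)
  (Phi_le : forall q : nat, (0 < q)%N -> T0 <= q%:R -> Phi q <= q%:R `^ (- t)).

Lemma Phi_hgt q : (0 < q)%N -> T0 <= q%:R -> Phi q / q%:R <= hgt q.
Proof.
move=> q0 Tq; rewrite ler_pdivrMr ?ltr0n // mulrC hgt_mul //; exact: Phi_le.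
Qed.

Lemma hgt_le (q q' : nat) : (0 < q)%N -> (q <= q')%N -> hgt q' <= hgt q.
Proof.
move=> q0 qq; rewrite /hgt !powRN lef_pV2 ?posrE ?powR_gt0 ?ltr0n //; last exact: leq_trans qq.
have t1 := t_gt1.
apply: ge0_ler_powR; rewrite ?nnegrE ?ler0n ?ler_nat //; lra.
Qed.

(* The maximum exists because Phi q / q tends to 0. *)
Lemma max_ratio x q1 : (0 < q1)%N -> rat_point q1 x ->
  exists q, [/\ (0 < q)%N, rat_point q x &
    forall q', (0 < q')%N -> rat_point q' x -> Phi q' / q'%:R <= Phi q / q%:R].
Proof.
move=> q10 rq1.
have r0 : 0 < Phi q1 / q1%:R by rewrite divr_gt0 ?ltr0n.
(* Beyond M one has [Phi] q / q <= 1/q <= [Phi] q1 / q1. *)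
pose M := maxn q1 (maxn (Num.truncn T0).+1 (Num.truncn (Phi q1 / q1%:R)^-1).+1).
have q1M : (q1 < M.+1)%N by rewrite ltnS leq_max leqnn.
pose P (i : 'I_M.+1) := `[< (0 < i)%N /\ rat_point i x >].
pose i0 := Ordinal q1M.
have Pi0 : P i0 by apply/asboolP.
case: (@Order.TotalTheory.arg_maxP _ _ _ i0 P (fun i : 'I_M.+1 => Phi i / i%:R) Pi0) => i /asboolP[i1 ri] hi.
exists i; split => // q' q'0 rq'.
have [q'M|Mq'] := ltnP q' M.+1.
  by have /= := hi (Ordinal q'M); apply; apply/asboolP.
apply: (@le_trans _ _ (Phi q1 / q1%:R)); last by apply: (hi i0).
have MTq : T0 <= q'%:R.
  apply: (@le_trans _ _ (Num.truncn T0).+1%:R); first by apply: ltW; exact: Num.Theory.truncnS_gt.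
  by rewrite ler_nat; apply: leq_trans (ltnW Mq'); rewrite !leq_max leqnn orbT.
have Mq : (Phi q1 / q1%:R)^-1 <= q'%:R.
  apply: (@le_trans _ _ (Num.truncn (Phi q1 / q1%:R)^-1).+1%:R).
    by apply: ltW; exact: Num.Theory.truncnS_gt.
  by rewrite ler_nat; apply: leq_trans (ltnW Mq'); rewrite !leq_max leqnn !orbT.
apply: (@le_trans _ _ (q'%:R^-1)).
  have q'1 : 0 < q'%:R :> R by rewrite ltr0n.
  rewrite -[leRHS]mul1r ler_pM2r ?invr_gt0 //.
  apply: (le_trans (Phi_le _ q'0 MTq)); rewrite powRN invf_le1 ?powR_gt0 //.
  have q'2 : 1 <= q'%:R :> R by rewrite ler1n.
  have t1 := t_gt1; have t0 : 0 <= t by lra.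
  by have := @ler_powR R _ q'2 _ _ t0; rewrite powRr0.
by rewrite -[leRHS]invrK lef_pV2 ?posrE ?invr_gt0 // ltr0n.
Qed.

Definition near_cube (c : 'cV[R]_m) (b : R) (al : 'cV[R]_m) := dist c al <= b.

(* Centre and radius of a cube, and the denominator T below which the approximations of its points
   are already controlled. *)
Definition node := ('cV[R]_m * R * R)%type.

(** Along a chain the fourth clause excludes solutions for smaller multiples of [Phi], and the fifth
    provides the infinitely many solutions for [Phi] itself. *)
Definition child (eps : R) (B B' : node) :=
  [/\ good_cube B'.1.2 B'.2, B.2 + 1 <= B'.2 /\ B'.1.2 <= B.1.2 / 2,
      forall al, near_cube B'.1.1 B'.1.2 al -> near_cube B.1.1 B.1.2 al,
      forall al, near_cube B'.1.1 B'.1.2 al -> forall q (p : 'I_m -> int),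
        (0 < q)%N -> B.2 <= q%:R -> q%:R <= B'.2 ->
        exists i, (1 - eps) * Phi q <= `|q%:R * al i ord0 - (p i)%:~R| &
      exists q (p : 'I_m -> int), [/\ (0 < q)%N, B.2 <= q%:R &
        forall al, near_cube B'.1.1 B'.1.2 al -> forall i,
          `|q%:R * al i ord0 - (p i)%:~R| <= Phi q]].

(** L bounds the denominators of a good point from below. The three inequalities after 0 < N serve
    [powR_large], the inheritance of [good_cube], and the growth of T. *)
Definition large (eps T : R) (N : nat) :=
  let L := N%:R ^+ m / dens%:R in
  [/\ (0 < N)%N, 2 * dens%:R `^ t <= N%:R,
     16 * (2 ^+ (5 * m) * 11 ^+ m) * (2 * dens%:R) `^ ((t + 1) * m%:R - 2) * (2 / eps) ^+ m <= L,
     2 * dens%:R * (T + 1) <= L & 1 <= L].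

Lemma nat_large (x : R) : exists N0 : nat, forall N, (N0 <= N)%N -> x <= N%:R.
Proof.
exists (Num.truncn x).+1 => N h.
apply: (@le_trans _ _ (Num.truncn x).+1%:R); last by rewrite ler_nat.
by apply: ltW; exact: Num.Theory.truncnS_gt.
Qed.

Lemma exists_large eps T : exists N0, forall N, (N0 <= N)%N -> (0 < N)%N -> large eps T N.
Proof.
have D0 : 0 < dens%:R :> R by rewrite ltr0n dens_gt0.
set x1 := 16 * (2 ^+ (5 * m) * 11 ^+ m) * (2 * dens%:R) `^ ((t + 1) * m%:R - 2) * (2 / eps) ^+ m : R.
have [N1 h1] := nat_large (2 * dens%:R `^ t).
have [N2 h2] := nat_large (dens%:R * x1).
have [N3 h3] := nat_large (dens%:R * (2 * dens%:R * (T + 1))).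
have [N4 h4] := nat_large (dens%:R * 1).
exists (maxn (maxn N1 N2) (maxn N3 N4)) => N; rewrite !geq_max.
move=> /andP[/andP[/h1 {}h1 /h2 {}h2] /andP[/h3 {}h3 /h4 {}h4]] N0.
have hL (y : R) : dens%:R * y <= N%:R -> y <= N%:R ^+ m / dens%:R.
  move=> h; rewrite ler_pdivlMr // mulrC; apply: (le_trans h).
  by rewrite -[leLHS]expr1 ler_weXn2l // ler1n.
by split => //; exact: hL.
Qed.

(** Since t m > m + 2, the exponent m (t - 1) is at least 2, so that the right-hand side is at least
    N^2 up to a power of [dens]. *)
Lemma powR_large N : (0 < N)%N -> 2 * dens%:R `^ t <= N%:R ->
  2 * dens%:R * N%:R <= (N%:R ^+ m / dens%:R) `^ (t - 1).
Proof.
move=> N0 NL1; have t1 := t_gt1; have tm' := tm.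
have D0 : 0 < dens%:R :> R by rewrite ltr0n dens_gt0.
have N1 : 1 <= N%:R :> R by rewrite ler1n.
have NN : 0 < N%:R :> R by rewrite ltr0n.
have Dt : 0 < dens%:R `^ (t - 1) by rewrite powR_gt0.
rewrite -(ler_pM2l Dt).
have -> : dens%:R `^ (t - 1) * (N%:R ^+ m / dens%:R) `^ (t - 1) = N%:R `^ (m%:R * (t - 1)).
  rewrite -powRM ?ler0n ?divr_ge0 ?exprn_ge0 // mulrCA divff ?mulr1 ?gt_eqF //.
  by rewrite -powR_mulrn // -powRrM.
apply: (@le_trans _ _ (N%:R `^ 2%:R)); last by apply: ler_powR => //; lra.
rewrite powR_mulrn // expr2.
have -> : dens%:R `^ (t - 1) * (2 * dens%:R * N%:R) = 2 * (dens%:R `^ (t - 1) * dens%:R) * N%:R by ring.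
rewrite ler_pM2r // -{2}[dens%:R]powRr1 // -powRD; last by rewrite (gt_eqF D0) implybT.
by rewrite subrK.
Qed.

(** Inheritance of the last inequality of [good_cube]. With s = (t + 1) m - 2 the decisive factor is
    r^m (L r)^-s = L^-s r^-(t m - 2), which decreases in r. At the largest r, L^-(t+1), the exponent
    of L is (t + 1)(t m - m - 2) + 2, hence at least 1. *)
Lemma good_cube_arith (k D L r eps : R) : 0 < r -> 0 < eps -> 0 < D -> 1 <= L -> 0 < k ->
  r <= L `^ (- (t + 1)) -> k * (D `^ ((t + 1) * m%:R - 2)) * (2 / eps) ^+ m <= L ->
  k <= (r * (eps / 2)) ^+ m * ((D * L * r)^-1) `^ ((t + 1) * m%:R - 2).
Proof.
move=> r0 e0 D0 L1 k0 rL kL; have t1 := t_gt1; have tm' := tm.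
have L0 : 0 < L by lra.
have m0 : 0 < m%:R :> R by rewrite ltr0n.
set s := (t + 1) * m%:R - 2 in kL *.
have Ds : 0 < D `^ s by rewrite powR_gt0.
have em : 0 < (eps / 2) ^+ m by rewrite exprn_gt0 // divr_gt0.
have -> : (r * (eps / 2)) ^+ m * (D * L * r)^-1 `^ s
   = (eps / 2) ^+ m / D `^ s * (r ^+ m * (L * r)^-1 `^ s).
  have -> : (D * L * r)^-1 = D^-1 * (L * r)^-1 by rewrite -mulrA invfM.
  rewrite powRM ?invr_ge0 ?mulr_ge0 ?ltW // exprMn.
  have -> : D^-1 `^ s = (D `^ s)^-1.
    by rewrite -powR_inv1 ?ltW // -powRrM mulN1r powRN.
  by ring.
have h : L <= r ^+ m * (L * r)^-1 `^ s.
  have -> : r ^+ m * (L * r)^-1 `^ s = L `^ (- s) * r `^ (- (t * m%:R - 2)).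
    rewrite invfM powRM ?invr_ge0 ?ltW // -!powR_inv1 ?ltW // -!powRrM !mulN1r.
    rewrite mulrCA -powR_mulrn ?ltW // -powRD; last by rewrite (gt_eqF r0) implybT.
    by congr (_ * _ `^ _); rewrite /s; ring.
  apply: (@le_trans _ _ (L `^ (- s) * (L `^ (- (t + 1))) `^ (- (t * m%:R - 2)))).
    rewrite -powRrM -powRD; last by rewrite (gt_eqF L0) implybT.
    rewrite -[leLHS]powRr1 ?(ltW L0) //; apply: ler_powR => //; rewrite /s.
    have -> : - ((t + 1) * m%:R - 2) + - (t + 1) * - (t * m%:R - 2)
       = (t + 1) * (t * m%:R - 2 - m%:R) + 2 by ring.
    by nra.
  rewrite ler_pM2l ?powR_gt0 // !powRN lef_pV2 ?posrE ?powR_gt0 ?invr_gt0 ?powR_gt0 //.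
  apply: ge0_ler_powR; rewrite ?nnegrE ?invr_ge0 ?powR_ge0 ?(ltW r0) //; first by lra.
  by rewrite -powRN.
apply: (@le_trans _ _ ((eps / 2) ^+ m / D `^ s * L)); last by rewrite ler_pM2l // divr_gt0.
rewrite mulrAC ler_pdivlMr //.
have -> : k * D `^ s = (eps / 2) ^+ m * (k * D `^ s * (2 / eps) ^+ m).
  rewrite mulrCA -exprMn; have -> : eps / 2 * (2 / eps) = 1 by field; rewrite gt_eqF.
  by rewrite expr1n mulr1.
by rewrite ler_pM2l.
Qed.

(* Shifting every coordinate of x by (1 - eps/2) r puts the cube of radius r eps/2 in the shell
   (1 - eps) r <= |al - x| <= r, in each coordinate.  Up to the new bound 1/(2 N^m r) on q, fractions
   other than x are too far from x to matter. *)
Definition child_node (eps : R) (N : nat) (x : 'cV[R]_m) (r : R) : node :=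
  (\col_i (x i ord0 + (1 - eps / 2) * r), r * (eps / 2), (2 * N%:R ^+ m * r)^-1).

Lemma shell eps N x r al : 0 < r -> 0 < eps < 1 ->
  near_cube (child_node eps N x r).1.1 (child_node eps N x r).1.2 al ->
  forall i, (1 - eps) * r <= `|al i ord0 - x i ord0| <= r.
Proof.
move=> r0 /andP[e0 e1] h i.
have h2 : `|(x i ord0 + (1 - eps / 2) * r) - al i ord0| <= r * (eps / 2).
  by have := dist_ge (child_node eps N x r).1.1 al i ord0; rewrite mxE => /le_trans; apply.
move: h2; rewrite ler_distl => /andP[h2 h3].
have h4 : 0 <= (1 - eps) * r by rewrite mulr_ge0 ?(ltW r0) //; lra.
by rewrite ger0_norm; [apply/andP; split; lra|lra].
Qed.

(** All denominators of x are at least L = N^m / [dens], so that r <= [hgt] qs <= L^-(t+1); the size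
    conditions follow from this. For the fourth clause of [child], a fraction p/q equals x, or has q
    < N^m / [dens], or is separated from x as a distinct rational point. *)
Lemma child_of_point eps (c x : 'cV[R]_m) b T N r qs :
  good_cube b T -> T0 <= T -> 0 < eps < 1 -> large eps T N -> mesh N <= b / 4 ->
  good_point c b T N x ->
  (0 < qs)%N -> rat_point qs x -> r = Phi qs / qs%:R ->
  (forall q', (0 < q')%N -> rat_point q' x -> Phi q' / q'%:R <= r) ->
  child eps (c, b, T) (child_node eps N x r) /\ r <= mesh N.
Proof.
move=> [b0 b1 T1 kT] T0T /andP[e0 e1] [N0 NL1 NL2 NL3 L1] mb [cx [qx [qx0 qxN [px hpx]]] dx farx] qs0 rqs rE rmax.
set L : R := N%:R ^+ m / dens%:R in NL2 NL3 L1.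
have tm' := tm; have t1 := t_gt1.
have D0 : 0 < dens%:R :> R by rewrite ltr0n dens_gt0.
have D1 : 1 <= dens%:R :> R by rewrite ler1n dens_gt0.
have NN : 0 < N%:R :> R by rewrite ltr0n.
have QE : N%:R ^+ m = dens%:R * L by rewrite /L mulrCA divff ?mulr1 // gt_eqF.
have L0 : 0 < L by lra.
have Q0 : 0 < N%:R ^+ m :> R by rewrite exprn_gt0.
have m0 : 0 < m%:R :> R by rewrite ltr0n.
have TL : T + 1 <= L by move: NL3; rewrite -mulrA; nra.
have Tpos : 0 < T by apply: lt_le_trans T1; rewrite mulr_gt0 // exprn_gt0.
have big q : (N ^ m <= q * dens)%N -> L <= q%:R.
  by move=> h; rewrite /L ler_pdivrMr // -natrX -natrM ler_nat.
have qsL : (N ^ m <= qs * dens)%N.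
  by rewrite leqNgt; apply/negP => /(dx _ qs0); apply.
have qs1 : 0 < qs%:R :> R by rewrite ltr0n.
have r0 : 0 < r by rewrite rE divr_gt0.
have Lqs := big _ qsL.
have rhgt : r <= hgt qs by rewrite rE; apply: Phi_hgt => //; lra.
have rL : r <= L `^ (- (t + 1)).
  apply: (le_trans rhgt); rewrite /hgt !powRN lef_pV2 ?posrE ?powR_gt0 //.
  by apply: ge0_ler_powR; rewrite ?nnegrE //; lra.
have key : 2 * dens%:R * N%:R <= L `^ (t - 1) by exact: powR_large.
have LtN : N%:R <= L `^ t.
  have -> : t = 1 + (t - 1) by ring.
  rewrite powRD; last by rewrite (gt_eqF L0) implybT.
  rewrite powRr1 ?(ltW L0) //; have p0 := powR_ge0 L (t - 1); clear -key p0 D1 L1 NN; nra.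
have rmesh : r <= mesh N.
  apply: (le_trans rL); rewrite powRN.
  have -> : mesh N = (L * N%:R)^-1.
    by rewrite /mesh /L exprSr; field; rewrite !gt_eqF // exprn_gt0.
  have LLN : L * N%:R <= L `^ (t + 1).
    rewrite powRD; last by rewrite (gt_eqF L0) implybT.
    by rewrite powRr1 ?(ltW L0) // mulrC ler_pM2r.
  have LN0 : 0 < L * N%:R by rewrite mulr_gt0.
  by rewrite lef_pV2 // posrE powR_gt0.
set T' := (2 * N%:R ^+ m * r)^-1.
have Qr0 : 0 < 2 * N%:R ^+ m * r by rewrite !mulr_gt0.
have L2r : L * L * r <= 1.
  apply: (@le_trans _ _ (L * L * L `^ (- (t + 1)))); first by rewrite (ler_pM2l (mulr_gt0 L0 L0)).
  rewrite powRN ler_pdivrMr ?powR_gt0 // mul1r -expr2 -powR_mulrn ?(ltW L0) //.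
  by apply: ler_powR => //; lra.
have T'L : L / (2 * dens%:R) <= T'.
  rewrite -[leRHS]mul1r ler_pdivlMr //; apply: le_trans L2r.
  have -> : L / (2 * dens%:R) * (2 * N%:R ^+ m * r) = L * L * r; last exact: lexx.
  by rewrite QE; field; rewrite gt_eqF.
have TT' : T + 1 <= T'.
  by apply: le_trans T'L; rewrite ler_pdivlMr ?mulr_gt0 // mulrC.
have gc' : good_cube (r * (eps / 2)) T'.
  split; first by rewrite mulr_gt0 ?divr_gt0.
      by clear -rmesh mb b1 r0 e0 e1; nra.
      by apply: le_trans T1 _; apply: le_trans TT'; rewrite lerDl.
  have D2 : 0 < 2 * dens%:R :> R by rewrite mulr_gt0.
  have k0 : 0 < 16 * (2 ^+ (5 * m) * 11 ^+ m) :> R by rewrite !mulr_gt0 // exprn_gt0.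
  have -> : T' = (2 * dens%:R * L * r)^-1 by rewrite /T' QE mulrA.
  exact: good_cube_arith.
split => //; split => //=.
- by split => //; clear -rmesh mb b0 r0 e0 e1; nra.
- move=> al hal; rewrite /near_cube.
  have h := shell eps N x r al r0 _ hal; rewrite e0 e1 in h; have {}h := h isT.
  apply: (le_trans (dist_triangle x _ _)); apply: (@le_trans _ _ (b / 2 + b / 4)); last first.
    by rewrite [leRHS]splitr lerD2l ler_pM2l // lef_pV2 ?posrE // ler_nat.
  apply: lerD => //; apply/dist_leP => [|i j]; first by rewrite divr_ge0 // ltW.
  rewrite ord1 distrC; have /andP[_ h2] := h i.
  by apply: le_trans h2 _; exact: le_trans mb.
- move=> al hal q p q0 Tq qT'.
  have h := shell eps N x r al r0 _ hal; rewrite e0 e1 in h; have {}h := h isT.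
  have q1 : 0 < q%:R :> R by rewrite ltr0n.
  have Phiq0 := Phi_gt0 q.
  have ePhi : (1 - eps) * Phi q <= Phi q by rewrite ler_piMl ?(ltW Phiq0) // gerBl ltW.
  have Phit : Phi q <= q%:R * hgt q by rewrite hgt_mul //; apply: Phi_le => //; exact: le_trans T0T Tq.
  have scale i : `|q%:R * al i ord0 - (p i)%:~R| = q%:R * `|al i ord0 - (p i)%:~R / q%:R|.
    rewrite -{2}[q%:R]gtr0_norm // -normrM mulrBr; congr (`| _ - _ |).
    by rewrite mulrC divfK // gt_eqF.
  (* If p/q = x, maximality of r gives [Phi] q <= q r, and the shell keeps every coordinate at least
     (1 - eps) r away, so any i will do. *)
  case: (pselect (forall i, q%:R * x i ord0 = (p i)%:~R)) => [hp|/existsNP[i hi]].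
    exists (Ordinal m_gt0); set i := Ordinal m_gt0.
    have /andP[h1 _] := h i.
    have xi : x i ord0 = (p i)%:~R / q%:R by rewrite -hp mulrC mulKf // gt_eqF.
    rewrite scale -xi; apply: (@le_trans _ _ (q%:R * ((1 - eps) * r))); last by rewrite ler_pM2l.
    rewrite mulrCA ler_pM2l ?subr_gt0 //.
    by rewrite mulrC -ler_pdivrMr //; apply: rmax => //; exists p.
  (* For small q some coordinate of x is more than 2 [hgt] q from p/q, and al moves it by at most r
     <= [hgt] q. *)
  have [qD|qD] := ltnP (q * dens)%N (N ^ m)%N.
    have [i' hi'] := farx q p q0 Tq qD; exists i'.
    apply: (le_trans ePhi); apply: (le_trans Phit); rewrite scale ler_pM2l //.
    have qqs : (q <= qs)%N.
      by rewrite -(leq_pmul2r dens_gt0); apply: leq_trans qsL; exact: ltnW.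
    have rq : r <= hgt q by apply: le_trans rhgt _; apply: hgt_le.
    have /andP[_ h2] := h i'.
    exact: far_from_near (ltW hi') (le_trans h2 rq).
  (* Rational numbers that differ and have denominators qx <= N^m and q are at least 1/(N^m q)
     apart, which is at least 2 r because q <= T'. Half of this distance remains at al and is at
     least [Phi] q / q. *)
  exists i; apply: (le_trans ePhi); apply: (le_trans (Phi_le _ q0 _)); first exact: le_trans T0T Tq.
  have qx1 : 0 < qx%:R :> R by rewrite ltr0n.
  have sep : (N%:R ^+ m * q%:R)^-1 <= `|x i ord0 - (p i)%:~R / q%:R|.
    have -> : x i ord0 - (p i)%:~R / q%:R = ((px i * q%:Z - p i * qx%:Z)%:~R) / (qx%:R * q%:R).
      rewrite intrB !intrM -hpx; field; rewrite !gt_eqF //.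
    rewrite normrM normfV [`|_ * _|]gtr0_norm ?mulr_gt0 // ler_pdivlMr ?mulr_gt0 //.
    apply: (@le_trans _ _ 1).
      rewrite mulrC ler_pdivrMr ?mulr_gt0 // mul1r ler_pM2r // -natrX ler_nat //.
    rewrite -intr_norm ler1z -gtz0_ge1 normr_gt0 subr_eq0; apply/eqP => hpq; apply: hi.
    have : (px i)%:~R * q%:R = (p i)%:~R * qx%:R :> R.
      by move: hpq => /(congr1 (fun z => z%:~R : R)); rewrite !intrM.
    rewrite -hpx => h1; apply: (@mulfI _ qx%:R); first by rewrite gt_eqF.
    by rewrite [RHS]mulrC -h1; ring.
  have rq : r <= (2 * (N%:R ^+ m * q%:R))^-1.
    have Qq0 : 0 < 2 * (N%:R ^+ m * q%:R) :> R by rewrite !mulr_gt0.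
    have qT2 : q%:R * (2 * N%:R ^+ m * r) <= 1 by rewrite -ler_pdivlMr // mul1r.
    by rewrite -[leRHS]mul1r ler_pdivlMr //; apply: le_trans qT2; rewrite le_eqVlt; apply/orP; left; apply/eqP; ring.
  rewrite scale; have /andP[_ h2] := h i.
  have h4 : (2 * (N%:R ^+ m * q%:R))^-1 <= `|al i ord0 - (p i)%:~R / q%:R|.
    by apply: far_from_near (le_trans h2 rq); rewrite invfM mulrA divff ?mul1r.
  apply: (@le_trans _ _ (q%:R * (2 * (N%:R ^+ m * q%:R))^-1)); last by rewrite ler_pM2l.
  have -> : q%:R * (2 * (N%:R ^+ m * q%:R))^-1 = (2 * N%:R ^+ m)^-1 :> R.
    by field; rewrite ?gt_eqF // gt_eqF.
  rewrite powRN lef_pV2 ?posrE ?mulr_gt0 ?powR_gt0 //.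
  have Lq := big _ qD.
  apply: (@le_trans _ _ (L `^ t)); last by apply: ge0_ler_powR; rewrite ?nnegrE ?(ltW L0) ?(ltW (lt_trans ltr01 t1)).
  have -> : t = (t - 1) + 1 by ring.
  rewrite powRD; last by rewrite (gt_eqF L0) implybT.
  rewrite QE powRr1 ?(ltW L0) // mulrA ler_pM2r //; apply: le_trans key.
  by rewrite ler_peMr ?mulr_ge0 // ler1n.
- have [p hp] := rqs; exists qs, p; split => // [|al hal i]; first by apply: le_trans Lqs; apply: le_trans TL; rewrite lerDl.
  have h := shell eps N x r al r0 _ hal; rewrite e0 e1 in h; have {}h := h isT.
  rewrite -hp -mulrBr normrM gtr0_norm //; have /andP[_ h2] := h i.
  apply: (@le_trans _ _ (qs%:R * r)); first by rewrite ler_pM2l.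
  by rewrite rE mulrC divfK // gt_eqF.
Qed.

(** The rational points are 4 [mesh] apart and each cube lies within r <= [mesh] of its own, which
    leaves 2 [mesh]. For the lower bound on the radius, x has a denominator at most N^m, so that
    monotonicity and the maximality of r give r >= [Phi] (N^m) / N^m. *)
Lemma children (c : 'cV[R]_m) b T eps : good_cube b T -> T0 <= T -> 0 < eps < 1 ->
  exists N0, forall N, (N0 <= N)%N -> (0 < N)%N ->
  forall k : nat, k%:R * (10 * mesh N) ^+ m <= (b / 2) ^+ m / 8 ->
  exists f : 'I_k -> node, [/\ forall i, child eps (c, b, T) (f i),
    forall i j al al', i != j -> near_cube (f i).1.1 (f i).1.2 al ->
      near_cube (f j).1.1 (f j).1.2 al' -> 2 * mesh N < dist al al' &
    (forall q q' : nat, (q <= q')%N -> Phi q' <= Phi q) ->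
      forall i, Phi (N ^ m)%N / N%:R ^+ m * (eps / 2) <= (f i).1.2].
Proof.
move=> gc T0T eps01; have [b0 b1 T1 kT] := gc; have /andP[e0 e1] := eps01.
have b4 : 0 < b / 4 by rewrite divr_gt0.
have [N1 hN1] := mesh_le _ b4; have [N2 hN2] := good_points c b T gc.
have [N3 hN3] := exists_large eps T.
exists (maxn N1 (maxn N2 N3)) => N; rewrite !geq_max.
move=> /andP[/hN1 {}hN1 /andP[/hN2 {}hN2 /hN3 {}hN3]] N0 k kb.
have [s [sk sep gs]] := hN2 N0 k kb.
have HR (x : 'cV[R]_m) : exists r : R, good_point c b T N x ->
    [/\ 0 < r, child eps (c, b, T) (child_node eps N x r), r <= mesh N &
     (forall q q' : nat, (q <= q')%N -> Phi q' <= Phi q) -> Phi (N ^ m)%N / N%:R ^+ m <= r].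
  case: (pselect (good_point c b T N x)) => [gx|]; last by exists 0.
  have [_ [qx [qx0 qxN rqx]] _ _] := gx.
  have [qs [qs0 rqs hmax]] := max_ratio x qx qx0 rqx.
  exists (Phi qs / qs%:R) => _.
  have [ch rm] := child_of_point eps c x b T N _ qs gc T0T eps01 (hN3 N0) (hN1 N0) gx qs0 rqs erefl hmax.
  split => // [|dec]; first by rewrite divr_gt0 ?ltr0n.
  apply: le_trans (hmax qx qx0 rqx).
  apply: ler_pM; rewrite ?invr_ge0 ?exprn_ge0 ?(ltW (Phi_gt0 _)) //; first exact: dec.
  by rewrite lef_pV2 ?posrE ?exprn_gt0 ?ltr0n // -natrX ler_nat.
have [r hr] := choice HR.
pose x (i : 'I_k) := nth c s i.
have xs i : good_point c b T N (x i) by apply: gs; rewrite mem_nth // sk.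
exists (fun i => child_node eps N (x i) (r (x i))); split.
- by move=> i; have [] := hr _ (xs i).
- move=> i j al al' ij hal hal'.
  have [ri0 _ rim _] := hr _ (xs i); have [rj0 _ rjm _] := hr _ (xs j).
  have d0 := mesh_gt0 N N0.
  have h1 : dist (x i) al <= mesh N.
    apply/dist_leP => [|a a']; first exact: ltW.
    by rewrite ord1 distrC; have /andP[_] := shell _ _ _ _ _ ri0 eps01 hal a; move/le_trans; apply.
  have h2 : dist al' (x j) <= mesh N.
    apply/dist_leP => [|a a']; first exact: ltW.
    by rewrite ord1; have /andP[_] := shell _ _ _ _ _ rj0 eps01 hal' a; move/le_trans; apply.
  have h3 : 4 * mesh N < dist (x i) (x j).
    apply: separated_nth => //; rewrite ?sk //.
    by move/val_inj/eqP; apply/negP.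
  have h4 := dist_triangle al (x i) (x j); have h5 := dist_triangle al' al (x j).
  lra.
- move=> dec i; have [_ _ _ h] := hr _ (xs i).
  by rewrite /= ler_pM2r ?divr_gt0 //; exact: h.
Qed.

End RationalPoints.

(** * Finiteness of the solutions with bounded denominator *)

Lemma vnorm_leP {R : realType} {k : nat} (v : 'cV[R]_k) (r : R) : 0 <= r ->
  (vnorm R k v <= r) <-> (forall i, `|v i ord0| <= r).
Proof.
move=> r0; rewrite /vnorm; split=> [h i|h].
  by apply: le_trans h; rewrite (bigD1 i) //= le_max lexx.
by elim/big_ind: _ => // x y hx hy; rewrite ge_max hx hy.
Qed.

Lemma finite_int_box (k l M : nat) :
  finite_set [set A : 'M[int]_(k, l) | forall i j, (`|A i j|%N <= M)%N].
Proof.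
pose f (B : 'M['I_(2 * M).+1]_(k, l)) : 'M[int]_(k, l) := \matrix_(i, j) ((B i j)%:Z - M%:Z).
apply: (@sub_finite_set _ _ (f @` setT)); last by apply: finite_image; exact: finite_finset.
move=> A hA; exists (\matrix_(i, j) inord (absz (A i j + M%:Z))) => //.
apply/matrixP => i j; rewrite !mxE inordK; have := hA i j; lia.
Qed.

(** For bounded q a bounded error bounds p as well. Hence small denominators do not matter for
    [Exact]. *)
Lemma finite_solutions {R : realType} {m n : nat} (A : 'M[R]_(m, n)) (M : nat) (K : R) :
  finite_set [set pq : 'cV[int]_m * 'cV[int]_n | (qnorm n pq.2 <= M)%N /\
    vnorm R m (A *m map_mx intr pq.2 - map_mx intr pq.1) <= K].
Proof.
pose L : R := \sum_i \sum_j `|A i j| * M%:R.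
have [M' hM'] : exists M' : nat, L + `|K| <= M'%:R.
  by exists (Num.truncn (L + `|K|)).+1; apply: ltW; exact: Num.Theory.truncnS_gt.
apply: (@sub_finite_set _ _ ([set p : 'cV[int]_m | forall i j, (`|p i j|%N <= M')%N] `*`
   [set q : 'cV[int]_n | forall i j, (`|q i j|%N <= M)%N])); last first.
  by apply: finite_setX; exact: finite_int_box.
move=> [p q] /= [qM h]; have qM' i : (`|q i ord0|%N <= M)%N.
  by apply: leq_trans qM; apply: (leq_bigmax (F := fun i => `|q i ord0|%N) i).
split => i j; rewrite ord1 //=.
rewrite -(ler_nat R) natr_absz; apply: le_trans hM'.
have := (vnorm_leP (A *m map_mx intr q - map_mx intr p) `|K| (normr_ge0 _)).1 (le_trans h (ler_norm _)) i.
have -> : (A *m map_mx intr q - map_mx intr p) i ord0 = (A *m map_mx intr q) i ord0 - (p i ord0)%:~R.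
  by rewrite !mxE.
move=> h'; have h2 := ler_distD ((A *m map_mx intr q) i ord0) (p i ord0)%:~R 0.
rewrite !subr0 distrC in h2; rewrite intr_norm; apply: (le_trans h2).
rewrite addrC; apply: lerD => //.
rewrite mxE; apply: (le_trans (ler_norm_sum _ _ _)).
apply: (@le_trans _ _ (\sum_j `|A i j| * M%:R)).
  apply: ler_sum => j' _; rewrite normrM ler_wpM2l // mxE -intr_norm -natr_absz ler_nat.
  exact: qM'.
rewrite /L (bigD1 i) //= lerDl; apply: sumr_ge0 => i' _; apply: sumr_ge0 => j' _.
by rewrite mulr_ge0.
Qed.

(** * Exact approximation by a column *)

Section Chains.
Variables (R : realType) (m : nat) (t : R).
Variables (Phi : nat -> R).
Hypotheses (Phi_gt0 : forall q, 0 < Phi q).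
Variable (B : nat -> node R m).
Hypotheses (B0 : 0 <= (B 0).2)
  (chain : forall k, child R m t Phi (k.+2%:R^-1) (B k) (B k.+1)).
Let c k := (B k).1.1.
Let b k := (B k).1.2.
Let T k := (B k).2.

Lemma chain_T k : k%:R <= T k.
Proof.
elim: k => [//|k IH]; have [_ [h _] _ _ _] := chain k.
by rewrite -natr1; apply: le_trans h; rewrite lerD2r.
Qed.

Lemma chain_nested k l al : (k <= l)%N -> near_cube R m (c l) (b l) al -> near_cube R m (c k) (b k) al.
Proof.
move=> kl; rewrite -(subnKC kl); elim: (l - k)%N => [|d IH]; first by rewrite addn0.
by rewrite addnS; have [_ _ h _ _] := chain (k + d) => /h /IH.
Qed.

Lemma chain_point : (0 <= b 0) -> exists al, forall k, near_cube R m (c k) (b k) al.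
Proof.
move=> b0.
have bk k : 0 <= b k by case: k => // k; have [[/ltW]] := chain k.
(* In each coordinate the limit point is the supremum of the left end points of the nested
   intervals. *)
pose E i : set R := range (fun k => c k i ord0 - b k).
have ub i k : ubound (E i) (c k i ord0 + b k).
  move=> _ [l _ <-].
  have cc p : near_cube R m (c p) (b p) (c p) by rewrite /near_cube distxx.
  pose M := maxn k l.
  have hk := chain_nested k M (c M) (leq_maxl _ _) (cc M).
  have hl := chain_nested l M (c M) (leq_maxr _ _) (cc M).
  have := le_trans (dist_ge _ _ i ord0) hk; have := le_trans (dist_ge _ _ i ord0) hl.
  rewrite !ler_distl => /andP[h1 h2] /andP[h3 h4]; lra.
have hs i : has_sup (E i).
  by split; [exists (c 0 i ord0 - b 0); exists 0%N|exists (c 0 i ord0 + b 0); exact: ub].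
exists (\col_i sup (E i)) => k; apply/dist_leP => // i j; rewrite ord1 mxE distrC ler_distl.
apply/andP; split.
  by apply: ub_le_sup; [case: (hs i)|exists k].
by apply: ge_sup; [case: (hs i)|exact: ub].
Qed.

(** Link k gives a solution with q >= T k >= k, hence there are infinitely many. For d > 1 and k
    with 1 - 1/(k + 2) > 1/d, the links from k on exclude every solution for [Phi] / d with q >= T
    k. *)
Lemma chain_exact al : (forall k, near_cube R m (c k) (b k) al) -> Exact R m 1 Phi al.
Proof.
move=> hal.
have mul1 (q : int) i : (al *m map_mx intr (const_mx q : 'cV[int]_1)) i ord0 = q%:~R * al i ord0.
  by rewrite mxE big_ord_recl big_ord0 addr0 !mxE mulrC; congr (_ * al _ _); exact: val_inj.
have qn (q : 'cV[int]_1) : qnorm 1 q = `|q ord0 ord0|%N.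
  by rewrite /qnorm big_ord_recl big_ord0 maxn0.
have qc (q : 'cV[int]_1) : q = const_mx (q ord0 ord0).
  by apply/matrixP => i j; rewrite !mxE !ord1.
split.
- move=> /finite_seqP[s hs].
  pose M := \max_(pq <- s) qnorm 1 pq.2.
  have [_ _ _ _ [q [p [q0 Tq hq]]]] := chain M.+1.
  have : (\col_i p i, const_mx q%:Z) \in s.
    have : [set` s] (\col_i p i, const_mx q%:Z : 'cV[int]_1).
      rewrite -hs; split => /=.
        apply/eqP => /matrixP/(_ ord0 ord0); rewrite !mxE => /eqP.
        by rewrite eqz_nat -leqn0 leqNgt q0.
      apply/vnorm_leP; first by rewrite ltW.
      move=> i; have := hq al (hal M.+2) i.
      by rewrite qn mxE mul1 !mxE.
    by [].
  move=> hin; have : (qnorm 1 (const_mx q%:Z : 'cV[int]_1) <= M)%N.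
    by rewrite /M (big_rem _ hin) /= leq_maxl.
  rewrite qn mxE /= -(ler_nat R); have := chain_T M.+1; rewrite -natr1.
  by rewrite /T; lra.
- move=> [d /= d1 hd]; apply: hd.
  have [k0 hk0] : exists k0 : nat, (1 - d^-1)^-1 <= k0%:R.
    by exists (Num.truncn (1 - d^-1)^-1).+1; apply: ltW; exact: Num.Theory.truncnS_gt.
  have d0 : 0 < d by lra.
  have dv : d^-1 < 1 by rewrite invf_lt1.
  pose M := (Num.truncn (T k0)).+1.
  pose K := \sum_(q < M.+1) Phi q.
  apply: sub_finite_set (finite_solutions al M K) => -[p q] /= [q0 hq].
  have qn0 : (0 < qnorm 1 q)%N.
    rewrite lt0n; apply: contra_neq q0; rewrite qn => /eqP; rewrite absz_eq0 => /eqP h.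
    by rewrite (qc q) h; apply/matrixP => i j; rewrite !mxE.
  have [qM|Mq] := leqP (qnorm 1 q) M.
    split => //; apply: (le_trans hq); apply: (@le_trans _ _ (Phi (qnorm 1 q))).
      by rewrite ler_pdivrMr // ler_peMr ?(ltW (Phi_gt0 _)) // ltW.
    have hM : (qnorm 1 q < M.+1)%N by [].
    rewrite /K (bigD1 (Ordinal hM)) //= lerDl; apply: sumr_ge0 => i _; exact: ltW.
  exfalso.
  have Tk0 : T k0 <= (qnorm 1 q)%:R.
    apply: (@le_trans _ _ M%:R); last by rewrite ler_nat ltnW.
    by apply: ltW; exact: Num.Theory.truncnS_gt.
  have [k [k0k Tk Tk1]] : exists k, [/\ (k0 <= k)%N, T k <= (qnorm 1 q)%:R & (qnorm 1 q)%:R <= T k.+1].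
    suff : forall j, T (k0 + j) <= (qnorm 1 q)%:R \/ exists k, [/\ (k0 <= k)%N, T k <= (qnorm 1 q)%:R & (qnorm 1 q)%:R <= T k.+1].
      move=> /(_ (qnorm 1 q).+1) [] // h; exfalso; move: h; apply/negP; rewrite -ltNge.
      apply: lt_le_trans (chain_T _); rewrite ltr_nat addnS ltnS leq_addl //.
    elim=> [|j [IH|IH]]; [by left; rewrite addn0| |by right].
    rewrite addnS; case: (leP (T (k0 + j).+1) (qnorm 1 q)%:R) => h; first by left.
    by right; exists (k0 + j)%N; split; [exact: leq_addr|exact: IH|exact: ltW].
  have [_ _ _ h _] := chain k.
  have low (p' : 'I_m -> int) : exists i, Phi (qnorm 1 q) / d < `|(qnorm 1 q)%:R * al i ord0 - (p' i)%:~R|.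
    have [i hi] := h al (hal k.+1) (qnorm 1 q) p' qn0 Tk Tk1; exists i.
    apply: lt_le_trans hi; rewrite mulrC ltr_pM2r //.
    rewrite ltrBrDr addrC -ltrBrDr.
    have v0 : 0 < 1 - d^-1 by lra.
    rewrite invf_plt ?posrE ?ltr0n //; apply: le_lt_trans hk0 _.
    by rewrite ltr_nat; clear -k0k; lia.
  have hv : 0 <= Phi (qnorm 1 q) / d by rewrite divr_ge0 ?ltW.
  have hq' := (vnorm_leP _ _ hv).1 hq.
  have qE i : (al *m map_mx intr q) i ord0 = (q ord0 ord0)%:~R * al i ord0.
    by rewrite {1}(qc q) mul1.
  have pE i : (al *m map_mx intr q - map_mx intr p) i ord0 = (q ord0 ord0)%:~R * al i ord0 - (p i ord0)%:~R.
    by rewrite mxE qE !mxE.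
  have [h0|h0] := leP 0 (q ord0 ord0).
    have [i] := low (fun i => p i ord0); apply/negP; rewrite -leNgt.
    by have := hq' i; rewrite pE qn natr_absz (ger0_norm h0).
  (* For q < 0 the pair (-p, -q) gives the same distances. *)
  have [i] := low (fun i => - p i ord0); apply/negP; rewrite -leNgt.
  have := hq' i; rewrite pE qn natr_absz (ltr0_norm h0).
  by rewrite !intrN mulNr -opprD normrN.
Qed.

End Chains.

(* Every set with finite s-dimensional packing premeasure has this property, see small_set_packing. *)
Definition small_set {R : realType} {m n : nat} (s : R) (F : set 'M[R]_(m, n)) :=
  exists (K d : R), 0 < d /\ forall r, 0 < r <= d -> forall l : seq 'M[R]_(m, n),
    (forall x, x \in l -> F x) -> separated r l -> (size l)%:R <= K * r `^ (- s).

Lemma pairwise_distinct {T : eqType} (e : rel T) (s : seq T) :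
  uniq s -> (forall i j, i != j -> e i j) -> pairwise e s.
Proof.
elim: s => //= x s IH /andP[xs us] h; rewrite IH // andbT.
by apply/allP => y ys; apply: h; apply: contraNneq xs => ->.
Qed.

Lemma powR_small {R : realType} (sg e : R) : 0 < sg -> 0 < e ->
  exists2 d0, 0 < d0 & forall d, 0 < d -> d <= d0 -> d `^ sg <= e.
Proof.
move=> sg0 e0; exists (e `^ sg^-1); first by rewrite powR_gt0.
move=> d d0 dd; apply: (@le_trans _ _ ((e `^ sg^-1) `^ sg)).
  have p0 := powR_ge0 e sg^-1; have d0' := ltW d0; have sg0' := ltW sg0.
  by apply: ge0_ler_powR; rewrite ?nnegrE.
by rewrite -powRrM mulVf ?gt_eqF // powRr1 // ltW.
Qed.

(** * Greedy choice of nested cubes *)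

Section Greedy.
Variables (R : realType) (m : nat) (t : R).
Hypotheses (m_gt0 : (0 < m)%N) (tm : m%:R + 2 < t * m%:R).
Variables (Phi : nat -> R) (T0 : R).
Hypotheses (Phi_gt0 : forall q, 0 < Phi q)
  (Phi_le : forall q : nat, (0 < q)%N -> T0 <= q%:R -> Phi q <= q%:R `^ (- t)).
Local Notation near := (near_cube R m).
Local Notation good := (good_cube R m t).
Local Notation mesh := (mesh R m).

(** Dependent choice with S k as invariant at stage k; what the limit point has to avoid is put into
    S. The halving of the radii brings the cubes below any prescribed scale. *)
Lemma exact_greedy (S : nat -> node R m -> Prop) (B0 : node R m) :
  0 <= B0.1.2 -> 0 <= B0.2 -> S 0%N B0 ->
  (forall k B, S k B -> exists2 B', child R m t Phi (k.+2%:R^-1) B B' & S k.+1 B') ->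
  exists al B_, [/\ Exact R m 1 Phi al, forall k, S k (B_ k),
    forall k, near (B_ k).1.1 (B_ k).1.2 al &
    forall k, (B_ k).1.2 <= B0.1.2 / 2 ^+ k].
Proof.
move=> b0 T00 S0 step.
have H (kB : nat * node R m) : exists B', S kB.1 kB.2 ->
    child R m t Phi (kB.1.+2%:R^-1) kB.2 B' /\ S kB.1.+1 B'.
  case: (pselect (S kB.1 kB.2)) => h; last by exists B0.
  by have [B' h1 h2] := step _ _ h; exists B'.
have [f hf] := choice H.
pose B_ := fix F k := if k is k'.+1 then f (k', F k') else B0.
have SB k : S k (B_ k) by elim: k => // k IH; have [] := hf (k, B_ k) IH.
have chainB k : child R m t Phi (k.+2%:R^-1) (B_ k) (B_ k.+1).
  by have [] := hf (k, B_ k) (SB k).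
have [al hal] := chain_point R m t Phi B_ chainB b0.
exists al, B_; split => //.
  exact: (chain_exact R m t Phi Phi_gt0 B_ T00 chainB al hal).
elim=> [|k IH]; first by rewrite expr0 divr1.
have [_ [_ h] _ _ _] := chainB k; apply: (le_trans h).
by rewrite exprS invfM [_^-1 * _]mulrC mulrA ler_pM2r.
Qed.

(** For radius 1 a large T suffices, since the exponent (t + 1) m - 2 is at least 1. *)
Lemma exists_good_cube : exists T, [/\ good 1 T, T0 <= T & 0 <= T].
Proof.
have tm' := tm.
pose C1 : R := 16 * 2 ^+ (5 * m); pose C2 : R := 16 * (2 ^+ (5 * m) * 11 ^+ m).
have C10 : 0 < C1 by rewrite mulr_gt0 // exprn_gt0.
have C20 : 0 < C2 by rewrite !mulr_gt0 // exprn_gt0.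
have m1 : 1 <= m%:R :> R by rewrite ler1n.
exists (C1 + C2 + `|T0| + 1).
have h0 := normr_ge0 T0; have h1 := ler_norm T0.
split; [split => //; rewrite -?/C1 -?/C2; first by lra| lra | lra].
rewrite expr1n mul1r; apply: (@le_trans _ _ (C1 + C2 + `|T0| + 1)); first lra.
rewrite -[leLHS]powRr1; last by lra.
apply: ler_powR; first by lra.
have : t * m%:R = t * m%:R by []; lra.
Qed.

(** The admissible numbers reach at least 1 once 160 [mesh] <= b, so that rounding down costs at
    most a factor 2, hence 16 in place of 8. *)
Lemma many_children (b : R) : 0 < b -> forall d0, 0 < d0 -> exists N0, forall N, (N0 <= N)%N -> (0 < N)%N ->
  [/\ mesh N <= d0 & exists k : nat, [/\ (0 < k)%N, k%:R * (10 * mesh N) ^+ m <= (b / 2) ^+ m / 8 &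
     b ^+ m <= k%:R * (16 * (20 * mesh N) ^+ m)]].
Proof.
move=> b0 d0 d00.
have b160 : 0 < b / 160 by rewrite divr_gt0.
have dd : 0 < Num.min d0 (b / 160) by rewrite lt_min d00.
have [N0 hN0] := mesh_le R m _ dd.
exists N0 => N NN0 N1; have := hN0 N NN0 N1; rewrite le_min => /andP[h1 h2].
split => //; have de := mesh_gt0 R m N N1.
pose y := (b / 2) ^+ m / 8 / (10 * mesh N) ^+ m.
have de10 : 0 < (10 * mesh N) ^+ m by rewrite exprn_gt0 // mulr_gt0.
have y1 : 1 <= y.
  rewrite /y ler_pdivlMr // mul1r ler_pdivlMr //.
  apply: (@le_trans _ _ ((80 * mesh N) ^+ m)).
    have -> : 80 * mesh N = 8 * (10 * mesh N) by ring.
    rewrite [leRHS]exprMn mulrC ler_pM2r // -[leLHS]expr1 ler_weXn2l //; lra.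
  by rewrite lerXn2r ?nnegrE ?mulr_ge0 ?(ltW de) //; lra.
have y0 : 0 <= y by lra.
have /andP[k1 k2] := Num.Theory.truncn_itv y0.
exists (Num.truncn y); split.
- by rewrite Num.Theory.truncn_gt0.
- by rewrite -ler_pdivlMr.
- have k3 : y <= 2 * (Num.truncn y)%:R.
    have : 1 <= (Num.truncn y)%:R :> R by rewrite ler1n Num.Theory.truncn_gt0.
    by move: k2; rewrite -natr1; lra.
  have -> : b ^+ m = y * (8 * (20 * mesh N) ^+ m).
    have -> : 20 * mesh N = 2 * (10 * mesh N) by ring.
    rewrite /y [(2 * _) ^+ m]exprMn exprMn exprVn; field.
    by rewrite !gt_eqF // exprn_gt0.
  have -> : (Num.truncn y)%:R * (16 * (20 * mesh N) ^+ m) = (2 * (Num.truncn y)%:R) * (8 * (20 * mesh N) ^+ m) by ring.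
  by rewrite ler_pM2r // mulr_gt0 // exprn_gt0 // mulr_gt0.
Qed.

(* At stage k the subcubes are more numerous than the separated points of F k, so one misses F k. *)
Theorem exact_avoid (F : nat -> set 'cV[R]_m) (s : R) : s < m%:R ->
  (forall i, small_set s (F i)) -> exists2 al, Exact R m 1 Phi al & forall i, ~ F i al.
Proof.
move=> sm sF.
have [T [gT T0T Tge0]] := exists_good_cube.
pose S k (B : node R m) := [/\ good B.1.2 B.2, T0 <= B.2 &
  forall i, (i < k)%N -> forall al, near B.1.1 B.1.2 al -> ~ F i al].
have S0 : S 0%N (0, 1, T) by split.
have [] := exact_greedy S (0, 1, T) ler01 Tge0 S0; last first.
  move=> al [B_ [ex SB nB _]]; exists al => // i.
  by have [_ _ h] := SB i.+1; apply: (h i).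
move=> k [[c b] T'] [/= gc T0T' av].
have eps01 : 0 < (k.+2%:R^-1 : R) < 1.
  by rewrite invr_gt0 ltr0n invf_lt1 ?ltr0n // ltr1n.
have [N1 hN1] := children R m t m_gt0 tm Phi T0 Phi_gt0 Phi_le c b T' _ gc T0T' eps01.
have [b0 _ _ _] := gc.
have [K [d [d0 hK]]] := sF k.
have sg0 : 0 < m%:R - s by lra.
pose K' := `|K| + 1.
have K'0 : 0 < K' by rewrite ltr_pwDr.
(* With (2 [mesh])^(m - s) at most this value, K (2 [mesh])^-s is less than the number n of
   subcubes. *)
have e0 : 0 < b ^+ m / (2 * K' * (16 * 10 ^+ m)).
  by rewrite divr_gt0 ?exprn_gt0 // !mulr_gt0 // exprn_gt0.
have [d1 d10 hd1] := powR_small _ _ sg0 e0.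
have dm0 : 0 < Num.min (d / 2) (d1 / 2) by rewrite lt_min !divr_gt0.
have [N2 hN2] := many_children b b0 _ dm0.
pose N := (maxn N1 N2).+1.
have NN1 : (N1 <= N)%N by rewrite leqW // leq_maxl.
have NN2 : (N2 <= N)%N by rewrite leqW // leq_maxr.
have [me [n [n0 nb1 nb2]]] := hN2 N NN2 isT.
have [f [f1 f2 _]] := hN1 N NN1 isT n nb1.
suff [j hj] : exists j, forall al, near (f j).1.1 (f j).1.2 al -> ~ F k al.
  exists (f j) => //; have [g' [/= TT _] sub _ _] := f1 j; split => //.
    by apply: le_trans T0T' _; apply: le_trans TT; rewrite lerDl.
  by move=> i; rewrite ltnS leq_eqVlt => /orP[/eqP -> //|ik] al /sub; exact: av.
apply: contrapT => hj.
(* If every subcube met F k, one point from each would form a family of n points of F k with mutual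
   distances above 2 [mesh]. *)
have H j : exists al, near (f j).1.1 (f j).1.2 al /\ F k al.
  apply: contrapT => h; apply: hj; exists j => al h1 h2; apply: h; exists al; split => //.
have [y hy] := choice H.
move: me; rewrite le_min => /andP[me1 me2].
have de := mesh_gt0 R m N isT.
have r01 : 0 < 2 * mesh N <= d by rewrite mulr_gt0 //=; lra.
have := hK _ r01 [seq y j | j <- enum 'I_n].
have -> : size [seq y j | j <- enum 'I_n] = n by rewrite size_map size_enum_ord.
have yF x : x \in [seq y j | j <- enum 'I_n] -> F k x by move=> /mapP[j _ ->]; have [] := hy j.
have ysep : separated (2 * mesh N) [seq y j | j <- enum 'I_n].
  rewrite /separated pairwise_map; apply: pairwise_distinct; first exact: enum_uniq.
  by move=> i j ij /=; have [h1 _] := hy i; have [h2 _] := hy j; exact: (f2 i j).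
move=> /(_ yF ysep); apply/negP; rewrite -ltNge.
have r2 : 0 < 2 * mesh N by rewrite mulr_gt0.
have h : (2 * mesh N) `^ (m%:R - s) <= b ^+ m / (2 * K' * (16 * 10 ^+ m)).
  by apply: hd1 => //; rewrite mulrC -ler_pdivlMr.
have -> : - s = (m%:R - s) - m%:R by ring.
rewrite powRD; last by rewrite (gt_eqF r2) implybT.
rewrite powRN powR_mulrn ?(ltW r2) //.
have rm : 0 < (2 * mesh N) ^+ m by rewrite exprn_gt0.
rewrite mulrA ltr_pdivrMr //.
apply: (@le_lt_trans _ _ (K' * (2 * mesh N) `^ (m%:R - s))).
  by rewrite ler_wpM2r ?powR_ge0 // /K' (le_trans (ler_norm K)) // lerDl.
apply: (@le_lt_trans _ _ (K' * (b ^+ m / (2 * K' * (16 * 10 ^+ m))))); first by rewrite ler_pM2l.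
have -> : K' * (b ^+ m / (2 * K' * (16 * 10 ^+ m))) = b ^+ m / (16 * 10 ^+ m) / 2.
  by field; rewrite !gt_eqF // exprn_gt0.
have c0 : 0 < 16 * 10 ^+ m :> R by rewrite mulr_gt0 // exprn_gt0.
apply: (@lt_le_trans _ _ (b ^+ m / (16 * 10 ^+ m))).
  have : 0 < b ^+ m / (16 * 10 ^+ m) by rewrite divr_gt0 // exprn_gt0.
  by move=> z0; rewrite ltr_pdivrMr // ltr_pMr // ltr1n.
rewrite ler_pdivrMr //; apply: (le_trans nb2).
have -> : 20 * mesh N = 10 * (2 * mesh N) by ring.
by rewrite exprMn -mulrA; rewrite [(2 * mesh N) ^+ m * _]mulrC -!mulrA.
Qed.

(* Upper bound for the proportion of the construction inside a cube of radius b that a set of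
   diameter r can meet. *)
Definition hit (s b r : R) : R := Num.min 1 (16 * 30 ^+ m * (r / b) `^ s).

Definition meets (U : set 'cV[R]_m) (B : node R m) : R :=
  (`[< exists x, U x /\ near B.1.1 B.1.2 x >] : bool)%:R.

Lemma hit_ge0 s b r : 0 <= hit s b r.
Proof. by rewrite /hit le_min ler01 mulr_ge0 ?powR_ge0 // mulr_ge0 // exprn_ge0. Qed.

(** If r <= 2 [mesh], U meets at most one subcube, and (b/bm)^s <= k compares [hit] at the radii bm
    and b. Otherwise, for r < b, a volume count bounds the subcubes met by (3 r / (2 [mesh]))^m;
    divided by k >= b^m / (16 (20 [mesh])^m) this is 16 (30 r/b)^m, the origin of the constant in
    [hit], and s <= m allows the exponent s for r/b. *)
Lemma children_hit (s b bm r : R) (k N : nat) (f : 'I_k -> node R m) (U : set 'cV[R]_m) :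
  0 <= s -> s <= m%:R -> 0 < b -> 0 < bm -> 0 < r -> (0 < N)%N -> (0 < k)%N ->
  (forall x y, U x -> U y -> dist x y <= r) ->
  (forall i j al al', i != j -> near (f i).1.1 (f i).1.2 al ->
      near (f j).1.1 (f j).1.2 al' -> 2 * mesh N < dist al al') ->
  (forall i, bm <= (f i).1.2) ->
  b ^+ m <= k%:R * (16 * (20 * mesh N) ^+ m) ->
  (b / bm) `^ s <= k%:R ->
  \sum_(j < k) hit s (f j).1.2 r * meets U (f j) <= k%:R * hit s b r.
Proof.
move=> s0 sm b0 bm0 r0 N0 k0 Ur fsep fbm kb ks.
have de := mesh_gt0 R m N N0.
have one_powR (y : R) : 1 `^ y = 1 :> R by rewrite powR1.
have C0 : 1 <= 16 * 30 ^+ m :> R.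
  have : 1 <= 30 ^+ m :> R by rewrite exprn_ege1 // ler1n.
  lra.
have k1 : 1 <= k%:R :> R by rewrite ler1n.
pose P : {set 'I_k} := [set j : 'I_k | `[< exists x, U x /\ near (f j).1.1 (f j).1.2 x >]]%SET.
have mP j : meets U (f j) = (j \in P)%:R by rewrite /meets inE.
have inP j : j \in P -> exists x, U x /\ near (f j).1.1 (f j).1.2 x.
  by rewrite finset.in_set => /asboolP.
have cardP (h : R) : 0 <= h -> (forall j, hit s (f j).1.2 r <= h) ->
    \sum_(j < k) hit s (f j).1.2 r * meets U (f j) <= #|P|%:R * h.
  move=> h0 hh; apply: (@le_trans _ _ (\sum_(j < k) h * (j \in P)%:R)).
    by apply: ler_sum => j _; rewrite mP ler_wpM2r.
  rewrite -mulr_sumr mulrC ler_wpM2r // -natr_sum ler_nat.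
  by rewrite -sum1_card [leqRHS]big_mkcond.
have Pk : (#|P| <= k)%N by have := max_card P; rewrite card_ord.
have [r2|r2] := leP r (2 * mesh N).
  have P1 : (#|P| <= 1)%N.
    rewrite leqNgt; apply/negP => /card_gt1P[i [j [iP jP ij]]].
    have [x [Ux nx]] := inP i iP; have [y [Uy ny]] := inP j jP.
    have := fsep i j x y ij nx ny; apply/negP; rewrite -leNgt.
    by apply: le_trans r2; exact: Ur.
  pose h := Num.min 1 (16 * 30 ^+ m * (r / bm) `^ s).
  have h0 : 0 <= h by exact: (hit_ge0 s bm r).
  apply: (le_trans (cardP h h0 _)).
    move=> j; rewrite /hit /h le_min ge_min lexx /= ge_min; apply/orP; right.
    rewrite ler_pM2l ?(lt_le_trans ltr01 C0) //.
    have fj := fbm j; have fj0 : 0 < (f j).1.2 by exact: lt_le_trans fj.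
    apply: ge0_ler_powR => //; rewrite ?nnegrE ?divr_ge0 ?(ltW r0) ?(ltW fj0) ?(ltW bm0) //.
    by rewrite ler_pM2l // lef_pV2.
  apply: (@le_trans _ _ h).
    by rewrite ler_piMl // -[1]/(1%:R) ler_nat.
  rewrite /h /hit minr_pMr ?ler0n // mulr1 le_min; apply/andP; split.
    by rewrite ge_min k1.
  rewrite ge_min; apply/orP; right.
  rewrite mulrCA ler_pM2l ?(lt_le_trans ltr01 C0) //.
  have -> : r / bm = (b / bm) * (r / b) by field; rewrite !gt_eqF.
  have z1 := ltW (divr_gt0 b0 bm0); have z2 := ltW (divr_gt0 r0 b0).
  by rewrite powRM // ler_wpM2r // powR_ge0.
apply: (@le_trans _ _ (#|P|%:R * 1)).
  by apply: cardP => // j; rewrite /hit ge_min lexx.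
rewrite mulr1 /hit minr_pMr ?ler0n // mulr1 le_min ler_nat Pk /=.
have [rb|br] := leP b r.
  apply: (@le_trans _ _ k%:R); first by rewrite ler_nat.
  have zs : 1 <= (r / b) `^ s.
    rewrite -(one_powR s); apply: ge0_ler_powR; rewrite ?nnegrE ?ler01 //.
      exact: ltW (divr_gt0 r0 b0).
    by rewrite ler_pdivlMr // mul1r.
  by rewrite ler_peMr //; apply: (le_trans C0); rewrite ler_peMr // (le_trans ler01 C0).
have cP : #|P|%:R * (2 * mesh N) ^+ m <= (3 * r) ^+ m.
  have [P0|] := posnP #|P|; first by rewrite P0 mul0r exprn_ge0 // mulr_ge0 // ltW.
  move=> /card_gt0P[j0 j0P].
  have H j : exists x, j \in P -> U x /\ near (f j).1.1 (f j).1.2 x.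
    case: (boolP (j \in P)) => jP; last by exists 0.
    by have [x hx] := inP j jP; exists x.
  have [y hy] := choice H.
  have [Uj0 _] := hy j0 j0P.
  have := @size_separated R m 1 [seq y j | j <- enum P] (y j0) (mesh N) r de (ltW r0).
  rewrite muln1 size_map -cardE => hs.
  apply: le_trans (hs _ _) _.
  - rewrite /separated pairwise_map.
    have : {in enum P &, forall i j, i != j -> 2 * mesh N < dist (y i) (y j)}.
      move=> i j; rewrite !mem_enum => iP jP ij.
      by have [_ h1] := hy i iP; have [_ h2] := hy j jP; exact: fsep ij h1 h2.
    have := enum_uniq P; elim: (enum P) => //= x l IH /andP[xl ul] hl.
    apply/andP; split.
      apply/allP => z zl /=; apply: hl; rewrite ?mem_head // ?inE ?zl ?orbT //.
      by apply: contraNneq xl => ->.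
    by apply: IH => // i j il jl; apply: hl; rewrite inE ?il ?jl orbT.
  - by move=> x /mapP[j]; rewrite mem_enum => jP ->; apply: Ur => //; have [] := hy j jP.
  - rewrite lerXn2r ?nnegrE ?mulr_ge0 ?addr_ge0 ?(ltW r0) ?(ltW de) //; lra.
have rb1 : (r / b) ^+ m <= (r / b) `^ s.
  have z0 : 0 < r / b by exact: divr_gt0.
  have z1 : r / b <= 1 by rewrite ler_pdivrMr // mul1r ltW.
  rewrite -powR_mulrn ?(ltW z0) // -[X in _ `^ X](subrK s) addrC.
  rewrite powRD; last by rewrite (gt_eqF z0) implybT.
  have ms : 0 <= m%:R - s by rewrite subr_ge0.
  rewrite ler_piMr ?powR_ge0 //; apply: (@le_trans _ _ (1 `^ (m%:R - s))); last by rewrite one_powR.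
  by apply: ge0_ler_powR; rewrite ?nnegrE // ltW.
rewrite -(ler_pM2r (_ : 0 < (2 * mesh N) ^+ m)); last by rewrite exprn_gt0 // mulr_gt0.
apply: (le_trans cP).
apply: (@le_trans _ _ (k%:R * (16 * 30 ^+ m * (r / b) ^+ m) * (2 * mesh N) ^+ m)); last first.
  have M0 : 0 < (2 * mesh N) ^+ m by rewrite exprn_gt0 // mulr_gt0.
  have Cp := lt_le_trans ltr01 C0; have kp := lt_le_trans ltr01 k1.
  by rewrite (ler_pM2r M0) (ler_pM2l kp) (ler_pM2l Cp).
have -> : k%:R * (16 * 30 ^+ m * (r / b) ^+ m) * (2 * mesh N) ^+ m
  = k%:R * (16 * (20 * mesh N) ^+ m) * (3 * (r / b)) ^+ m.
  have -> : 20 * mesh N = 10 * (2 * mesh N) by ring.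
  have -> : 30 = 10 * 3 :> R by ring.
  by rewrite !exprMn; ring.
have -> : (3 * r) ^+ m = b ^+ m * (3 * (r / b)) ^+ m.
  by rewrite -exprMn; congr (_ ^+ _); field; rewrite gt_eqF.
by rewrite ler_pM2r // exprn_gt0 // mulr_gt0 // divr_gt0.
Qed.

(* Greedy mass distribution: by children_hit the average over the subcubes of \sum_i w i * hit does
   not exceed the value for the cube, so some subcube does not exceed it either. *)
Theorem exact_weighted (s : R) : 0 <= s -> s <= m%:R ->
  (forall q q' : nat, (q <= q')%N -> Phi q' <= Phi q) ->
  (forall (A : R) N0, exists N, [/\ (N0 <= N)%N, (0 < N)%N &
     A * (Phi (N ^ m)%N / N%:R ^+ m) `^ (- s) <= (N%:R ^+ m) ^+ m.+1]) ->
  exists2 C : R, 0 < C & forall (U : nat -> set 'cV[R]_m) (w r : nat -> R),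
    (forall i, 0 <= w i) -> (forall i, 0 < r i) ->
    (forall i x y, U i x -> U i y -> dist x y <= r i) ->
    sums_le (fun i => w i * r i `^ s) C ->
    exists2 al, Exact R m 1 Phi al & sums_le (fun i => w i * \1_(U i) al) (1 / 2).
Proof.
move=> s0 sm dec HN.
have C0 : 1 <= 16 * 30 ^+ m :> R.
  have : 1 <= 30 ^+ m :> R by rewrite exprn_ege1 // ler1n.
  lra.
have Cp := lt_le_trans ltr01 C0.
exists (16 * 30 ^+ m * 2)^-1; first by rewrite invr_gt0 mulr_gt0.
move=> U w r w0 r0 Ur sumC.
have [T [gT T0T Tge0]] := exists_good_cube.
pose V (B : node R m) i := w i * (hit s B.1.2 (r i) * meets (U i) B).
have V0 B i : 0 <= V B i by rewrite !mulr_ge0 ?hit_ge0 // /meets.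
pose S (k : nat) (B : node R m) := [/\ good B.1.2 B.2, T0 <= B.2 & sums_le (V B) (1 / 2)].
have S0 : S 0%N (0, 1, T).
  split => // l ul; apply: (@le_trans _ _ (\sum_(i <- l) (16 * 30 ^+ m) * (w i * r i `^ s))).
    apply: ler_sum => i _; rewrite mulrCA /V ler_wpM2l //=.
    apply: (@le_trans _ _ (hit s 1 (r i) * 1)).
      by rewrite ler_wpM2l ?hit_ge0 // /meets; case: asbool.
    by rewrite mulr1 /hit divr1 ge_min lexx orbT.
  rewrite -mulr_sumr; apply: (@le_trans _ _ (16 * 30 ^+ m * (16 * 30 ^+ m * 2)^-1)).
    by rewrite ler_pM2l //; exact: sumC.
  by rewrite invfM mulrA divff ?gt_eqF // mul1r div1r.
have [] := exact_greedy S (0, 1, T) ler01 Tge0 S0; last first.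
  move=> al [B_ [ex SB nB bB]]; exists al => // l ul.
  (* Only finitely many i occur in l, so at some stage the cube is smaller than all their r i. There
     [hit] is 1, and V is at least the weight times the indicator. *)
  have [k hk] : exists k, forall i, i \in l -> (B_ k).1.2 <= r i.
    suff [e e0 he] : exists2 e : R, 0 < e & forall i, i \in l -> e <= r i.
      have [N hN] := nat_large R e^-1.
      exists N => i il; apply: le_trans (he i il); apply: (le_trans (bB N)).
      rewrite div1r /=; rewrite -[leRHS]invrK lef_pV2 ?posrE ?exprn_gt0 ?invr_gt0 //.
      apply: (le_trans (hN N (leqnn _))).
      by rewrite -natrX ler_nat ltnW // ltn_expl.
    elim: l {ul} => [|i l [e e0 he]]; first by exists 1.
    exists (Num.min e (r i)); first by rewrite lt_min e0 r0.
    move=> j; rewrite inE => /orP[/eqP ->|jl]; first by rewrite ge_min lexx orbT.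
    by rewrite ge_min he.
  have [[bk0 _ _ _] _ sV] := SB k.
  apply: le_trans (sV l ul); rewrite big_seq [leRHS]big_seq; apply: ler_sum => i il.
  rewrite /V ler_wpM2l //.
  have hit1 : hit s (B_ k).1.2 (r i) = 1.
    rewrite /hit; apply/min_idPl; apply: (le_trans C0); rewrite ler_peMr ?(ltW Cp) //.
    apply: (@le_trans _ _ (1 `^ s)); first by rewrite powR1.
    have z0 := ltW (divr_gt0 (r0 i) bk0).
    by apply: ge0_ler_powR; rewrite ?nnegrE // ler_pdivlMr // mul1r; exact: hk.
  rewrite hit1 mul1r indicE; case: (boolP (al \in U i)) => [|_]; last by rewrite /meets.
  by rewrite inE => Ual; rewrite /meets; case: asboolP => // h; case: h; exists al.
move=> k [[c b] T'] [/= gc T0T' sV].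
have eps01 : 0 < (k.+2%:R^-1 : R) < 1.
  by rewrite invr_gt0 ltr0n invf_lt1 ?ltr0n // ltr1n.
set eps := k.+2%:R^-1 in eps01 *.
have /andP[e0 e1] := eps01.
have [N1 hN1] := children R m t m_gt0 tm Phi T0 Phi_gt0 Phi_le c b T' _ gc T0T' eps01.
have [b0 _ _ _] := gc.
have [N2 hN2] := many_children b b0 1 ltr01.
(* A collects the factors in (b/bm)^s <= n that do not depend on N. *)
pose A := (b / (eps / 2)) `^ s * (16 * 20 ^+ m * (dens m)%:R ^+ m) / b ^+ m.
have [N [NN NN0 hA]] := HN A (maxn N1 N2).
move: NN; rewrite geq_max => /andP[NN1 NN2].
have [_ [n [n0 nb1 nb2]]] := hN2 N NN2 NN0.
have [f [f1 f2 f3]] := hN1 N NN1 NN0 n nb1.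
have Np : 0 < N%:R :> R by rewrite ltr0n.
pose Fr := Phi (N ^ m)%N / N%:R ^+ m.
have Fr0 : 0 < Fr by rewrite divr_gt0 // exprn_gt0.
pose bm := Fr * (eps / 2).
have bm0 : 0 < bm by rewrite mulr_gt0 // divr_gt0.
have hbn : (b / bm) `^ s <= n%:R.
  have -> : b / bm = (b / (eps / 2)) * Fr^-1.
    by rewrite /bm; field; rewrite !gt_eqF.
  have z1 : 0 <= b / (eps / 2) by rewrite ltW // !divr_gt0.
  rewrite powRM // ?invr_ge0 ?(ltW Fr0) //.
  have -> : Fr^-1 `^ s = Fr `^ (- s).
    by rewrite -powR_inv1 ?(ltW Fr0) // -powRrM mulN1r.
  have D0 : 0 < (dens m)%:R :> R by rewrite ltr0n dens_gt0.
  have bmm : 0 < b ^+ m by rewrite exprn_gt0.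
  have c0 : 0 < 16 * 20 ^+ m * (dens m)%:R ^+ m :> R.
    by rewrite !mulr_gt0 // exprn_gt0.
  have hA' : (b / (eps / 2)) `^ s * Fr `^ (- s) * (16 * 20 ^+ m * (dens m)%:R ^+ m)
       <= (N%:R ^+ m) ^+ m.+1 * b ^+ m.
    by rewrite -ler_pdivrMr //; apply: le_trans hA; rewrite /A -/Fr le_eqVlt; apply/orP; left; apply/eqP; ring.
  rewrite -(ler_pM2r c0); apply: (le_trans hA').
  have QQ : 0 < (N%:R ^+ m) ^+ m.+1 :> R by rewrite !exprn_gt0.
  apply: (@le_trans _ _ ((N%:R ^+ m) ^+ m.+1 * (n%:R * (16 * (20 * mesh N) ^+ m)))).
    by rewrite ler_pM2l.
  rewrite le_eqVlt; apply/orP; left; apply/eqP.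
  have -> : mesh N = (dens m)%:R / N%:R ^+ m.+1 by [].
  rewrite exprMn exprMn exprVn -!exprM mulnC.
  by field; rewrite gt_eqF // exprn_gt0.
suff [j hj] : exists j, sums_le (V (f j)) (1 / 2).
  exists (f j) => //; have [g' [/= TT _] sub _ _] := f1 j; split => //.
  by apply: le_trans T0T' _; apply: le_trans TT; rewrite lerDl.
apply: contrapT => hj.
have H j : exists l, uniq l /\ 1 / 2 < \sum_(i <- l) V (f j) i.
  apply: contrapT => h; apply: hj; exists j => l ul.
  by rewrite leNgt; apply/negP => h'; apply: h; exists l.
have [l hl] := choice H.
(* Each bad subcube has its own finite witness; L serves all of them at once, so that the two sums
   can be exchanged. *)
pose L := undup (flatten [seq l j | j <- enum 'I_n]).
have lL j : {subset l j <= L}.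
  move=> i il; rewrite mem_undup; apply/flattenP; exists (l j) => //.
  by apply: map_f; rewrite mem_enum.
have bigS : n%:R * (1 / 2) < \sum_(j < n) \sum_(i <- L) V (f j) i.
  have -> : n%:R * (1 / 2) = \sum_(j < n) (1 / 2) :> R.
    by rewrite sumr_const card_ord mulr_natl.
  apply: ltr_sum => [|j _]; first by apply/hasP; exists (Ordinal n0); rewrite ?mem_index_enum.
  have [ul hlj] := hl j; apply: (lt_le_trans hlj); apply: sum_uniq_sub => //.
move: bigS; apply/negP; rewrite -leNgt exchange_big /=.
apply: (@le_trans _ _ (\sum_(i <- L) n%:R * V (c, b, T') i)); last first.
  by rewrite -mulr_sumr ler_pM2l ?ltr0n //; apply: sV; exact: undup_uniq.
apply: ler_sum => i _; rewrite /V -mulr_sumr mulrCA ler_wpM2l //=.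
rewrite /meets; case: asboolP => [_|nm].
  rewrite mulr1; apply: (children_hit s b bm (r i) n N f (U i)) => //.
    exact: Ur.
  by move=> j; exact: f3.
rewrite !mulr0 big1 // => j _.
case: asboolP => [[x [Ux nx]]|_]; last by rewrite mulr0.
by case: nm; exists x; split => //; have [_ _ sub _ _] := f1 j; exact: sub.
Qed.

End Greedy.

(** * Adding a column *)

(** A vector of norm k is determined by the position of a coordinate of absolute value k, its sign,
    and the other N coordinates with 2 k + 1 possible values each. *)
Lemma size_qnorm (N k : nat) (s : seq 'cV[int]_N.+1) : uniq s ->
  (forall q, q \in s -> qnorm N.+1 q = k) -> (size s <= N.+1 * 2 * (2 * k).+1 ^ N)%N.
Proof.
move=> us hs.
pose piv (q : 'cV[int]_N.+1) : 'I_N.+1 := odflt ord0 [pick i | `|q i ord0|%N == qnorm N.+1 q].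
have pivP (q : 'cV[int]_N.+1) : `|q (piv q) ord0|%N = qnorm N.+1 q.
  rewrite /piv; case: pickP => [i /eqP //|h].
  have c0 : (0 < #|'I_N.+1|)%N by rewrite card_ord.
  have [i hi] := @bigop.eq_bigmax 'I_N.+1 (fun i => `|q i ord0|%N) c0.
  by have := h i; rewrite /qnorm hi eqxx.
have le_qnorm (q : 'cV[int]_N.+1) i : (`|q i ord0|%N <= qnorm N.+1 q)%N.
  by apply: (leq_bigmax (F := fun i => `|q i ord0|%N) i).
pose g (q : 'cV[int]_N.+1) : 'I_N.+1 * bool * {ffun 'I_N -> 'I_(2 * k).+1} :=
  (piv q, (0 <= q (piv q) ord0)%R, [ffun i => inord (absz (q (lift (piv q) i) ord0 + k%:Z)%R)]).
have gI : {in s &, injective g}.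
  move=> q q' qs q's [e1 e2 /ffunP e3].
  have qk := hs q qs; have q'k := hs q' q's.
  apply/matrixP => i j; suff : q i ord0 = q' i ord0 by rewrite (ord1 j).
  case: (unliftP (piv q) i) => [i' ->|->].
    have := e3 i'; rewrite !ffunE -e1 => /(congr1 val) /=.
    have := le_qnorm q (lift (piv q) i'); have := le_qnorm q' (lift (piv q) i').
    rewrite qk q'k => h1 h2; rewrite !inordK; lia.
  have := pivP q; have := pivP q'; rewrite qk q'k -e1; move: e2; rewrite -e1.
  by move: (q _ _) (q' _ _) => x y; case: (lerP 0 x); case: (lerP 0 y) => //; lia.
rewrite -(size_map g).
have /card_uniqP <- : uniq (map g s) by rewrite map_inj_in_uniq.
by apply: leq_trans (max_card _) _; rewrite !card_prod card_bool card_ffun !card_ord.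
Qed.

(** Vectors are grouped by norm; 2 k + 1 <= 3 k turns the count of [size_qnorm] into a multiple of
    k^N. *)
Lemma sums_le_qnorm {R : realType} (N : nat) (g : nat -> R) (T : nat) (K : R) :
  (0 < T)%N -> (forall k, 0 <= g k) ->
  (forall k, (T <= k)%N -> g k * k%:R ^+ N <= K * k%:R ^- 2) -> 0 <= K ->
  sums_le (fun q : 'cV[int]_N.+1 => (T <= qnorm N.+1 q)%N%:R * g (qnorm N.+1 q))
    (2 * N.+1%:R * 3 ^+ N * K * (2 / T%:R)).
Proof.
move=> T0 g0 gK K0 s us.
pose M := (\max_(q <- s) qnorm N.+1 q).+1.
have hM q : q \in s -> (qnorm N.+1 q < M)%N.
  by move=> qs; rewrite /M ltnS (big_rem _ qs) /= leq_maxl.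
have -> : \sum_(q <- s) (T <= qnorm N.+1 q)%N%:R * g (qnorm N.+1 q) =
  \sum_(T <= k < M) \sum_(q <- s | qnorm N.+1 q == k) g k.
  rewrite (exchange_big_dep xpredT) //= big_seq [RHS]big_seq; apply: eq_bigr => q qs.
  have [Tq|qT] := leqP T (qnorm N.+1 q).
    rewrite mul1r big_mkcond (bigD1_seq (qnorm N.+1 q)) /= ?iota_uniq ?mem_index_iota ?Tq ?hM //.
    by rewrite eqxx big1 ?addr0 // => k; rewrite eq_sym => /negbTE ->.
  rewrite mul0r big_nat_cond big1 // => k /andP[/andP[Tk _] /eqP qk].
  by move: qT; rewrite qk ltnNge Tk.
apply: (@le_trans _ _ (\sum_(T <= k < M) 2 * N.+1%:R * 3 ^+ N * K * k%:R ^- 2)).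
  rewrite big_nat_cond [leRHS]big_nat_cond; apply: ler_sum => k /andP[/andP[Tk _] _].
  rewrite -big_filter big_const_seq count_predT iter_addr_0.
  have us' : uniq [seq q <- s | qnorm N.+1 q == k] by exact: filter_uniq.
  have := size_qnorm N k _ us'.
  have hk q : q \in [seq q <- s | qnorm N.+1 q == k] -> qnorm N.+1 q = k.
    by rewrite mem_filter => /andP[/eqP].
  move=> /(_ hk); move: (size _) => c hc.
  have k1 : (1 <= k)%N by exact: leq_trans Tk.
  rewrite -[_ *+ c]mulr_natr.
  apply: (@le_trans _ _ (g k * (2 * N.+1%:R * 3 ^+ N * k%:R ^+ N))).
    rewrite ler_wpM2l //; apply: (@le_trans _ _ (N.+1 * 2 * (2 * k).+1 ^ N)%N%:R); first by rewrite ler_nat.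
    apply: (@le_trans _ _ (N.+1 * 2 * (3 ^ N * k ^ N))%N%:R); last first.
      by rewrite !natrM !natrX le_eqVlt; apply/orP; left; apply/eqP; ring.
    rewrite ler_nat leq_mul2l -expnMn; apply/orP; right.
    by case: (N) => // N'; rewrite leq_exp2r //; lia.
  have -> : g k * (2 * N.+1%:R * 3 ^+ N * k%:R ^+ N) = 2 * N.+1%:R * 3 ^+ N * (g k * k%:R ^+ N) by ring.
  by rewrite -[leRHS]mulrA ler_pM2l ?gK // !mulr_gt0 // exprn_gt0.
rewrite -mulr_sumr ler_wpM2l ?mulr_ge0 ?exprn_ge0 //.
exact: sum_inv_sq.
Qed.

(** About |q| intervals of length 2 e / |q| give a bound independent of q; with |q| >= 1 and e <= 1
    the factor 2 (|q| + 2 e + 3) / |q| is at most 12. *)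
Lemma near_multiples {R : realType} (q : int) (s e : R) : q != 0 -> 0 <= e -> e <= 1 ->
  exists V : set R, [/\ measurable V, (lebesgue_measure V <= (12 * e)%:E)%E &
    forall x (p : int), 0 <= x <= 1 -> `|q%:~R * x + s - p%:~R| <= e -> V x].
Proof.
move=> q0 e0 e1.
pose a : R := `|q|%:~R.
have a1 : 1 <= a by rewrite /a ler1z -gtz0_ge1 normr_gt0.
have a0 : 0 < a by lra.
pose sg : int := if 0 <= q then 1 else -1.
have qE : q%:~R = sg%:~R * a :> R.
  rewrite /a -intrM; congr (_%:~R); rewrite /sg; case: ifP => h; lia.
have sg2 : sg%:~R * sg%:~R = 1 :> R by rewrite -intrM /sg; case: ifP.
have sg1 : `|sg%:~R| = 1 :> R by rewrite /sg; case: ifP => _; rewrite ?normr1 // mulrN1z normrN1.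
have [V [mV lV hV]] := near_fractions a (- (sg%:~R * s)) (e / a) 0 1 a0 (divr_ge0 e0 (ltW a0)) ler01.
exists V; split => //.
  apply: (le_trans lV); rewrite lee_fin.
  have -> : (a * 1 + 2 * a * (e / a) + 3) * (2 * (e / a)) = (a + 2 * e + 3) * 2 / a * e.
    by field; rewrite gt_eqF.
  by rewrite ler_wpM2r // ler_pdivrMr //; lra.
move=> x p x01 h; apply: (hV x (sg * p)); first by rewrite add0r.
rewrite -(ler_pM2l a0) mulrCA divff ?gt_eqF // mulr1.
apply: le_trans h; rewrite -{1}(gtr0_norm a0) -normrM.
rewrite -[leLHS]mul1r -{1}sg1 -normrM le_eqVlt; apply/orP; left; apply/eqP; congr `| _ |.
rewrite intrM qE.
have -> : sg%:~R * (a * (x - (sg%:~R * p%:~R - sg%:~R * s) / a)) =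
  sg%:~R * a * x - (sg%:~R * sg%:~R) * (p%:~R - s) by field; rewrite gt_eqF.
by rewrite sg2 mul1r; ring.
Qed.

Lemma qnorm_col0 (n : nat) (q : 'cV[int]_n) :
  qnorm n.+1 (col_mx (0 : 'cV[int]_1) q : 'cV[int]_(1 + n)) = qnorm n q.
Proof.
rewrite /qnorm big_ord_recl.
have -> : (col_mx (0 : 'cV[int]_1) q) ord0 ord0 = 0.
  have -> : ord0 = lshift n ord0 :> 'I_(1 + n) by exact: val_inj.
  by rewrite col_mxEu mxE.
rewrite absz0 max0n; apply: eq_bigr => i _.
have -> : lift ord0 i = rshift 1 i :> 'I_(1 + n) by exact: val_inj.
by congr absz; exact: (col_mxEd (0 : 'cV[int]_1) q i ord0).
Qed.

Lemma mul_row_col0 {R : realType} (m n : nat) (v : 'cV[R]_m) (A : 'M[R]_(m, n)) (q : 'cV[int]_n) :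
  row_mx v A *m map_mx intr (col_mx (0 : 'cV[int]_1) q) = A *m map_mx intr q.
Proof. by rewrite map_col_mx mul_row_col map_mx0 mulmx0 add0r. Qed.

Lemma mul_row_col_coord {R : realType} (m n : nat) (v : 'cV[R]_m) (A : 'M[R]_(m, n))
    (q : 'cV[int]_(1 + n)) j :
  (row_mx v A *m map_mx intr q) j ord0 =
  (q ord0 ord0)%:~R * v j ord0 + (A *m map_mx intr (dsubmx q)) j ord0.
Proof.
rewrite -{1}[q]vsubmxK map_col_mx mul_row_col mxE; congr (_ + _).
rewrite mxE big_ord_recl big_ord0 addr0 !mxE mulrC; congr (_ * _).
by congr (_%:~R); congr (q _ _); exact: val_inj.
Qed.

(** The given sets and the sets of v admitting a large solution with nonzero first coordinate form
    one weighted family over [0, 1]^m. There are at most a constant times k^n vectors of norm k,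
    each costing 12^m k^(-t m), and n - t m <= -2. Both halves of the family get 1/8, which is less
    than 1/2 in total; as the second half has weights 0 and 1, a sum of at most 1/2 means
    avoidance. *)
Lemma add_column {R : realType} (m n : nat) (t T0 : R) (Phi : nat -> R) (I : countType)
    (A : 'M[R]_(m, n)) (U : I -> set 'cV[R]_m) (w r : I -> R) :
  0 < t -> n%:R + 2 <= t * m%:R -> (forall q, 0 < Phi q) ->
  (forall q : nat, (0 < q)%N -> T0 <= q%:R -> Phi q <= q%:R `^ (- t)) ->
  Exact R m n Phi A ->
  (forall i, 0 <= w i) -> (forall i, 0 <= r i) ->
  (forall i x y, U i x -> U i y -> dist x y <= r i) ->
  sums_le (fun i => w i * r i ^+ m) (8 * 2 ^+ m)^-1 ->
  exists2 v : 'cV[R]_m, Exact R m n.+1 Phi (row_mx v A : 'M[R]_(m, 1 + n)) &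
    sums_le (fun i => w i * \1_(U i) v) (1 / 2).
Proof.
move=> t0 tm Phi_gt0 Phi_le exA w0 r0 Ur sumw.
pose K : R := 12 ^+ m.
have K0 : 0 < K by rewrite exprn_gt0.
have [T1 hT1] := nat_large R (8 * (2 * n.+1%:R * 3 ^+ n * K * 2)).
have [T2 hT2] := nat_large R T0.
pose T := (maxn T1 T2).+1.
have Tp : (0 < T)%N by [].
have TT0 k : (T <= k)%N -> T0 <= k%:R.
  by move=> Tk; apply: hT2; apply: leq_trans Tk; rewrite leqW // leq_maxr.
have TK : 2 * n.+1%:R * 3 ^+ n * K * (2 / T%:R) <= 1 / 8.
  have hh : 8 * (2 * n.+1%:R * 3 ^+ n * K * 2) <= T%:R by apply: hT1; rewrite leqW // leq_maxl.
  by rewrite mulrA ler_pdivrMr ?ltr0n //; lra.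
pose Psi (k : nat) : R := k%:R `^ (- t).
have Psi0 k : 0 <= Psi k by exact: powR_ge0.
have Psi1 k : (0 < k)%N -> Psi k <= 1.
  move=> k0; have k1 : 1 <= k%:R :> R by rewrite ler1n.
  rewrite /Psi powRN invf_le1 ?powR_gt0 ?ltr0n //.
  by have := @ler_powR R _ k1 _ _ (ltW t0); rewrite powRr0.
pose g k := (12 * Psi k) ^+ m.
have g0 k : 0 <= g k by rewrite exprn_ge0 // mulr_ge0.
have gK k : (T <= k)%N -> g k * k%:R ^+ n <= K * k%:R ^- 2.
  move=> Tk; have k0 : (0 < k)%N by exact: leq_trans Tk.
  have k1 : 1 <= k%:R :> R by rewrite ler1n.
  have kp : 0 < k%:R :> R by rewrite ltr0n.
  rewrite /g exprMn -mulrA ler_pM2l //.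
  rewrite -!powR_mulrn // -powRN -powRrM -powRD; last by rewrite (gt_eqF kp) implybT.
  by apply: ler_powR => //; lra.
have sumq := sums_le_qnorm n g T K Tp g0 gK (ltW K0).
pose sA (q : 'cV[int]_(1 + n)) : 'cV[R]_m := A *m map_mx intr (dsubmx q).
have HV (qj : 'cV[int]_n.+1 * 'I_m) : exists V : set R, [/\ measurable V,
    (lebesgue_measure V <= (12 * Psi (qnorm n.+1 qj.1))%:E)%E &
    qj.1 ord0 ord0 != 0 -> (0 < qnorm n.+1 qj.1)%N -> forall x (p : int), 0 <= x <= 1 ->
      `|(qj.1 ord0 ord0)%:~R * x + sA qj.1 qj.2 ord0 - p%:~R| <= Psi (qnorm n.+1 qj.1) -> V x].
  case: qj => q j /=.
  have [q0|q0] := eqVneq (q ord0 ord0) 0.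
    by exists set0; split => //; rewrite measure0 lee_fin mulr_ge0.
  have [qn|qn] := posnP (qnorm n.+1 q).
    by exists set0; split => //; rewrite measure0 lee_fin mulr_ge0.
  have [V [mV lV hV]] := near_multiples _ (sA q j ord0) _ q0 (Psi0 (qnorm n.+1 q)) (Psi1 _ qn).
  by exists V; split => // _ _; exact: hV.
have [V hV] := choice HV.
(* U i need not be measurable; it is replaced by the cube of radius r i about one of its points, or
   about 0 if it is empty. *)
have HU i : exists u, forall x, U i x -> dist u x <= r i.
  case: (pselect (exists u, U i u)) => [[u Uu]|nU]; first by exists u => x; exact: Ur.
  by exists 0 => x Ux; case: nU; exists x.
have [u hu] := choice HU.
pose ww (i : I + 'cV[int]_n.+1) : R := match i with inl i => w i
  | inr q => ((q ord0 ord0 != 0) && (T <= qnorm n.+1 q)%N)%:R end.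
pose vv (i : I + 'cV[int]_n.+1) : R := match i with inl i => 2 * r i
  | inr q => 12 * Psi (qnorm n.+1 q) end.
pose VV (i : I + 'cV[int]_n.+1) (j : 'I_m) : set R := match i with
  | inl i => `[u i j ord0 - r i, u i j ord0 + r i]%classic
  | inr q => V (q, j) end.
have ww0 i : 0 <= ww i by case: i => /=.
have vv0 i : 0 <= vv i by case: i => [i|q] /=; rewrite mulr_ge0.
have mVV i j : measurable (VV i j).
  by case: i => [i|q] /=; [exact: measurable_itv|case: (hV (q, j))].
have lVV i j : (lebesgue_measure (VV i j) <= (vv i)%:E)%E.
  by case: i => [i|q] /=; [rewrite measure_ball1|case: (hV (q, j))].
have sumK : sums_le (fun i => ww i * vv i ^+ #|'I_m|) (1 / 8 + 1 / 8).
  rewrite card_ord; apply: sums_le_sum => /= s us.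
    have -> : \sum_(i <- s) w i * (2 * r i) ^+ m = 2 ^+ m * \sum_(i <- s) w i * r i ^+ m.
      by rewrite mulr_sumr; apply: eq_bigr => i _; rewrite exprMn mulrCA.
    apply: (@le_trans _ _ (2 ^+ m * (8 * 2 ^+ m)^-1)).
      by rewrite ler_pM2l ?exprn_gt0 //; exact: sumw.
    by rewrite invfM mulrCA divff ?mulr1 ?div1r // gt_eqF // exprn_gt0.
  apply: le_trans TK; apply: le_trans (sumq s us); apply: ler_sum => q _.
  by rewrite -/(g _) ler_wpM2r // ler_nat; case: (q _ _ != 0); case: (T <= _)%N.
have KC : 1 / 8 + 1 / 8 < (1 / 2) * 1 ^+ #|'I_m| :> R by rewrite expr1n; lra.
have [x xb xC] := exists_point ww vv VV (fun=> 0) 1 _ _ ltr01 ww0 vv0 mVV lVV sumK KC.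
pose v : 'cV[R]_m := \col_j x j.
exists v; last first.
  move=> s us; apply: le_trans (xC (map inl s) _); last by rewrite map_inj_uniq // => ? ? [].
  rewrite big_map; apply: ler_sum => i _ /=; rewrite ler_wpM2l //.
  rewrite indicE; case: (boolP (v \in U i)) => [|_]; last by rewrite prodr_ge0.
  rewrite inE => Uv; rewrite big1 // => j _; rewrite indicE mem_set //= in_itv /= -ler_distl.
  by have := le_trans (dist_ge _ _ j ord0) (hu i v Uv); rewrite mxE distrC.
have avoid (q : 'cV[int]_(1 + n)) (p : 'cV[int]_m) : q ord0 ord0 != 0 -> (T <= qnorm n.+1 q)%N ->
    ~ (vnorm R m (row_mx v A *m map_mx intr q - map_mx intr p) <= Psi (qnorm n.+1 q)).
  move=> q0 Tq /(vnorm_leP _ _ (Psi0 _)) h.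
  suff P1 : \prod_j \1_(VV (inr q) j) (x j) = 1 :> R.
    have ww1 : ww (inr q) = 1 by rewrite /= q0 Tq.
    by have := xC [:: inr q] isT; rewrite big_seq1 P1 ww1 mulr1; lra.
  apply: big1 => j _; rewrite indicE mem_set //=.
  case: (hV (q, j)) => _ _ H; apply: (H q0 _ (x j) (p j ord0)).
  - exact: leq_trans Tq.
  - by have := xb j; rewrite add0r.
  have := h j; rewrite /sA.
  have -> : (row_mx v A *m map_mx intr q - map_mx intr p) j ord0
    = (row_mx v A *m map_mx intr q) j ord0 - (p j ord0)%:~R by rewrite !mxE.
  by rewrite mul_row_col_coord [v j _]mxE.
have [WA nWA] := exA; split.
- move=> fB; apply: WA.
  apply: sub_finite_set (finite_image (fun pq : 'cV[int]_m * 'cV[int]_(1 + n) => (pq.1, dsubmx pq.2)) fB).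
  move=> [p q] /= [q0 h]; exists (p, col_mx 0 q); last by rewrite /= col_mxKd.
  rewrite /= mul_row_col0 qnorm_col0; split => //.
  by apply: contra_neq q0 => h0; rewrite -[q](col_mxKd (0 : 'cV[int]_1)) h0; apply/matrixP => i j; rewrite !mxE.
- move=> [c /= c1 hc]; apply: hc.
  have c0 : 0 < c by lra.
  have fA : finite_set [set pq : 'cV[int]_m * 'cV[int]_n | pq.2 != 0 /\
      vnorm R m (A *m map_mx intr pq.2 - map_mx intr pq.1) <= Phi (qnorm n pq.2) / c].
    by apply: contrapT => h; apply: nWA; exists c.
  have Phic k : Phi k / c <= Phi k.
    by rewrite ler_pdivrMr // ler_peMr ?(ltW (Phi_gt0 _)) // ltW.
  pose KK := \sum_(k < T.+1) Phi k.
  apply: (@sub_finite_set _ _ ((fun pq : 'cV[int]_m * 'cV[int]_n => (pq.1, col_mx 0 pq.2 : 'cV[int]_(1 + n))) @`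
     [set pq : 'cV[int]_m * 'cV[int]_n | pq.2 != 0 /\
      vnorm R m (A *m map_mx intr pq.2 - map_mx intr pq.1) <= Phi (qnorm n pq.2) / c] `|`
     [set pq : 'cV[int]_m * 'cV[int]_n.+1 | (qnorm n.+1 pq.2 <= T)%N /\
      vnorm R m (row_mx v A *m map_mx intr pq.2 - map_mx intr pq.1) <= KK])).
    move=> [p q] /= [q0 h].
    have [qT|Tq] := leqP (qnorm n.+1 q) T.
      right; split => //; apply: (le_trans h); apply: (le_trans (Phic _)).
      have hM : (qnorm n.+1 q < T.+1)%N by [].
      rewrite /KK (bigD1 (Ordinal hM)) //= lerDl; apply: sumr_ge0 => i _; exact: ltW.
    have [q00|q00] := eqVneq (q ord0 ord0) 0; last first.
      exfalso; apply: (avoid q p q00 (ltnW Tq)); apply: (le_trans h); apply: (le_trans (Phic _)).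
      by apply: Phi_le; [exact: leq_trans Tq|apply: TT0; exact: ltnW].
    left; have qE : q = col_mx 0 (dsubmx (q : 'cV[int]_(1 + n))).
      rewrite -[LHS](vsubmxK (q : 'cV[int]_(1 + n))); congr col_mx.
      apply/matrixP => i j; rewrite !mxE !ord1 -[RHS]q00; congr (q _ _); exact: val_inj.
    exists (p, dsubmx (q : 'cV[int]_(1 + n))); last by rewrite /= -qE.
    rewrite /= -qnorm_col0 -qE -(mul_row_col0 m n v) -qE; split => //.
    by apply: contra_neq q0 => h0; rewrite qE h0 col_mx0.
  by rewrite finite_setU; split; [exact: finite_image|exact: finite_solutions].
Qed.

Lemma dist_row_mx {R : realType} (m n : nat) (v v' : 'cV[R]_m) (A A' : 'M[R]_(m, n)) :
  let d := dist (row_mx v A : 'M[R]_(m, 1 + n)) (row_mx v' A') in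
  dist A A' <= d /\ dist v v' <= d.
Proof.
split; apply/dist_leP => [|i j]; rewrite ?dist_ge0 //.
  have := dist_ge (row_mx v A : 'M[R]_(m, 1 + n)) (row_mx v' A') i (rshift 1 j).
  by rewrite !row_mxEr.
have := dist_ge (row_mx v A : 'M[R]_(m, 1 + n)) (row_mx v' A') i (lshift n j).
by rewrite !row_mxEl.
Qed.

(* With w = 1 this excludes covers of E with \sum_i r_i^s <= C, hence gives dim_H E >= s; the weights
   make the property pass from Exact m n to Exact m n.+1. *)
Definition weighted_dim {R : realType} {m n : nat} (E : set 'M[R]_(m, n)) (s : R) :=
  exists2 C : R, 0 < C & forall (U : nat -> set 'M[R]_(m, n)) (w r : nat -> R),
    (forall i, 0 <= w i) -> (forall i, 0 < r i) ->
    (forall i x y, U i x -> U i y -> dist x y <= r i) ->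
    sums_le (fun i => w i * r i `^ s) C ->
    exists2 A, E A & sums_le (fun i => w i * \1_(U i) A) (1 / 2).

(** Plays for the packing dimension the part of [weighted_dim], see [dimP_ge]. *)
Definition avoids {R : realType} {m n : nat} (E : set 'M[R]_(m, n)) (s : R) :=
  forall F : nat -> set 'M[R]_(m, n), (forall i, small_set s (F i)) ->
    exists2 A, E A & forall i, ~ F i A.

Lemma sums_le_pair {R : realType} {I J : eqType} (a : I * J -> R) (b : I -> R) (K : R) :
  (forall i, sums_le (fun j => a (i, j)) (b i)) -> sums_le b K -> sums_le a K.
Proof.
move=> ab bK s us; pose S := undup (map fst s).
apply: le_trans (bK S (undup_uniq _)).
have -> : \sum_(p <- s) a p = \sum_(i <- S) \sum_(p <- s | p.1 == i) a p.
  rewrite (exchange_big_dep xpredT) //= big_seq [RHS]big_seq; apply: eq_bigr => p ps.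
  rewrite big_mkcond (bigD1_seq p.1) ?undup_uniq //=; last by rewrite mem_undup map_f.
  by rewrite eqxx big1 ?addr0 // => k; rewrite eq_sym => /negbTE ->.
apply: ler_sum => i _; rewrite -big_filter.
have -> : \sum_(p <- [seq p <- s | p.1 == i]) a p = \sum_(j <- map snd [seq p <- s | p.1 == i]) a (i, j).
  rewrite big_map big_seq [RHS]big_seq; apply: eq_bigr => -[i' j].
  by rewrite mem_filter /= => /andP[/eqP ->].
apply: ab; rewrite map_inj_in_uniq ?filter_uniq // => -[i1 j1] [i2 j2].
by rewrite !mem_filter /= => /andP[/eqP -> _] /andP[/eqP -> _] ->.
Qed.

Lemma sums_le_geometric {R : realType} (c : R) : 0 <= c ->
  sums_le (fun i : nat => c * 2 ^- i.+1) c.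
Proof.
move=> c0 s us.
pose M := (\max_(i <- s) i).+1.
apply: (@le_trans _ _ (\sum_(0 <= i < M) c * 2 ^- i.+1)).
  apply: sum_uniq_sub => // [i|i si]; first by rewrite mulr_ge0 // invr_ge0 exprn_ge0.
  by rewrite mem_index_iota /= /M ltnS (big_rem _ si) /= leq_maxl.
suff -> : \sum_(0 <= i < M) c * 2 ^- i.+1 = c * (1 - 2 ^- M).
  by rewrite ler_piMr // gerBl invr_ge0 exprn_ge0.
elim: M => [|M IH]; first by rewrite big_geq // expr0 invr1 subrr mulr0.
rewrite big_nat_recr //= IH -mulrDr; congr (_ * _); rewrite exprS invfM.
by have := erefl (2 ^- M : R); lra.
Qed.

Section Columns.
Variables (R : realType) (m n : nat) (t T0 : R) (Phi : nat -> R).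
Hypotheses (t_gt0 : 0 < t) (tm : n%:R + 2 <= t * m%:R)
  (Phi_gt0 : forall q, 0 < Phi q)
  (Phi_le : forall q : nat, (0 < q)%N -> T0 <= q%:R -> Phi q <= q%:R `^ (- t)).

(** A is chosen against the projections of the U i with weights proportional to w r^m, the volume
    that a fibre can occupy; then v is chosen against the fibres over A. The factor k = 4 * 2^m
    turns the bound 1/2 from the first choice into the bound required for the second one. *)
Lemma weighted_add_column s :
  weighted_dim (Exact R m n Phi) s -> weighted_dim (Exact R m n.+1 Phi) (s + m%:R).
Proof.
move=> [C C0 hC]; pose k : R := 4 * 2 ^+ m.
have k0 : 0 < k by rewrite mulr_gt0 // exprn_gt0.
exists (C / k); first exact: divr_gt0.
move=> U w r w0 r0 Ur sumw.
pose U' i : set 'M[R]_(m, n) := [set A | exists v, U i (row_mx v A : 'M[R]_(m, 1 + n))].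
have U'r i x y : U' i x -> U' i y -> dist x y <= r i.
  move=> [v Uv] [v' Uv']; apply: le_trans (Ur i _ _ Uv Uv').
  by have [] := dist_row_mx m n v v' x y.
have w'0 i : 0 <= k * (w i * r i ^+ m).
  by rewrite mulr_ge0 ?(ltW k0) // mulr_ge0 // exprn_ge0 // ltW.
have [A exA sA] : exists2 A, Exact R m n Phi A & sums_le (fun i => k * (w i * r i ^+ m) * \1_(U' i) A) (1 / 2).
  apply: (hC U' _ r w'0 r0 U'r) => l ul.
  have -> : \sum_(i <- l) k * (w i * r i ^+ m) * r i `^ s = k * \sum_(i <- l) w i * r i `^ (s + m%:R).
    rewrite mulr_sumr; apply: eq_bigr => i _; rewrite powRD; last by rewrite (gt_eqF (r0 i)) implybT.
    by rewrite powR_mulrn ?(ltW (r0 i)) //; ring.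
  by rewrite mulrC -ler_pdivlMr //; exact: sumw.
pose w'' i := w i * \1_(U' i) A.
have w''0 i : 0 <= w'' i by rewrite mulr_ge0.
have [v exv sv] : exists2 v : 'cV[R]_m, Exact R m n.+1 Phi (row_mx v A : 'M[R]_(m, 1 + n)) &
    sums_le (fun i => w'' i * \1_([set v | U i (row_mx v A : 'M[R]_(m, 1 + n))]) v) (1 / 2).
  apply: (add_column m n t T0 Phi _ A _ w'' r) => //.
  - by move=> i; exact: ltW.
  - by move=> i x y Ux Uy; apply: le_trans (Ur i _ _ Ux Uy); have [] := dist_row_mx m n x y A A.
  - move=> l ul; rewrite -(ler_pM2l k0).
    have -> : k * (8 * 2 ^+ m)^-1 = 1 / 2.
      by rewrite /k; field; rewrite gt_eqF // exprn_gt0.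
    apply: le_trans (sA l ul); rewrite mulr_sumr le_eqVlt; apply/orP; left; apply/eqP.
    by apply: eq_bigr => i _; rewrite /w''; ring.
exists (row_mx v A) => // l ul; apply: le_trans (sv l ul); apply: ler_sum => i _.
rewrite /w'' -mulrA ler_wpM2l // !indicE.
case: (boolP (row_mx v A \in U i)) => [|_]; last by rewrite mulr_ge0.
rewrite inE => Ui; rewrite (@mem_set _ (U' i)); last by exists v.
by rewrite mul1r mem_set.
Qed.

Lemma avoid_add_column :
  (forall s, s < m%:R * n%:R -> avoids (Exact R m n Phi) s) ->
  forall s, s < m%:R * n.+1%:R -> avoids (Exact R m n.+1 Phi) s.
Proof.
move=> H s sm F sF.
(* Outside the sets G i k, the fibres of F i have covers of arbitrarily small m-dimensional volume;
   counting points in F i shows that G i k is small. *)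
pose G (i k : nat) : set 'M[R]_(m, n) := [set A | forall r, 0 < r <= k.+1%:R^-1 ->
  exists l : seq 'cV[R]_m, [/\ forall v, v \in l -> F i (row_mx v A : 'M[R]_(m, 1 + n)),
    separated r l & r ^- m / k.+1%:R <= (size l)%:R]].
have sG i k : small_set (s - m%:R) (G i k).
  have [K [d [d0 hK]]] := sF i.
  exists (K * k.+1%:R), (Num.min d k.+1%:R^-1); split; first by rewrite lt_min d0 invr_gt0 ltr0n.
  move=> r; rewrite le_min => /andP[r0 /andP[rd rk]] l lG lsep.
  have hA A : exists lA : seq 'cV[R]_m, A \in l -> [/\ forall v, v \in lA -> F i (row_mx v A : 'M[R]_(m, 1 + n)),
    separated r lA & r ^- m / k.+1%:R <= (size lA)%:R].
    case: (boolP (A \in l)) => Al; last by exists [::].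
    have [|lA h] := lG A Al r; first by rewrite r0.
    by exists lA.
  have [f hf] := choice hA.
  (* Separated fibres over a separated base form a separated subset of F i, at least r^-m / (k + 1)
     times as large as the base; this lowers the exponent by m. *)
  pose L : seq 'M[R]_(m, n.+1) := flatten [seq [seq (row_mx v A : 'M[R]_(m, 1 + n)) | v <- f A] | A <- l].
  have LF x : x \in L -> F i x.
    move=> /flattenP[_ /mapP[A Al ->] /mapP[v vf ->]].
    by have [h _ _] := hf A Al; exact: h.
  have Lsep : separated r L.
    rewrite /L; move: hf; clear -lsep; elim: l lsep => [|A l IH] //= /andP[Asep lsep] hf.
    rewrite /separated pairwise_cat; apply/and3P; split.
    - apply/allrelP => x y /mapP[v _ ->] /flattenP[_ /mapP[A' A'l ->] /mapP[v' _ ->]].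
      apply: lt_le_trans (dist_row_mx m n v v' A A').1.
      by move/allP: Asep; apply.
    - have [_ h _] := hf A (mem_head _ _).
      rewrite pairwise_map; apply: sub_pairwise h => v v' /= h; apply: lt_le_trans h _.
      by have [] := dist_row_mx m n v v' A A.
    - by apply: IH => // A' A'l; apply: hf; rewrite inE A'l orbT.
  have hL := hK r _ L LF Lsep; rewrite r0 rd in hL; have {}hL := hL isT.
  have r0' := ltW r0; have rm : 0 < r ^+ m by rewrite exprn_gt0.
  have sizeL : (size l)%:R * (r ^- m / k.+1%:R) <= (size L)%:R.
    rewrite /L; move: hf; clear -r; elim: l => [|A l IH] hf /=; first by rewrite mul0r.
    rewrite size_cat size_map natrD -natr1 mulrDl mul1r addrC; apply: lerD.
      by have [] := hf A (mem_head _ _).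
    by apply: IH => A' A'l; apply: hf; rewrite inE A'l orbT.
  have := le_trans sizeL hL.
  have k1 : 0 < k.+1%:R :> R by rewrite ltr0n.
  have -> : - (s - m%:R) = - s + m%:R by ring.
  rewrite powRD; last by rewrite (gt_eqF r0) implybT.
  rewrite powR_mulrn // mulrA ler_pdivrMr // ler_pdivrMr // => h.
  by apply: (le_trans h); rewrite le_eqVlt; apply/orP; left; apply/eqP; ring.
(* The double family is enumerated by nat; numbers that code no pair give the empty set. *)
pose G' (j : nat) : set 'M[R]_(m, n) := if (unpickle j : option (nat * nat)) is Some (i, k) then G i k else set0.
have sG' j : small_set (s - m%:R) (G' j).
  rewrite /G'; case: unpickle => [[i k]|]; first exact: sG.
  exists 0, 1; split => // r _ [|x l] // h; first by rewrite mul0r.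
  by case: (h x (mem_head _ _)).
have sm' : s - m%:R < m%:R * n%:R.
  by rewrite ltrBlDr; apply: lt_le_trans sm _; rewrite -natr1 mulrDr mulr1.
have [A exA hA] := H _ sm' G' sG'.
have nG i k : ~ G i k A.
  by have := hA (pickle (i, k)); rewrite /G' pickleK.
pose c : R := (8 * 2 ^+ m)^-1.
have c0 : 0 < c by rewrite invr_gt0 mulr_gt0 // exprn_gt0.
have cover i : exists rs : R * seq 'cV[R]_m, [/\ 0 < rs.1,
    (size rs.2)%:R * (2 * rs.1) ^+ m <= c * 2 ^- i.+1 &
    forall v, F i (row_mx v A : 'M[R]_(m, 1 + n)) -> exists2 u, u \in rs.2 & dist v u <= rs.1].
  have e0 : 0 < c * 2 ^- i.+1 by rewrite mulr_gt0 // invr_gt0 exprn_gt0.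
  (* Since A is outside G i k, at some scale r the fibre has fewer than r^-m / (k + 1) separated
     points. A maximal family of them covers it by balls of radius r, and the factor 2^m allows for
     their diameter 2 r. The share of F i is c 2^-(i+1), so that all shares add up to at most c. *)
  have [k hk] := nat_large R (2 ^+ m / (c * 2 ^- i.+1)).
  have {}hk : 2 ^+ m / k.+1%:R <= c * 2 ^- i.+1.
    by rewrite ler_pdivrMr ?ltr0n // mulrC -ler_pdivrMr //; exact: hk.
  have /existsNP[r /not_implyP[/andP[r0 rk] nr]] := nG i k.
  have y0 : 0 <= r ^- m / k.+1%:R by rewrite divr_ge0 // invr_ge0 exprn_ge0 // ltW.
  have [l [lsz lsep lF lcov]] := separated_maximal [set v | F i (row_mx v A : 'M[R]_(m, 1 + n))] r
    (Num.truncn (r ^- m / k.+1%:R)).+1.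
  have hsz : (size l)%:R < r ^- m / k.+1%:R.
    rewrite ltNge; apply/negP => h; apply: nr; exists l; split => //.
  exists (r, l); split => //=.
    apply: le_trans hk; rewrite exprMn mulrCA ler_pM2l ?exprn_gt0 //.
    have rm : 0 < r ^+ m by rewrite exprn_gt0.
    rewrite -ler_pdivlMr // mulrC; exact: ltW.
  apply: lcov; rewrite ltnS Num.Theory.truncn_ge_nat //; exact: ltW.
have [rs hrs] := choice cover.
pose U (ij : nat * nat) : set 'cV[R]_m := [set v | (ij.2 < size (rs ij.1).2)%N /\
  dist v (nth 0 (rs ij.1).2 ij.2) <= (rs ij.1).1].
pose w (ij : nat * nat) : R := (ij.2 < size (rs ij.1).2)%N%:R.
pose r (ij : nat * nat) : R := 2 * (rs ij.1).1.
have rs0 i : 0 < (rs i).1 by have [] := hrs i.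
have [v exv sv] : exists2 v : 'cV[R]_m, Exact R m n.+1 Phi (row_mx v A : 'M[R]_(m, 1 + n)) &
    sums_le (fun i => w i * \1_(U i) v) (1 / 2).
  apply: (add_column m n t T0 Phi _ A U w r) => //.
  - by move=> i; rewrite mulr_ge0 // ltW.
  - move=> [i j] x y [_ xj] [_ yj]; apply: le_trans (dist_triangle (nth 0 (rs i).2 j) x y) _.
    by rewrite /r /= mulr_natl mulr2n lerD // distC.
  - apply: (sums_le_pair (fun ij => w ij * r ij ^+ m) (fun i => c * 2 ^- i.+1)); last first.
      exact: sums_le_geometric (ltW c0).
    move=> i; have [_ hs _] := hrs i.
    apply: (sums_le_nat _ (size (rs i).2)) => [j|j|].
    + by rewrite /w mulr_ge0 // exprn_ge0 // mulr_ge0 // ltW.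
    + by rewrite /w /= ltnNge => ->; rewrite mul0r.
    + apply: le_trans hs; rewrite le_eqVlt; apply/orP; left; apply/eqP.
      under eq_bigr => j _ do rewrite /w /r /= ltn_ord mul1r.
      by rewrite sumr_const card_ord -[LHS]mulr_natl.
exists (row_mx v A) => // i Fi; have [_ _ /(_ v Fi)[u ul vu]] := hrs i.
have := sv [:: (i, index u (rs i).2)] isT.
rewrite big_seq1 /w /= index_mem ul mul1r indicE mem_set; last first.
  by split; rewrite /= ?index_mem // nth_index.
by rewrite /=; lra.
Qed.

End Columns.

(** * Hausdorff and packing dimension *)

Lemma sums_le_nneseries {R : realType} (a : nat -> R) (K : R) : (forall i, 0 <= a i) ->
  (\sum_(i <oo) (a i)%:E <= K%:E)%E -> sums_le a K.
Proof.
move=> a0 aK s us; pose M := (\max_(i <- s) i).+1.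
have sM : {subset s <= index_iota 0 M}.
  by move=> i si; rewrite mem_index_iota /= /M ltnS (big_rem _ si) /= leq_maxl.
apply: le_trans (sum_uniq_sub _ _ _ a0 us sM) _.
rewrite -lee_fin -sumEFin; apply: le_trans aK.
by apply: nneseries_lim_ge => i _ _; rewrite lee_fin.
Qed.

Lemma rdiam_bounds {R : realType} {m n : nat} (U : set 'M[R]_(m, n)) (d : R) x y :
  (forall x y, U x -> U y -> dist x y <= d) -> U x -> U y ->
  [/\ 0 <= rdiam R m n U, rdiam R m n U <= d & dist x y <= rdiam R m n U].
Proof.
move=> Ud Ux Uy; pose S := [set r | exists x y, U x /\ U y /\ r = dist x y].
have S0 : S !=set0 by exists (dist x y), x, y.
have ubS : ubound S d by move=> _ [x' [y' [Ux' [Uy' ->]]]]; exact: Ud.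
have le_rdiam x' y' : U x' -> U y' -> dist x' y' <= rdiam R m n U.
  by move=> Ux' Uy'; apply: ub_le_sup; [exists d | exists x', y'].
split; last exact: le_rdiam.
- by apply: le_trans (le_rdiam _ _ Ux Ux); exact: dist_ge0.
- exact: ge_sup.
Qed.

Lemma dcost_ge0 {R : realType} {m n : nat} (s : R) (U : set 'M[R]_(m, n)) : 0 <= dcost R m n s U.
Proof. by rewrite /dcost; case: ifP => // _; exact: powR_ge0. Qed.

(* A positive radius is needed even for sets of diameter 0, hence the slack e. *)
Lemma radius_of_diameter {R : realType} (s s1 e x : R) : 0 <= s -> s <= s1 -> 0 < e ->
  0 <= x -> x <= 1 -> exists r, [/\ 0 < r, x <= r & r `^ s1 <= x `^ s + e].
Proof.
move=> s0 ss e0 x0 x1; have [s1E|s1n0] := eqVneq s1 0.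
  have -> : s = 0 by apply/eqP; rewrite eq_le s0 -s1E ss.
  by exists 1; rewrite s1E !powRr0; split => //; rewrite lerDl ltW.
have s1p : 0 < s1 by rewrite lt_def s1n0 (le_trans s0).
have px : 0 <= x `^ s1 by exact: powR_ge0.
have xs : x `^ s1 <= x `^ s.
  have [->|xn0] := eqVneq x 0.
    by rewrite (powR0 s1n0) powR_ge0.
  by apply: ger_powR => //; rewrite lt_def xn0 x0.
exists ((x `^ s1 + e) `^ s1^-1); split.
- by rewrite powR_gt0 // ltr_wpDl.
- rewrite -{1}(powRr1 x0) -(mulfV s1n0) powRrM ge0_ler_powR ?nnegrE ?invr_ge0 ?(ltW s1p) //.
    by rewrite addr_ge0 // ltW.
  by rewrite lerDl ltW.
- by rewrite -powRrM mulVf // powRr1 ?lerD2r // addr_ge0 // ltW.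
Qed.

(** A cover with small s-dimensional sum, its diameters enlarged to positive radii at total cost
    C/2, would contradict the weighted property with weight 1 on the nonempty members: the point
    obtained lies in some member, and 1 > 1/2. *)
Lemma dimH_ge {R : realType} {m n : nat} (E : set 'M[R]_(m, n)) (s0 : R) :
  (forall s, 0 <= s -> s < s0 -> exists2 s1, s <= s1 & weighted_dim E s1) ->
  (s0%:E <= dimH R m n E)%E.
Proof.
move=> H; apply/ereal_infP => _ /= [s [s_ge0 Hs] <-]; rewrite lee_fin leNgt; apply/negP => ss0.
have [s1 ss1 [C C0 hC]] := H s s_ge0 ss0.
have C2 : 0 < C / 2 by rewrite divr_gt0.
(* The scale 1 keeps all diameters at most 1, as the passage from s to the larger s1 requires. *)
have : (Hcontent R m n s 1 E < (C / 2)%:E)%E.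
  apply: (@le_lt_trans _ _ 0%E); last by rewrite lte_fin.
  by rewrite -Hs; apply: ereal_sup_ubound; exists 1 => //=.
move=> /ereal_inf_lt[_ [U [EU Ud] <-] sumU].
have dU := sums_le_nneseries _ _ (fun i => dcost_ge0 s (U i)) (ltW sumU).
have e0 i : 0 < C / 2 * 2 ^- i.+1 :> R by rewrite mulr_gt0 // invr_gt0 exprn_gt0.
have hr i : exists r, [/\ 0 < r, forall x y, U i x -> U i y -> dist x y <= r &
    (U i !=set0 -> r `^ s1 <= dcost R m n s (U i) + C / 2 * 2 ^- i.+1)].
  have [U0|/set0P[x Ux]] := eqVneq (U i) set0.
    exists 1; split => //; first by move=> x y; rewrite U0.
    by case=> x; rewrite U0.
  have [d0 d1 _] := rdiam_bounds _ _ x x (Ud i) Ux Ux.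
  have [r [r0 dr rs]] := radius_of_diameter s s1 _ _ s_ge0 ss1 (e0 i) d0 d1.
  exists r; split => // [y z Uy Uz|_].
    by apply: le_trans dr; have [_ _] := rdiam_bounds _ _ y z (Ud i) Uy Uz.
  by rewrite /dcost asboolF // => U0; rewrite U0 in Ux.
have [r hr'] := choice hr.
pose w i : R := (`[< U i !=set0 >])%:R.
have [||||A EA sA] := hC U w r.
- by move=> i; rewrite /w ler0n.
- by move=> i; have [] := hr' i.
- by move=> i; have [] := hr' i.
- move=> l ul; have {1}-> : C = C / 2 + C / 2 by lra.
  apply: le_trans (lerD (dU l ul) (sums_le_geometric _ (ltW C2) l ul)).
  rewrite -big_split /=; apply: ler_sum => i _; rewrite /w; have [_ _ h] := hr' i.
  case: asboolP => [/h|_]; first by rewrite mul1r.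
  by rewrite mul0r addr_ge0 ?dcost_ge0 // ltW.
have [i _ Ui] := EU A EA; have := sA [:: i] isT.
by rewrite big_seq1 /w asboolT ?indicE ?mem_set ?mul1r //=; [lra|exists A].
Qed.

Lemma Ppre_delta_ge0 {R : realType} {m n : nat} (s d : R) (E : set 'M[R]_(m, n)) :
  (0 <= Ppre_delta R m n s d E)%E.
Proof.
apply: ereal_sup_ubound; exists 0%N, (fun=> 0), (fun=> 0); split; first by case.
by split; [case | rewrite big_ord0].
Qed.

Lemma Ppre_ge0 {R : realType} {m n : nat} (s : R) (E : set 'M[R]_(m, n)) : (0 <= Ppre R m n s E)%E.
Proof. by apply/ereal_infP => _ [d _ <-]; exact: Ppre_delta_ge0. Qed.

(** Points at distances above r are centres of disjoint balls of radius r/2, a packing whose sum is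
    the number of points times r^s. *)
Lemma small_set_packing {R : realType} {m n : nat} (s : R) (F : set 'M[R]_(m, n)) :
  (Ppre R m n s F < 1)%E -> small_set s F.
Proof.
move=> /ereal_inf_lt[_ [d d0 <-] hd]; exists 1, (2 * d); split; first by rewrite mulr_gt0.
move=> r /andP[r0 rd] l lF lsep; rewrite mul1r powRN.
rewrite -div1r ler_pdivlMr ?powR_gt0 // -lee_fin; apply: (le_trans _ (ltW hd)).
apply: ereal_sup_ubound; exists (size l), (fun i => nth 0 l i), (fun=> r / 2).
have r2 : 2 * (r / 2) = r by field.
split=> [i|]; first split; first by apply: lF; exact: mem_nth.
  by apply/andP; split; lra.
split=> [i j ij [y [yi yj]]|].
  have := separated_nth _ _ 0 i j lsep (ltn_ord i) (ltn_ord j).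
  have hij : nat_of_ord i <> j by move/val_inj/eqP; rewrite (negbTE ij).
  move=> /(_ hij); rewrite ltNge => /negP; apply.
  apply: le_trans (dist_triangle y _ _) _; rewrite (distC _ y); lra.
by rewrite r2 sumr_const card_ord -[in RHS]mulr_natl.
Qed.

(** If the packing measure vanishes, E is covered by countably many sets whose premeasures sum to
    less than 1, so each of them is small. *)
Lemma dimP_ge {R : realType} {m n : nat} (E : set 'M[R]_(m, n)) (s0 : R) :
  (forall s, s < s0 -> avoids E s) -> (s0%:E <= dimP R m n E)%E.
Proof.
move=> H; apply/ereal_infP => _ /= [s [s_ge0 Ps] <-]; rewrite lee_fin leNgt; apply/negP => ss0.
have : (Pmeasure R m n s E < 1%:E)%E by rewrite Ps lte_fin.
move=> /ereal_inf_lt[_ [F EF <-] sumF].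
have sF i : small_set s (F i).
  apply: small_set_packing; apply: le_lt_trans sumF.
  apply: (@le_trans _ _ (\sum_(0 <= j < i.+1) Ppre R m n s (F j))%E); last first.
    by apply: nneseries_lim_ge => j _ _; exact: Ppre_ge0.
  rewrite big_nat_recr //= leeDr // sume_ge0 // => j _; exact: Ppre_ge0.
have [A EA nF] := H s ss0 F sF.
by have [i _ Fi] := EF A EA; exact: nF i Fi.
Qed.

(** Disjoint balls in a bounded box have bounded total volume, and the excess of s over m n
    contributes a factor that tends to 0 with the radii. *)
Lemma Ppre_bounded {R : realType} {m n : nat} (s k : R) (F : set 'M[R]_(m, n)) :
  m%:R * n%:R < s -> 0 <= k -> (forall A i j, F A -> `|A i j| <= k) -> Ppre R m n s F = 0%E.
Proof.
move=> ms k0 Fk; apply/eqP; rewrite eq_le Ppre_ge0 andbT; apply/lee_addgt0Pr => e e0; rewrite add0e.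
have sg0 : 0 < s - m%:R * n%:R by rewrite subr_gt0.
pose L : R := (2 * k + 2) ^+ (m * n).
have L0 : 0 < L by rewrite exprn_gt0 // ltr_wpDl // mulr_ge0.
have [d0 d00 hd0] := powR_small _ _ sg0 (divr_gt0 e0 L0).
(* Radii at most 1 keep the balls in the box of half-side k + 1, whose volume is L. *)
pose d := Num.min 1 (d0 / 2).
have dp : 0 < d by rewrite lt_min ltr01 divr_gt0.
have d1 : d <= 1 by rewrite ge_min lexx.
have dd0 : 2 * d <= d0.
  by rewrite mulrC -ler_pdivlMr // ge_min lexx orbT.
apply: ge_ereal_inf; exists (Ppre_delta R m n s d F); first by exists d.
apply/ereal_supP => _ [p [x [r [hx [disj ->]]]]]; rewrite lee_fin.
have r0 i : 0 < r i by have [_ /andP[]] := hx i.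
have rd i : r i <= d by have [_ /andP[]] := hx i.
have hsum : \sum_i (2 * r i) ^+ (m * n) <= L.
  have -> : (m * n)%N = #|{: 'I_m * 'I_n}| by rewrite card_prod !card_ord.
  have -> : L = (2 * k + 2) ^+ #|{: 'I_m * 'I_n}| by rewrite card_prod !card_ord.
  apply: (packing_volume _ (fun i ab => x i ab.1 ab.2) r (fun=> - (k + 1))).
  - by rewrite ltr_wpDl // mulr_ge0.
  - by move=> i; exact: ltW.
  - move=> i j; have [Fx _] := hx i; have := Fk _ j.1 j.2 Fx; rewrite ler_norml => /andP[h _].
    have := rd i; lra.
  - move=> i j; have [Fx _] := hx i; have := Fk _ j.1 j.2 Fx; rewrite ler_norml => /andP[_ h].
    have := rd i; lra.
  - move=> i i' ii' [y hy]; apply: (disj i i' ii'); exists (\matrix_(a, b) y (a, b)).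
    by split; apply/dist_leP => [|a b]; rewrite ?(ltW (r0 _)) // mxE; have [] := hy (a, b).
apply: (@le_trans _ _ (\sum_i e / L * (2 * r i) ^+ (m * n))); last first.
  rewrite -mulr_sumr mulrAC ler_pdivrMr // ler_wpM2l // ltW //.
apply: ler_sum => i _; have r2 : 0 < 2 * r i by rewrite mulr_gt0.
rewrite -powR_mulrn ?(ltW r2) // natrM -[in X in X <= _](subrK (m%:R * n%:R) s).
rewrite powRD; last by rewrite (gt_eqF r2) implybT.
rewrite ler_pM2r ?powR_gt0 //; apply: hd0 => //.
by apply: le_trans dd0; rewrite ler_pM2l.
Qed.

(** E is the union of its intersections with the cubes of integral radius, each of premeasure 0 for
    exponents above m n. *)
Lemma dimP_le {R : realType} {m n : nat} (E : set 'M[R]_(m, n)) :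
  (dimP R m n E <= (m%:R * n%:R)%:E)%E.
Proof.
apply/lee_addgt0Pr => e e0; apply: ereal_inf_lbound; exists (m%:R * n%:R + e); last by rewrite EFinD.
split; first by rewrite addr_ge0 ?mulr_ge0 // ltW.
have P0 k : Ppre R m n (m%:R * n%:R + e) (E `&` [set A | forall i j, `|A i j| <= k%:R]) = 0%E.
  by apply: (Ppre_bounded _ k%:R) => [||A i j []]; rewrite ?ltrDl.
apply/eqP; rewrite eq_le; apply/andP; split; last first.
  by apply/ereal_infP => _ [F _ <-]; apply: nneseries_ge0 => i _ _; exact: Ppre_ge0.
apply: ereal_inf_lbound; exists (fun k : nat => E `&` [set A | forall i j, `|A i j| <= k%:R]).
  move=> A EA; have [N hN] := nat_large R (dist A 0).
  exists N => //; split => // i j; apply: le_trans (hN N (leqnn _)).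
  by have := dist_ge A 0 i j; rewrite mxE subr0.
by apply: eseries0 => k _ _; exact: P0.
Qed.

(** * The exponent tau *)

Lemma tauE {R : realType} (Phi : nat -> R) :
  tau R Phi = ereal_sup (range (einfs (fun t : nat => ((- ln (Phi t)) / ln (t%:R))%:E))).
Proof. by rewrite /tau limn_einf_lim; apply/cvg_lim => //; exact: cvg_einfs_sup. Qed.

Lemma ln_nat_gt0 {R : realType} (q : nat) : (2 <= q)%N -> 0 < ln (q%:R : R).
Proof. by move=> q2; rewrite ln_gt0 // (_ : 1 = 1%:R) // ltr_nat. Qed.

Lemma tau_gt {R : realType} (Phi : nat -> R) (theta : R) : (forall q, 0 < Phi q) ->
  (theta%:E < tau R Phi)%E -> exists t T0 : R, theta < t /\
    forall q : nat, (0 < q)%N -> T0 <= q%:R -> Phi q <= q%:R `^ (- t).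
Proof.
move=> Phi_gt0; rewrite tauE => /ereal_sup_gt[_ [N _ <-] hN].
have [t tt1 tN] : exists2 t, theta < t & (t%:E <= einfs (fun t : nat => ((- ln (Phi t)) / ln (t%:R))%:E) N)%E.
  case: (einfs _ N) hN => [x||] // h; first by exists x => //; rewrite -lte_fin.
  by exists (theta + 1); rewrite ?ltrDl // leey.
(* From q = 2 on, the denominator ln q is positive. *)
exists t, (maxn N 2)%:R; split => // q q0; rewrite ler_nat geq_max => /andP[Nq q2].
have l0 := ln_nat_gt0 (R := R) q q2.
have : (t%:E <= ((- ln (Phi q)) / ln (q%:R))%:E)%E.
  by apply: le_trans tN _; apply: ereal_inf_lbound; exists q.
rewrite lee_fin ler_pdivlMr // => h.
rewrite -(@ler_ln R) ?posrE ?powR_gt0 ?ltr0n // ln_powR; lra.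
Qed.

Lemma tau_infinitely_often {R : realType} (Phi : nat -> R) (r eta : R) : (forall q, 0 < Phi q) ->
  tau R Phi = r%:E -> 0 < eta -> forall N, exists2 q, (N <= q)%N & q%:R `^ (- (r + eta)) <= Phi q.
Proof.
move=> Phi_gt0 tr eta0 N.
have : (einfs (fun t : nat => ((- ln (Phi t)) / ln (t%:R))%:E) (maxn N 2) < (r + eta)%:E)%E.
  apply: (@le_lt_trans _ _ (tau R Phi)); last by rewrite tr lte_fin ltrDl.
  by rewrite tauE; apply: ereal_sup_ubound; exists (maxn N 2).
move=> /ereal_inf_lt[_ [q /= hq <-]]; move: hq; rewrite geq_max => /andP[Nq q2].
have l0 := ln_nat_gt0 (R := R) q q2.
have q0 : 0 < q%:R :> R by rewrite ltr0n; apply: leq_trans q2.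
rewrite lte_fin ltr_pdivrMr // => h; exists q => //.
rewrite -(@ler_ln R) ?posrE ?powR_gt0 // ln_powR; lra.
Qed.

Lemma root_between (m q : nat) : (0 < m)%N -> (0 < q)%N ->
  exists N, [/\ (0 < N)%N, (N ^ m <= q)%N & (q < N.+1 ^ m)%N].
Proof.
move=> m0 q0; have ex1 : exists i, (0 < i)%N && (i ^ m <= q)%N by exists 1%N; rewrite exp1n.
have ub i : (0 < i)%N && (i ^ m <= q)%N -> (i <= q)%N.
  by move=> /andP[i0 iq]; apply: leq_trans iq; rewrite -{1}(expn1 i) leq_pexp2l.
case: (ex_maxnP ex1 ub) => N /andP[N0 Nq] max; exists N; split => //.
by rewrite ltnNge; apply/negP => h; have := max N.+1; rewrite h ltnn => /(_ isT).
Qed.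

(** For suitable q put Q = N^m <= q < (N + 1)^m, so that q <= 2^m Q. Monotonicity gives [Phi] Q >=
    [Phi] q >= q^-(r + eta), hence ([Phi] Q / Q)^-s is at most a constant times Q^(s (1 + r + eta)).
    This exponent is below m + 1, and the gain Q^g absorbs A and the constant. *)
Lemma tau_scale {R : realType} (m : nat) (Phi : nat -> R) (r s : R) : (0 < m)%N ->
  (forall q, 0 < Phi q) -> (forall q q', (q <= q')%N -> Phi q' <= Phi q) ->
  tau R Phi = r%:E -> 0 <= r -> 0 <= s -> s < (m%:R + 1) / (1 + r) ->
  forall (A : R) N0, exists N, [/\ (N0 <= N)%N, (0 < N)%N &
    A * (Phi (N ^ m)%N / N%:R ^+ m) `^ (- s) <= (N%:R ^+ m) ^+ m.+1].
Proof.
move=> m0 Phi_gt0 Phi_dec tr r0 s0 sr A N0.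
have [eta eta0 heta] : exists2 eta, 0 < eta & s * (1 + r + eta) < m%:R + 1.
  have r1 : 0 < 1 + r by lra.
  have s1 : 0 < 1 + s by lra.
  move: sr; rewrite ltr_pdivlMr // => sr.
  have d0 : 0 < m%:R + 1 - s * (1 + r) by lra.
  (* Dividing the gap by 1 + s rather than by s includes s = 0. *)
  exists ((m%:R + 1 - s * (1 + r)) / (1 + s)); first exact: divr_gt0.
  rewrite mulrDr -ltrBrDl mulrA ltr_pdivrMr //.
  by rewrite mulrC ltr_pM2l // ltrDr.
pose b := 1 + r + eta; pose g := m%:R + 1 - s * b.
have g0 : 0 < g by rewrite /g /b; lra.
pose K : R := (2 ^+ m) `^ ((r + eta) * s).
have K0 : 0 < K by rewrite powR_gt0 // exprn_gt0.
have [B hB] := nat_large R ((`|A * K| + 1) `^ g^-1).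
pose N1 := maxn N0.+1 B.
have [q Nq hq] := tau_infinitely_often _ _ _ Phi_gt0 tr eta0 (N1 ^ m)%N.
have N1_gt0 : (0 < N1)%N by rewrite /N1 leq_max.
have q0 : (0 < q)%N by apply: leq_trans Nq; rewrite expn_gt0 N1_gt0.
have [N [Ngt0 NMq qN]] := root_between m q m0 q0.
have N1N : (N1 <= N)%N.
  by rewrite -ltnS -(ltn_exp2r _ _ m0); exact: leq_ltn_trans qN.
exists N; split => //; first by apply: leq_trans N1N; rewrite /N1 leq_max leqnSn.
pose M : R := N%:R ^+ m.
have N0' : 0 < N%:R :> R by rewrite ltr0n.
have M0 : 0 < M by rewrite exprn_gt0.
have re0 : 0 <= r + eta by rewrite addr_ge0 // ltW.
have q0' : 0 < q%:R :> R by rewrite ltr0n.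
have qM : q%:R <= 2 ^+ m * M :> R.
  rewrite /M -exprMn -natrM -natrX ler_nat; apply: (leq_trans (ltnW qN)).
  by rewrite leq_exp2r // mul2n -addnn -addn1 leq_add2l.
have tM0 : 0 < 2 ^+ m * M by rewrite mulr_gt0 // exprn_gt0.
have lowPhi : (2 ^+ m * M) `^ (- (r + eta)) <= Phi (N ^ m)%N.
  apply: (le_trans _ (Phi_dec _ _ NMq)); apply: (le_trans _ hq).
  rewrite !powRN lef_pV2 ?posrE ?powR_gt0 //.
  by apply: ge0_ler_powR; rewrite ?nnegrE // ltW.
have low : (2 ^+ m) `^ (- (r + eta)) * M `^ (- b) <= Phi (N ^ m)%N / M.
  rewrite ler_pdivlMr //; apply: le_trans lowPhi.
  rewrite powRM ?(ltW M0) ?exprn_ge0 // -mulrA ler_wpM2l ?powR_ge0 //.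
  rewrite -[X in _ * X](powRr1 (ltW M0)) -powRD; last by rewrite (gt_eqF M0) implybT.
  by rewrite (_ : - b + 1 = - (r + eta)) // /b; ring.
have low0 : 0 < (2 ^+ m) `^ (- (r + eta)) * M `^ (- b).
  by rewrite mulr_gt0 // powR_gt0 // exprn_gt0.
have up : (Phi (N ^ m)%N / M) `^ (- s) <= K * M `^ (s * b).
  apply: (@le_trans _ _ (((2 ^+ m) `^ (- (r + eta)) * M `^ (- b)) `^ (- s))).
    have high0 := lt_le_trans low0 low.
    rewrite [X in X <= _]powRN [X in _ <= X]powRN lef_pV2 ?posrE ?powR_gt0 //.
    by apply: ge0_ler_powR; rewrite ?nnegrE ?(ltW low0) ?(ltW high0).
  rewrite powRM ?powR_ge0 // -!powRrM /K.
  by rewrite (_ : - (r + eta) * - s = (r + eta) * s) 1?(_ : - b * - s = s * b) //; ring.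
have MN : N%:R <= M by rewrite /M -[X in X <= _]expr1 ler_weXn2l // (_ : 1 = 1%:R) // ler_nat.
have large : `|A * K| + 1 <= M `^ g.
  have a0 : 0 <= `|A * K| + 1 by rewrite addr_ge0.
  rewrite -[X in X <= _](powRr1 a0) -[X in _ `^ X](mulVf (lt0r_neq0 g0)) powRrM.
  apply: ge0_ler_powR; rewrite ?nnegrE ?powR_ge0 ?(ltW g0) ?(ltW M0) //.
  apply: le_trans MN; apply: (hB N); apply: leq_trans N1N; exact: leq_maxr.
have -> : M ^+ m.+1 = M `^ g * M `^ (s * b).
  rewrite -powRD; last by rewrite (gt_eqF M0) implybT.
  by rewrite -powR_mulrn ?(ltW M0) // /g subrK natr1.
rewrite -/M; apply: (@le_trans _ _ (`|A| * (K * M `^ (s * b)))).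
  apply: (@le_trans _ _ (`|A| * (Phi (N ^ m)%N / M) `^ (- s))).
    by rewrite ler_wpM2r ?powR_ge0 // ler_norm.
  by rewrite ler_wpM2l.
rewrite mulrA ler_wpM2r ?powR_ge0 //; apply: le_trans large.
by rewrite normrM (gtr0_norm K0) lerDl.
Qed.

(** * Dimension of the exact set with several columns *)

Section Dimensions.
Variables (R : realType) (m : nat) (t T0 : R) (Phi : nat -> R).
Hypotheses (m_gt0 : (0 < m)%N) (tm : m%:R + 2 < t * m%:R) (Phi_gt0 : forall q, 0 < Phi q)
  (Phi_le : forall q : nat, (0 < q)%N -> T0 <= q%:R -> Phi q <= q%:R `^ (- t)).

Let t_gt0 : 0 < t.
Proof.
have m0 : 0 < m%:R :> R by rewrite ltr0n.
have : 0 < t * m%:R by apply: lt_trans tm; rewrite addr_gt0.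
by rewrite pmulr_lgt0.
Qed.

(** As r^0 = 1, any single point of the exact set will do, and [exact_avoid] provides one without
    monotonicity of [Phi]. *)
Lemma weighted_dim0 : weighted_dim (Exact R m 1 Phi) (0 : R).
Proof.
have [//||al exal _] := exact_avoid R m t m_gt0 tm Phi T0 Phi_gt0 Phi_le (fun=> set0) 0.
- by rewrite ltr0n.
- by move=> i; exists 0, 1; split => // r _ [|x l] // h; [rewrite mul0r | case: (h x (mem_head _ _))].
exists (1 / 2) => // U w r w0 _ _ sumw; exists al => // l ul.
apply: le_trans (sumw l ul); apply: ler_sum => i _.
by rewrite powRr0 ler_wpM2l // indicE; case: (_ \in _).
Qed.

Lemma weighted_columns s k : k.+1%:R + 1 < t * m%:R :> R ->
  weighted_dim (Exact R m 1 Phi) s -> weighted_dim (Exact R m k.+1 Phi) (m%:R * k%:R + s).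
Proof.
elim: k => [|k IH] hk h; first by rewrite mulr0 add0r.
have -> : m%:R * k.+1%:R + s = m%:R * k%:R + s + m%:R by rewrite -natr1; ring.
apply: (weighted_add_column _ _ _ t T0) => //; first by rewrite -natr1 in hk; lra.
by apply: IH => //; rewrite -natr1 in hk; lra.
Qed.

Lemma avoid_columns k : k.+1%:R + 1 < t * m%:R :> R ->
  forall s, s < m%:R * k.+1%:R -> avoids (Exact R m k.+1 Phi) s.
Proof.
elim: k => [|k IH] hk.
  move=> s sm F sF; apply: (exact_avoid R m t m_gt0 tm Phi T0 Phi_gt0 Phi_le F s _ sF).
  by rewrite mulr1 in sm.
apply: (avoid_add_column _ _ _ t T0) => //; first by rewrite -natr1 in hk; lra.
by apply: IH; rewrite -natr1 in hk; lra.
Qed.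

(** Exponents up to m k use the exponent 0 in the first column, so that s0 = 0 yields the bound m k
    by itself. *)
Lemma dimH_columns s0 k : k.+1%:R + 1 < t * m%:R :> R -> 0 <= s0 ->
  (forall s, 0 < s -> s < s0 -> weighted_dim (Exact R m 1 Phi) s) ->
  ((m%:R * k%:R + s0)%:E <= dimH R m k.+1 (Exact R m k.+1 Phi))%E.
Proof.
move=> hk s00 H; apply: dimH_ge => s s_ge0 ss0.
have [smk|mks] := leP s (m%:R * k%:R).
  exists (m%:R * k%:R + 0); first by rewrite addr0.
  by apply: weighted_columns => //; exact: weighted_dim0.
exists (m%:R * k%:R + (s - m%:R * k%:R)); first by rewrite addrC subrK.
by apply: weighted_columns => //; apply: H; lra.
Qed.

End Dimensions.

Theorem theorem2p3 (R : realType) (m n : nat) (Phi : nat -> R) :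
  (0 < m)%N -> (0 < n)%N ->
  (forall t, 0 < Phi t) ->
  (forall t : nat, (1 <= t)%N -> Phi t <= (t%:R : R) `^ (- (n%:R / m%:R))) ->
  let theta : R := Num.max (n%:R + 1) (m%:R + 2) / m%:R in
  let ta := tau R Phi in
  ((theta%:E < ta)%E ->
     (forall s t : nat, (s <= t)%N -> Phi t <= Phi s) ->
     ((m%:R * (n%:R - 1))%:E
        + match ta with
          | r%:E => ((m%:R + 1) / (1 + r))%:E
          | _ => 0%E
          end <= dimH R m n (Exact R m n Phi))%E)
  /\
  ((Num.max theta ((5 + Num.sqrt 17) / 2))%:E < ta ->
     ((m%:R * (n%:R - 1))%:E <= dimH R m n (Exact R m n Phi))%E /\
     dimP R m n (Exact R m n Phi) = (m%:R * n%:R)%:E)%E.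
Proof.
move=> m_gt0 n_gt0 Phi_gt0 _ theta ta.
have m0 : 0 < m%:R :> R by rewrite ltr0n.
case: n n_gt0 @theta => // k _ theta.
have kE : k.+1%:R - 1 = k%:R :> R by rewrite -natr1 addrK.
have H : (theta%:E < ta)%E -> exists t T0 : R, [/\ m%:R + 2 < t * m%:R, k.+1%:R + 1 < t * m%:R &
    forall q : nat, (0 < q)%N -> T0 <= q%:R -> Phi q <= q%:R `^ (- t)].
  move=> /(tau_gt Phi theta Phi_gt0)[t [T0 [tt hT0]]]; exists t, T0.
  move: tt; rewrite /theta ltr_pdivrMr // gt_max => /andP[? ?]; split => //.
split=> [th Phi_dec|th].
  have [t [T0 [tm tn hT0]]] := H th.
  (* For s0 = 0 the range 0 < s < s0 is empty. This settles infinite tau. *)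
  have dimH0 : ((m%:R * k%:R + 0)%:E <= dimH R m k.+1 (Exact R m k.+1 Phi))%E.
    by apply: (dimH_columns R m t T0) => // s s0 /(lt_trans s0); rewrite ltxx.
  rewrite kE; case taE: ta => [r||]; [|by rewrite -EFinD|by rewrite -EFinD].
  rewrite -EFinD; rewrite taE lte_fin in th.
  have rm : m%:R + 2 < r * m%:R.
    by move: th; rewrite /theta ltr_pdivrMr // gt_max => /andP[].
  have r0 : 0 < r.
    by rewrite -(pmulr_lgt0 _ m0); apply: lt_trans rm; rewrite addr_gt0.
  have r1 : 0 < 1 + r by rewrite addr_gt0.
  apply: (dimH_columns R m t T0) => // [|s s0 sr].
    by rewrite divr_ge0 ?(ltW r1) // addr_ge0 // ltW.
  (* m + 1 <= m (1 + r), because r m > m + 2. *)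
  have sm : s <= m%:R.
    apply: le_trans (ltW sr) _; rewrite ler_pdivrMr //; lra.
  apply: (exact_weighted R m t m_gt0 tm Phi T0) => //; first exact: ltW.
  by apply: (tau_scale m Phi r) => //; exact: ltW.
have {}th : (theta%:E < ta)%E by apply: le_lt_trans th; rewrite lee_fin le_max lexx.
have [t [T0 [tm tn hT0]]] := H th; rewrite kE; split.
  rewrite -[X in X%:E](addr0 (m%:R * k%:R)).
  by apply: (dimH_columns R m t T0) => // s s0 /(lt_trans s0); rewrite ltxx.
apply/eqP; rewrite eq_le dimP_le dimP_ge // => s; exact: (avoid_columns R m t T0).
Qed.
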